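(* For $1\le i\le k\le n-1$ denote by $c^{k,i}$ the element of $\mathbb Z_0^\mu$ for which $c^{k,i}_{l,j}=0$ if $l>k$, or if $l=k$ and $j<i$, and $c^{k,i}_{l,j}=-1$ otherwise. Then $$\mathcal P(\Omega^+(\mathbf 0))=\sum_{1\le i\le k\le n-1}\mathbb N\,c^{k,i},$$ and $\mathcal P(\Omega^+(\mathbf 0))$ coincides with the essential support of the Verma module $M(-\tilde\rho)$, where $\tilde\rho=-(0,1,\dots,n-1)$.
   Context: Fix $n\ge1$; $\mathbb N$ includes $0$. $\mathbb C^\mu=\mathbb C^1\times\mathbb C^2\times\cdots\times\mathbb C^n$, with elements $v=(v_{k,i})_{1\le i\le k\le n}$; $S_\mu=S_1\times\cdots\times S_n$ acts on $\mathbb C^\mu$ by permuting the entries in each row. $\mathbb Z_0^\mu$ is the set of $z\in\mathbb C^\mu$ with integer entries and $z_{n,i}=0$ for all $i$. $\mathbb D(\mathbf 0)$ is the set of $z\in\mathbb Z_0^\mu$ with $z_{k,1}\ge z_{k,2}\ge\cdots\ge z_{k,k}$ for all $k\le n-1$. Put $S_\pi=S_1\times\cdots\times S_{n-1}$, acting on the first $n-1$ rows, and let $(S_\pi)_z$ be the stabilizer of $z$ in $S_\pi$. For $z\in\mathbb D(\mathbf 0)$, $\Omega^+(z)$ is the graph with vertices $[k,i]$, $1\le i\le k\le n$, and an edge $[k,i]-[k-1,j]$ ($2\le k\le n$, $1\le i\le k$, $1\le j\le k-1$) exactly when $z_{k,i}\ge z_{k-1,j}$. For a graph $\Omega$ on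 this vertex set, $\mathcal P(\Omega)=\{z\in\mathbb D(\mathbf 0):\Omega^+(z)=\Omega\}$. (Thus $\mathcal P(\Omega^+(\mathbf 0))$ is the set of $z\in\mathbb D(\mathbf 0)$ with $z_{k,i}\ge z_{k-1,j}$ for all $2\le k\le n$ and all $i,j$.) $U=U(\mathfrak{gl}(n,\mathbb C))$; $\Gamma\subset U$ is the (commutative) Gelfand-Tsetlin subalgebra generated by the centers of $U(\mathfrak{gl}(k,\mathbb C))$, $1\le k\le n$ (top-left-corner inclusions), equivalently by $c_{k,i}=\sum_{(r_1,\dots,r_i)\in\{1,\dots,k\}^i}E_{r_1,r_2}E_{r_2,r_3}\cdots E_{r_i,r_1}$, $1\le i\le k\le n$. Each $v\in\mathbb C^\mu$ defines a character $\chi_v:\Gamma\to\mathbb C$, $c_{k,i}\mapsto\gamma_{k,i}(v)$, where $\gamma_{k,i}=\sum_{j=1}^k(x_{k,j}+k-1)^i\prod_{m\ne j}\bigl(1-\frac1{x_{k,j}-x_{k,m}}\bigr)$ (a polynomial); $\chi_v=\chi_w$ iff $w\in S_\mu v$. For a $U$-module $M$, $M[v]=\{x\in M:(\ker\chi_v)^rx=0\text{ for some }r\ge0\}$. For $\lambda\in\mathbb C^n$ (a weight of the diagonal Cartan subalgebra), $M(\lambda)$ is the Verma module of $\mathfrak{gl}(n,\mathbb C)$ of highest weight $\lambda$ with respect to the Borel subalgebra of upper triangular matrices. The *essential support* of the simple module $M=M(-\tilde\rho)$ is the set of $z\in\mathbb D(\mathbf 0)$ with $M[z]\ne0$ and $\dim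 M[z]=|S_\pi|/|(S_\pi)_z|$. *)

(* Defs.v *)
From HB Require Import structures.
From mathcomp Require Import all_boot all_order all_fingroup all_algebra generic_quotient.
From mathcomp Require Import boolp classical_sets reals complex.
From mathcomp Require Import mpoly.
From mathcomp Require monalg.

Set Implicit Arguments.
Unset Strict Implicit.
Unset Printing Implicit Defensive.

Import Order.TTheory GRing.Theory Num.Theory.
Local Open Scope ring_scope.
Local Open Scope classical_set_scope.

(* Rows and columns are numbered from 0: the index (k, i) of the mathematics,
   with 1 <= i <= k <= n, is [idx k' i'] with k = k'.+1 and i = i'.+1. *)

Section QuotientModule.
Variables (A : pzRingType) (V : lmodType A) (S : set V).

Definition submodule (W : set V) : Prop :=
  W 0 /\ forall (a : A) (x y : V), W x -> W y -> W (a *: x + y).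

Definition span_mod : set V := smallest submodule S.

Lemma span_mod_submodule : submodule span_mod.
Proof.
split=> [W [[]]//|a x y Sx Sy W [Wsub SW]].
by apply: Wsub.2; [apply: Sx|apply: Sy].
Qed.

Definition span_mod_pred : V -> bool := fun x => `[< span_mod x >].

Lemma span_mod_zmod_closed : zmod_closed span_mod_pred.
Proof.
have [s0 sL] := span_mod_submodule.
split=> [|x y]; rewrite !unfold_in; first exact/asboolP.
move=> /asboolP sx /asboolP sy; apply/asboolP.
by rewrite -scaleN1r addrC; apply: sL.
Qed.

HB.instance Definition _ :=
  GRing.isZmodClosed.Build V span_mod_pred span_mod_zmod_closed.

Definition span_mod_closed : zmodClosed V :=
  GRing.ZmodClosed.clone V span_mod_pred _.

Definition quot_mod : Type := {ideal_quot span_mod_closed}.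
HB.instance Definition _ := GRing.Zmodule.on quot_mod.

Definition quot_mod_scale (a : A) (x : quot_mod) : quot_mod :=
  \pi_({ideal_quot span_mod_closed})%qT (a *: repr (x : {ideal_quot span_mod_closed})).

Lemma pi_quot_mod_scale a (x : V) :
  quot_mod_scale a (\pi_({ideal_quot span_mod_closed})%qT x)
  = \pi_({ideal_quot span_mod_closed})%qT (a *: x).
Proof.
have [s0 sL] := span_mod_submodule.
apply/eqP; rewrite -Quotient.idealrBE -scalerBr.
set r := repr _.
have: r - x \in span_mod_pred by rewrite Quotient.idealrBE reprK.
rewrite !unfold_in => /asboolP h; apply/asboolP.
by rewrite -[_ *: _]addr0; apply: sL.
Qed.

Let piP (x : quot_mod) : exists y : V, x = \pi_({ideal_quot span_mod_closed})%qT y.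
Proof. by exists (repr (x : {ideal_quot span_mod_closed})); rewrite reprK. Qed.

Let piD (x y : V) : \pi_({ideal_quot span_mod_closed})%qT x + \pi_({ideal_quot span_mod_closed})%qT y
  = \pi_({ideal_quot span_mod_closed})%qT (x + y) :> quot_mod.
Proof. by rewrite [RHS]raddfD. Qed.

Lemma quot_mod_scaleA a b v :
  quot_mod_scale a (quot_mod_scale b v) = quot_mod_scale (a * b) v.
Proof. by have [x ->] := piP v; rewrite !pi_quot_mod_scale scalerA. Qed.

Lemma quot_mod_scale1 : left_id 1 quot_mod_scale.
Proof. by move=> v; have [x ->] := piP v; rewrite pi_quot_mod_scale scale1r. Qed.

Lemma quot_mod_scaleDr : right_distributive quot_mod_scale +%R.
Proof.
move=> a u v; have [x ->] := piP u; have [y ->] := piP v.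
by rewrite piD !pi_quot_mod_scale piD scalerDr.
Qed.

Lemma quot_mod_scaleDl v : {morph quot_mod_scale^~ v : a b / a + b}.
Proof.
move=> a b; have [x ->] := piP v.
by rewrite !pi_quot_mod_scale piD scalerDl.
Qed.

HB.instance Definition _ := GRing.Zmodule_isLmodule.Build A quot_mod
  quot_mod_scaleA quot_mod_scale1 quot_mod_scaleDr quot_mod_scaleDl.

End QuotientModule.

Section SubalgebrasAndIdeals.
Variables (K : comNzRingType) (A : lalgType K).

Definition subalgebra (B : set A) : Prop :=
  [/\ B 1, (forall (a : K) (x y : A), B x -> B y -> B (a *: x + y))
    & forall x y : A, B x -> B y -> B (x * y)].

Definition span_alg (S : set A) : set A := smallest subalgebra S.

Definition two_sided_ideal (J : set A) : Prop :=
  [/\ J 0, (forall x y : A, J x -> J y -> J (x + y)),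
      (forall a x : A, J x -> J (a * x)) & forall a x : A, J x -> J (x * a)].

Definition span_ideal (S : set A) : set A := smallest two_sided_ideal S.

End SubalgebrasAndIdeals.

(* U(gl_n), presented by the matrix units E_{ij} (a basis of gl_n) and
   E_{ij} E_{kl} - E_{kl} E_{ij} = delta_{jk} E_{il} - delta_{li} E_{kj},
   as a quotient of the free algebra on the words in the symbols (i, j). *)
Section EnvelopingAlgebra.
Import monalg.
Variables (K : fieldType) (n : nat).

Notation word := (fmonom ('I_n * 'I_n)%type).
Notation free := (malg word K).

Definition free_gen (i j : 'I_n) : free := mkmalgU (fmu (i, j)) 1.
Local Notation gen := free_gen.

Definition gl_relations : set free :=
  [set r | exists i j k l : 'I_n, r =
    (gen i j * gen k l - gen k l * gen i j)
    - (gen i l *+ (j == k) - gen k j *+ (l == i))].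

Definition Ugl_ideal : set free := span_ideal gl_relations.

Lemma Ugl_ideal_two_sided : two_sided_ideal Ugl_ideal.
Proof.
split=> [J [[]]//|x y Jx Jy J|a x Jx J|a x Jx J] [Jideal relJ];
  have [_ JD Jl Jr] := Jideal.
- by apply: JD; [apply: Jx|apply: Jy].
- by apply: Jl; apply: Jx.
- by apply: Jr; apply: Jx.
Qed.

Definition Ugl_ideal_pred : free -> bool := fun x => `[< Ugl_ideal x >].

Lemma Ugl_ideal_zmod_closed : zmod_closed Ugl_ideal_pred.
Proof.
have [J0 JD Jl _] := Ugl_ideal_two_sided.
split=> [|x y]; rewrite !unfold_in; first exact/asboolP.
move=> /asboolP sx /asboolP sy; apply/asboolP.
by apply: JD => //; rewrite -mulN1r; apply: Jl.
Qed.

HB.instance Definition _ :=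
  GRing.isZmodClosed.Build free Ugl_ideal_pred Ugl_ideal_zmod_closed.

Definition Ugl_ideal_closed : zmodClosed free :=
  GRing.ZmodClosed.clone free Ugl_ideal_pred _.

Definition Ugl : Type := {ideal_quot Ugl_ideal_closed}.
HB.instance Definition _ := Choice.on Ugl.
HB.instance Definition _ := GRing.Zmodule.on Ugl.

Local Notation pi := (\pi_({ideal_quot Ugl_ideal_closed})%qT).

Definition Ugl_one : Ugl := pi 1.
Definition Ugl_mul (x y : Ugl) : Ugl :=
  pi (repr (x : {ideal_quot Ugl_ideal_closed}) * repr (y : {ideal_quot Ugl_ideal_closed})).
Definition Ugl_scale (a : K) (x : Ugl) : Ugl :=
  pi (a *: repr (x : {ideal_quot Ugl_ideal_closed})).

Lemma repr_pi_Ugl (x : free) : Ugl_ideal (repr (pi x) - x).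
Proof.
have: repr (pi x) - x \in Ugl_ideal_pred by rewrite Quotient.idealrBE reprK.
by rewrite !unfold_in => /asboolP.
Qed.

Lemma pi_Ugl_eq (x y : free) : Ugl_ideal (x - y) -> pi x = pi y.
Proof.
by move=> h; apply/eqP; rewrite -Quotient.idealrBE unfold_in; apply/asboolP.
Qed.

Lemma pi_Ugl_mul (x y : free) : Ugl_mul (pi x) (pi y) = pi (x * y).
Proof.
have [J0 JD Jl Jr] := Ugl_ideal_two_sided.
apply: pi_Ugl_eq; set r := repr _; set s := repr _.
have -> : r * s - x * y = r * (s - y) + (r - x) * y.
  by rewrite mulrBr mulrBl addrA subrK.
by apply: JD; [apply: Jl|apply: Jr]; apply: repr_pi_Ugl.
Qed.

Lemma pi_Ugl_scale a (x : free) : Ugl_scale a (pi x) = pi (a *: x).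
Proof.
have [J0 JD Jl Jr] := Ugl_ideal_two_sided.
apply: pi_Ugl_eq; rewrite -scalerBr -mulr_algl; apply: Jl.
exact: repr_pi_Ugl.
Qed.

Let piP (x : Ugl) : exists y : free, x = pi y.
Proof. by exists (repr (x : {ideal_quot Ugl_ideal_closed})); rewrite reprK. Qed.

Let piD (x y : free) : pi x + pi y = pi (x + y) :> Ugl.
Proof. by rewrite [RHS]raddfD. Qed.

Lemma Ugl_mulA : associative Ugl_mul.
Proof.
move=> u v w; have [x ->] := piP u; have [y ->] := piP v; have [z ->] := piP w.
by rewrite !pi_Ugl_mul mulrA.
Qed.

Lemma Ugl_mul1 : left_id Ugl_one Ugl_mul.
Proof. by move=> u; have [x ->] := piP u; rewrite pi_Ugl_mul mul1r. Qed.

Lemma Ugl_mulr1 : right_id Ugl_one Ugl_mul.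
Proof. by move=> u; have [x ->] := piP u; rewrite pi_Ugl_mul mulr1. Qed.

Lemma Ugl_mulDl : left_distributive Ugl_mul +%R.
Proof.
move=> u v w; have [x ->] := piP u; have [y ->] := piP v; have [z ->] := piP w.
by rewrite piD !pi_Ugl_mul piD mulrDl.
Qed.

Lemma Ugl_mulDr : right_distributive Ugl_mul +%R.
Proof.
move=> u v w; have [x ->] := piP u; have [y ->] := piP v; have [z ->] := piP w.
by rewrite piD !pi_Ugl_mul piD mulrDr.
Qed.

(* The ideal lies in the kernel of the augmentation. *)
Lemma Ugl_one_neq0 : Ugl_one != 0.
Proof.
rewrite /Ugl_one; apply/negP => /eqP h.
have: Ugl_ideal 1.
  have := repr_pi_Ugl 1; have := repr_pi_Ugl 0.
  have [J0 JD Jl _] := Ugl_ideal_two_sided.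
  have -> : pi 1 = pi 0 by rewrite [LHS]h [RHS]raddf0.
  move=> h0 h1; rewrite -[1](subKr (repr (pi 0))) -[X in X - _]subr0.
  by apply: JD => //; rewrite -mulN1r; apply: Jl.
pose aug : free -> K := mcoeff (one : word).
have aug0 : aug 0 = 0 by exact: raddf0.
have augD x y : aug x = 0 -> aug y = 0 -> aug (x + y) = 0.
  by move=> hx hy; rewrite /aug raddfD /= -/(aug x) hx add0r.
have augB x y : aug x = 0 -> aug y = 0 -> aug (x - y) = 0.
  by move=> hx hy; rewrite /aug raddfB /= -/(aug x) hx sub0r -/(aug y) hy oppr0.
have augMn x m : aug x = 0 -> aug (x *+ m) = 0.
  by move=> hx; rewrite /aug raddfMn /= -/(aug x) hx mul0rn.
have [augM aug1] := @mcoeff1g_is_multiplicative word K.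
have augl x y : aug y = 0 -> aug (x * y) = 0.
  by move=> hy; rewrite /aug augM /= -/(aug y) hy mulr0.
have augr x y : aug x = 0 -> aug (x * y) = 0.
  by move=> hx; rewrite /aug augM /= -/(aug x) hx mul0r.
have {}aug1 : aug 1 = 1 := aug1.
have gen0 i j : aug (gen i j) = 0.
  rewrite /aug /gen mcoeffU.
  by case: eqP => // /(congr1 (@fmonom_val _)); rewrite fmuE fm1.
clearbody aug => J1; have : aug 1 = 0.
  apply: (J1 [set x : free | aug x = 0]); split; first split.
  - exact: aug0.
  - exact: augD.
  - exact: augl.
  - by move=> a x; apply: augr.
  move=> _ [i [j [k [l ->]]]].
  apply: (augB); apply: (augB).
  - by apply: augl; apply: gen0.
  - by apply: augl; apply: gen0.
  - by apply: augMn; apply: gen0.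
  - by apply: augMn; apply: gen0.
by rewrite aug1 => /eqP; rewrite oner_eq0.
Qed.

HB.instance Definition _ := GRing.Zmodule_isNzRing.Build Ugl
  Ugl_mulA Ugl_mul1 Ugl_mulr1 Ugl_mulDl Ugl_mulDr Ugl_one_neq0.

Lemma Ugl_scaleA a b v : Ugl_scale a (Ugl_scale b v) = Ugl_scale (a * b) v.
Proof. by have [x ->] := piP v; rewrite !pi_Ugl_scale scalerA. Qed.

Lemma Ugl_scale1 : left_id 1 Ugl_scale.
Proof. by move=> v; have [x ->] := piP v; rewrite pi_Ugl_scale scale1r. Qed.

Lemma Ugl_scaleDr : right_distributive Ugl_scale +%R.
Proof.
move=> a u v; have [x ->] := piP u; have [y ->] := piP v.
by rewrite piD !pi_Ugl_scale piD scalerDr.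
Qed.

Lemma Ugl_scaleDl v : {morph Ugl_scale^~ v : a b / a + b}.
Proof.
move=> a b; have [x ->] := piP v.
by rewrite !pi_Ugl_scale piD scalerDl.
Qed.

Lemma Ugl_scale0 v : Ugl_scale 0 v = 0.
Proof. by apply: (addIr (Ugl_scale 1 v)); rewrite -Ugl_scaleDl !add0r. Qed.

HB.instance Definition _ := GRing.Nmodule_isLSemiModule.Build K Ugl
  Ugl_scaleA Ugl_scale0 Ugl_scale1 Ugl_scaleDr Ugl_scaleDl.

Lemma Ugl_scaleAl (a : K) (u v : Ugl) : a *: (u * v) = (a *: u) * v.
Proof.
have [x ->] := piP u; have [y ->] := piP v.
rewrite [LHS](congr1 (Ugl_scale a) (pi_Ugl_mul x y)) pi_Ugl_scale.
rewrite [in RHS](pi_Ugl_scale a x : a *: (pi x : Ugl) = pi (a *: x)).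
by rewrite [RHS]pi_Ugl_mul scalerAl.
Qed.

HB.instance Definition _ := GRing.Lmodule_isLalgebra.Build K Ugl Ugl_scaleAl.

Definition E (i j : 'I_n) : Ugl := pi (gen i j).

End EnvelopingAlgebra.

Arguments E {K n} i j.

Section Patterns.
Variable n : nat.

(* The index set of C^mu: the k-th row has k.+1 entries. *)
Definition mu : Type := {k : 'I_n & 'I_k.+1}.
HB.instance Definition _ := Finite.on mu.

Definition idx (k : 'I_n) (i : 'I_k.+1) : mu :=
  Tagged (fun k : 'I_n => 'I_k.+1) i.

(* Elements of C^mu with integer entries are represented by {ffun mu -> int}. *)
Definition Zmu0 : set {ffun mu -> int} :=
  [set z | forall a : mu, (tag a).+1 = n -> z a = 0].

Definition D0 : set {ffun mu -> int} :=
  [set z | Zmu0 z /\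
    forall (k : 'I_n) (i j : 'I_k.+1), (k.+1 < n)%N -> (i <= j)%N ->
      z (idx j) <= z (idx i)].

(* A graph with vertex set mu is given by its set of (unoriented) edges. *)
Definition Omega_plus (z : {ffun mu -> int}) : {set {set mu}} :=
  [set [set p.1; p.2] | p : mu * mu &
    ((tag p.1 : nat) == (tag p.2).+1) && (z p.2 <= z p.1)]%SET.

Definition P_Omega (Om : {set {set mu}}) : set {ffun mu -> int} :=
  [set z | D0 z /\ Omega_plus z = Om].

(* The vector c^{k,i}, for the index a = [k, i]. *)
Definition c_vec (a : mu) : {ffun mu -> int} :=
  [ffun b : mu =>
    if (tag a < tag b)%N
       || ((tag b == tag a :> nat) && (tagged b < tagged a)%N)
    then 0 else -1].

Definition S_mu : Type := {dffun forall k : 'I_n, 'S_k.+1}.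
HB.instance Definition _ := Finite.on S_mu.

(* S_1 x ... x S_{n-1}, as the subgroup of S_mu acting trivially on the last
   row. *)
Definition S_pi : {set S_mu} :=
  [set s : S_mu | [forall k : 'I_n, (k.+1 == n) ==> (s k == 1%g)]]%SET.

Definition permute (s : S_mu) (z : {ffun mu -> int}) : {ffun mu -> int} :=
  [ffun a : mu => z (idx (s (tag a) (tagged a)))].

Definition stab (z : {ffun mu -> int}) : {set S_mu} :=
  [set s in S_pi | permute s z == z]%SET.

End Patterns.

Arguments idx {n k} i.

Section GelfandTsetlin.
Variables (K : fieldType) (n : nat).

(* The rational function gamma_{k,i} in x_{k,1}, ..., x_{k,k}, and the
   polynomial that it is equal to. *)
Definition gamma_rat (k i : nat) : {fraction {mpoly K[k]}} :=
  \sum_(j < k) tofrac ('X_j + k%:R - 1) ^+ i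
    * \prod_(m < k | m != j) (1 - 1 / (tofrac 'X_j - tofrac 'X_m)).

Definition gamma (k i : nat) : {mpoly K[k]} :=
  xget 0 [set p : {mpoly K[k]} | tofrac p = gamma_rat k i].

Definition gamma_at (v : {ffun mu n -> K}) (a : mu n) : K :=
  (gamma (tag a).+1 (tagged a).+1).@[fun j : 'I_(tag a).+1 => v (idx j)].

(* c_{k,i} = sum over r_1, ..., r_i <= k of E_{r_1 r_2} E_{r_2 r_3} ...
   E_{r_i r_1}; [ordS] is the cyclic successor on 'I_i. *)
Definition gt_gen (a : mu n) : Ugl K n :=
  let i := (tagged a).+1 in
  let emb : 'I_(tag a).+1 -> 'I_n := widen_ord (ltn_ord (tag a)) in
  \sum_(r : {ffun 'I_i -> 'I_(tag a).+1})
    \prod_(t < i) E (emb (r t)) (emb (r (ordS t))).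

Definition Gamma : set (Ugl K n) := span_alg (range gt_gen).

(* Only the restriction of f to Gamma is constrained. *)
Definition is_Gamma_character (v : {ffun mu n -> K}) (f : Ugl K n -> K) : Prop :=
  [/\ f 1 = 1,
      (forall (a : K) (x y : Ugl K n), Gamma x -> Gamma y ->
         f (a *: x + y) = a * f x + f y),
      (forall x y : Ugl K n, Gamma x -> Gamma y -> f (x * y) = f x * f y)
    & forall a : mu n, f (gt_gen a) = gamma_at v a].

Definition chi (v : {ffun mu n -> K}) : Ugl K n -> K :=
  xget (fun=> 0) (is_Gamma_character v).

Definition ker_chi (v : {ffun mu n -> K}) : set (Ugl K n) :=
  [set x | Gamma x /\ chi v x = 0].

(* (ker chi_v)^r is spanned by the products of r elements of ker chi_v. *)
Definition gt_space (M : lmodType (Ugl K n)) (v : {ffun mu n -> K}) : set M :=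
  [set x | exists r : nat, forall y : 'I_r -> Ugl K n,
    (forall t, ker_chi v (y t)) -> (\prod_(t < r) y t) *: x = 0].
Arguments gt_space M v : clear implicits.

(* The subspace W has a basis of d elements over the ground field, which acts
   through its image in the enveloping algebra. *)
Definition has_dim (M : lmodType (Ugl K n)) (W : set M) (d : nat) : Prop :=
  exists b : 'I_d -> M,
  [/\ forall t, W (b t),
      forall a : 'I_d -> K,
        \sum_(t < d) (a t)%:A *: b t = 0 -> forall t, a t = 0
    & forall x, W x -> exists a : 'I_d -> K, x = \sum_(t < d) (a t)%:A *: b t].

Definition of_int (z : {ffun mu n -> int}) : {ffun mu n -> K} :=
  [ffun a => (z a)%:~R].

Definition essential_support (M : lmodType (Ugl K n)) : set {ffun mu n -> int} :=
  [set z | [/\ D0 z, exists2 x : M, gt_space M (of_int z) x & x != 0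
    & has_dim (gt_space M (of_int z)) (#|S_pi n| %/ #|stab z|)]].

(* The Verma module U / (sum_{i<j} U E_{ij} + sum_i U (E_{ii} - lam_i)). *)
Definition verma (lam : 'I_n -> K) : lmodType (Ugl K n) :=
  @quot_mod (Ugl K n) ((Ugl K n)^o)
    [set x | (exists i j : 'I_n, (i < j)%N /\ x = E i j)
          \/ exists i : 'I_n, x = E i i - (lam i)%:A].

Definition rho_tilde (i : 'I_n) : K := - i%:R.

End GelfandTsetlin.

Arguments gt_space {K n} M v.

(* Main.v *)
From HB Require Import structures.
Require Import Defs.
From mathcomp Require Import all_boot all_order all_fingroup all_algebra generic_quotient.
From mathcomp Require Import boolp classical_sets reals complex.
From mathcomp Require Import mpoly ring zify.
From mathcomp Require monalg.

(* Write M = M(-rho~), of highest weight (0, 1, ..., n-1), with highest weight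
   vector v.  The ordered products m_a = F_0 F_1 ... F_{n-1} v, where F_r is a
   monomial with exponents a(r, j) in the E_{rj}, j < r, form a basis of M:
   they span by induction along gl_1 < gl_2 < ... < gl_n, and they are free
   because U(gl_n) acts on a polynomial ring by differential operators, in such
   a way that m_a acts on 1 with leading monomial t^a.  The factors of m_a in
   the rows r > k produce, modulo vectors m_b that are larger for a suitable
   order, a highest weight vector for gl_k.  So Gamma is triangular in the basis
   (m_a), and its diagonal characters are the chi_w with w(a)_{k,i} =
   - sum_{r > k} a(r, i) (rows and columns are numbered from 0).  The a
   correspond to the w with a zero last row and w_{k,i} <= w_{k+1,i}; hence
   dim M[z] is the number of such interlacing w in the orbit S_pi z.  This number
   is |S_pi z| exactly when all elements of the orbit are interlacing, that is,
   when z_{k,i} <= z_{k+1,j} for all i and j.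

   These inequalities say that the entries of z, read from the last row up and
   from left to right, form a decreasing sequence of nonpositive integers; the
   c^{k,i} are the indicators (up to sign) of the final segments of this chain. *)

Set Implicit Arguments.
Unset Strict Implicit.
Unset Printing Implicit Defensive.

Import Order.TTheory GRing.Theory Num.Theory.
Local Open Scope ring_scope.
Local Open Scope classical_set_scope.

(** * The enveloping algebra *)

(** Several points lie between triangularity and the count. The eigenvalue of a Casimir element on a
    highest weight vector arises as a recursion ([hwt]) that makes sense for every weight, whereas
    gamma_{k,i} is given by fractions that break down when two entries of a row coincide, as they do
    in the zero pattern. The two are compared for indeterminate entries, over a fraction field, and
    then specialized. That the gamma_{k,i} determine a row up to permutation comes from a generating
    function, in characteristic 0. A triangular action on an infinite basis yields dimensions
    because Gamma preserves weights, hence finite sets of monomials. The character chi_z is defined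
    by choice: for interlacing z a character is found on the diagonal of the triangular action, and
    where there is no character the default value of [chi] makes M[z] zero. Finally, the weight (0,
    1, ..., n-1) is the one whose entries cancel the rho-shifts, so that v itself has the zero
    pattern. *)

Section UglTheory.
Import monalg.
Variables (K : fieldType) (n : nat).
Local Notation free := (malg (fmonom ('I_n * 'I_n)%type) K).
Local Notation U := (Ugl K n).
Local Notation pi := (\pi_({ideal_quot Ugl_ideal_closed K n})%qT).

Lemma Ugl_piP (x : U) : exists y : free, x = pi y.
Proof. by exists (repr (x : {ideal_quot Ugl_ideal_closed K n})); rewrite reprK. Qed.

Lemma Ugl_piM (x y : free) : (pi x : U) * (pi y : U) = (pi (x * y) : U).
Proof. exact: pi_Ugl_mul. Qed.

Lemma Ugl_piZ a (x : free) : a *: (pi x : U) = (pi (a *: x) : U).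
Proof. exact: pi_Ugl_scale. Qed.

Lemma malg_scalerAr (a : K) (x y : free) : a *: (x * y) = x * (a *: y).
Proof.
apply/malgP => k; rewrite mcoeffZ mcoeffMl.
rewrite (mcoeffMlw k (finmap.fsubset_refl _) (@msuppZ_le _ _ a y)) mulr_sumr.
apply: eq_bigr => i _; rewrite mulr_sumr; apply: eq_bigr => j _.
by rewrite mcoeffZ mulrnAr mulrCA.
Qed.

Lemma Ugl_scalerAr (a : K) (x y : U) : a *: (x * y) = x * (a *: y).
Proof.
have [u ->] := Ugl_piP x; have [w ->] := Ugl_piP y.
by rewrite !(Ugl_piM, Ugl_piZ) malg_scalerAr.
Qed.

HB.instance Definition _ := GRing.Lalgebra_isAlgebra.Build K U Ugl_scalerAr.

Lemma Ugl_comm (i j k l : 'I_n) :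
  E i j * E k l = E k l * E i j + (E i l *+ (j == k) - E k j *+ (l == i)) :> U.
Proof.
apply/eqP; rewrite -subr_eq0 opprD addrA subr_eq0; apply/eqP.
rewrite /E !Ugl_piM -!(raddfMn pi) -!(raddfB pi) /=.
apply: pi_Ugl_eq => J [_ JU]; apply: JU.
by exists i, j, k, l.
Qed.

(** Every element is a combination of words and a word is a product of generators. This serves as
    the induction principle for U. *)
Lemma Ugl_genP (P : set U) : subalgebra P -> (forall i j, P (E i j)) ->
  forall x, P x.
Proof.
move=> [P1 PL PM] PE x; have [u ->] := Ugl_piP x.
have P0 : P 0 by rewrite -[0](addrN 1) addrC -scaleN1r; apply: PL.
have PD (y z : U) : P y -> P z -> P (y + z).
  by move=> Py Pz; rewrite -[y]scale1r; apply: PL.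
have PZ a (y : U) : P y -> P (a *: y).
  by move=> Py; rewrite -[a *: y]addr0; apply: PL.
rewrite [u]monalgE raddf_sum /=; apply: (big_ind P) => // w _.
have -> : mkmalgU w (mcoeff w u) = (mcoeff w u) *: mkmalgU w 1.
  by apply/malgP => k; rewrite mcoeffZ !mcoeffU mulr_natr.
rewrite -Ugl_piZ; apply: PZ.
case: w => w; elim: w => [|[i j] w IHw]; first by rewrite -fmoneE; exact: P1.
have -> : mkmalgU (FMonom ((i, j) :: w)) 1 = free_gen K i j * mkmalgU (FMonom w) 1.
  rewrite /free_gen malgM_def fgmulUU mulr1 /mul /=.
  by congr mkmalgU; rewrite fmmulE fmuE.
by rewrite -Ugl_piM; apply: PM => //; apply: PE.
Qed.

Section Action.
Variables (m : nat) (op : 'I_n -> 'I_n -> (mpoly.mpoly m K) -> (mpoly.mpoly m K)).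
Hypothesis op_lin : forall i j, linear (op i j).
Hypothesis op_comm : forall i j k l p,
  op i j (op k l p) = op k l (op i j p)
    + (op i l p *+ (j == k) - op k j p *+ (l == i)).

Let act_word (w : fmonom ('I_n * 'I_n)%type) (p : (mpoly.mpoly m K)) :=
  foldr (fun ij => op ij.1 ij.2) p (w : seq _).

Let act (x : free) p := mmap (@mpolyC m K) (fun w => act_word w p) x.

Let opD i j p q : op i j (p + q) = op i j p + op i j q.
Proof. by have := op_lin i j 1 p q; rewrite !scale1r. Qed.

Let op0 i j : op i j 0 = 0.
Proof. by apply: (addrI (op i j 0)); rewrite -opD !addr0. Qed.

Let opZ i j a p : op i j (a *: p) = a *: op i j p.
Proof. by have := op_lin i j a p 0; rewrite !addr0 op0 addr0. Qed.

Let act_wordL w a p q : act_word w (a *: p + q) = a *: act_word w p + act_word w q.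
Proof.
rewrite /act_word; elim: (w : seq _) => //= -[i j] s ->.
by rewrite opD opZ.
Qed.

Let act_linl p a x y : act (a *: x + y) p = a *: act x p + act y p.
Proof.
rewrite /act raddfD /= (mmapEw (@msuppZ_le _ _ a x)) scaler_sumr.
congr (_ + _); apply: eq_bigr => w _.
by rewrite /= monalg.mcoeffZ mpoly.mpolyCM -mulrA mul_mpolyC.
Qed.

Let act_linr x a p q : act x (a *: p + q) = a *: act x p + act x q.
Proof.
rewrite /act !mmapE scaler_sumr -big_split /=; apply: eq_bigr => w _.
by rewrite act_wordL mulrDr scalerAr.
Qed.

Let actU c w p : act (mkmalgU w c) p = c *: act_word w p.
Proof. by rewrite /act mmapU mul_mpolyC. Qed.

Let act0l p : act 0 p = 0.
Proof. exact: mmap0. Qed.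

Let actDl p x y : act (x + y) p = act x p + act y p.
Proof. by have := act_linl p 1 x y; rewrite !scale1r. Qed.

Let actDr x p q : act x (p + q) = act x p + act x q.
Proof. by have := act_linr x 1 p q; rewrite !scale1r. Qed.

Let act0r x : act x 0 = 0.
Proof. by apply: (addrI (act x 0)); rewrite -actDr !addr0. Qed.

Let malg_ind (P : free -> Prop) : P 0 -> (forall x y, P x -> P y -> P (x + y)) ->
  (forall w c, P (mkmalgU w c)) -> forall x, P x.
Proof. by move=> P0 PD PU x; rewrite [x]monalgE; apply: big_ind => // w _. Qed.

Let actM x y p : act (x * y) p = act x (act y p).
Proof.
elim/malg_ind: x => [|x1 x2 h1 h2|w c]; first by rewrite mul0r !act0l.
  by rewrite mulrDl !actDl h1 h2.
elim/malg_ind: y => [|y1 y2 h1 h2|w' c']; first by rewrite mulr0 act0l act0r.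
  by rewrite mulrDr !actDl actDr h1 h2.
have actZr u a q : act u (a *: q) = a *: act u q.
  by have := act_linr u a q 0; rewrite !addr0 act0r addr0.
rewrite malgM_def fgmulUU (actU c') actZr !actU scalerA mulrC; congr (_ *: _).
by rewrite /act_word fmM foldr_cat.
Qed.

Let act_gen i j p : act (free_gen K i j) p = op i j p.
Proof. by rewrite /free_gen actU scale1r /act_word fmuE. Qed.

Let act_ideal x p : Ugl_ideal x -> act x p = 0.
Proof.
move=> /(_ [set x | forall p, act x p = 0]); apply; split; first split.
- by move=> q; rewrite act0l.
- by move=> y z hy hz q; rewrite actDl hy hz addr0.
- by move=> a y hy q; rewrite actM hy act0r.
- by move=> a y hy q; rewrite actM.
move=> _ [i [j [k [l ->]]]] q.
have actN y r : act (- y) r = - act y r.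
  by apply: (addrI (act y r)); rewrite -actDl !subrr act0l.
have actMn y r d : act (y *+ d) r = act y r *+ d.
  by elim: d => [|d IHd]; rewrite ?act0l // !mulrS actDl IHd.
rewrite !(actDl, actN, actM, actMn) !act_gen (op_comm i j k l q).
by rewrite [op k l _ + _]addrC addrK subrr.
Qed.

(** The free algebra acts through words; by [op_comm] the relations, hence the ideal they generate,
    act by 0, so that acting through any representative is well defined. *)
Lemma Ugl_action : exists rho : U -> (mpoly.mpoly m K) -> (mpoly.mpoly m K),
  [/\ forall p, rho 1 p = p,
      forall a u u' p, rho (a *: u + u') p = a *: rho u p + rho u' p,
      forall u u' p, rho (u * u') p = rho u (rho u' p)
    & forall i j p, rho (E i j) p = op i j p].
Proof.
pose rho (u : U) := act (repr (u : {ideal_quot Ugl_ideal_closed K n})).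
have rho_pi x p : rho (pi x) p = act x p.
  rewrite /rho; set y := repr _.
  by rewrite -(subrK x y) actDl act_ideal ?add0r //; apply: repr_pi_Ugl.
exists rho; split.
- by move=> p; rewrite rho_pi [act _ _]actU scale1r /act_word fm1.
- move=> a u u' p; have [x ->] := Ugl_piP u; have [y ->] := Ugl_piP u'.
  rewrite Ugl_piZ -[pi _ + pi y]raddfD !rho_pi; exact: act_linl.
- move=> u u' p; have [x ->] := Ugl_piP u; have [y ->] := Ugl_piP u'.
  by rewrite Ugl_piM !rho_pi actM.
- by move=> i j p; rewrite rho_pi act_gen.
Qed.
End Action.

End UglTheory.

(** * Polynomial representations *)

Section Extension.
Variables (K : fieldType) (N : comAlgType K) (k : nat) (c : K).
Variables (T D : nat -> {linear N -> N}) (e : nat -> nat -> {linear N -> N}).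

Definition ext_euler (p : N) : N := \sum_(l < k) T l (D l p).

Definition ext_mix (i : nat) (p : N) : N := \sum_(l < k) e i l (D l p).

(* From an action e of gl_k to one of gl_(k+1): the vectors E_{k,0}^a_0 ...
   E_{k,k-1}^a_(k-1) x, with x in a gl_k-module on which E_kk acts by c and the
   E_ik by 0, are written t^a x; then T j is the multiplication by t_j, D j is
   the partial derivative in t_j, and the formulas are those of the action on
   these vectors. *)
Definition ext_op (i j : nat) (p : N) : N :=
  if (i < k)%N then
    if (j < k)%N then e i j p - T j (D i p)
    else ext_mix i p - c *: D i p - ext_euler (D i p)
  else if (j < k)%N then T j p else c *: p + ext_euler p.

Lemma ext_euler_is_linear : linear ext_euler.
Proof.
move=> a p q; rewrite scaler_sumr -big_split /=.
by apply: eq_bigr => l _; rewrite !linearP.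
Qed.
HB.instance Definition _ := GRing.isLinear.Build K N N *:%R ext_euler ext_euler_is_linear.

Lemma ext_mix_is_linear i : linear (ext_mix i).
Proof.
move=> a p q; rewrite scaler_sumr -big_split /=.
by apply: eq_bigr => l _; rewrite !linearP.
Qed.
HB.instance Definition _ i := GRing.isLinear.Build K N N *:%R (ext_mix i) (ext_mix_is_linear i).

Lemma ext_op_is_linear i j : linear (ext_op i j).
Proof.
have AC (a b x y : N) : a + b + (x + y) = a + x + (b + y) by rewrite addrACA.
move=> a p q; rewrite /ext_op; case: ifP => _; case: ifP => _; rewrite !linearP //=.
- by rewrite !(scalerDr, scalerN, opprD) AC.
- rewrite !(scalerDr, scalerN, opprD).
  by rewrite [X in X + _ = _]addrACA [LHS]addrACA.
- by rewrite !scalerA [c * a]mulrC AC.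
Qed.
HB.instance Definition _ i j := GRing.isLinear.Build K N N *:%R (ext_op i j) (ext_op_is_linear i j).

Definition ext_linear i j : {linear N -> N} := GRing.Linear.clone _ _ _ _ (ext_op i j) _.

Hypothesis TT : forall i j p, (i < k)%N -> (j < k)%N -> T i (T j p) = T j (T i p).
Hypothesis DD : forall i j p, (i < k)%N -> (j < k)%N -> D i (D j p) = D j (D i p).
Hypothesis DT : forall i j p, (i < k)%N -> (j < k)%N ->
  D i (T j p) = T j (D i p) + p *+ (i == j).
Hypothesis eT : forall i j l p, (i < k)%N -> (j < k)%N -> (l < k)%N ->
  e i j (T l p) = T l (e i j p).
Hypothesis eD : forall i j l p, (i < k)%N -> (j < k)%N -> (l < k)%N ->
  e i j (D l p) = D l (e i j p).
Hypothesis ee : forall i j q r p, (i < k)%N -> (j < k)%N -> (q < k)%N -> (r < k)%N ->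
  e i j (e q r p) = e q r (e i j p) + (e i r p *+ (j == q) - e q j p *+ (r == i)).

Let sum_delta i (F : nat -> N) : (i < k)%N ->
  \sum_(l < k) F l *+ (l == i :> nat) = F i.
Proof.
move=> ik; rewrite (bigD1 (Ordinal ik)) //= eqxx big1 ?addr0 // => l.
by rewrite -val_eqE /= => /negbTE->.
Qed.

Let eulerT j p : (j < k)%N -> ext_euler (T j p) = T j (ext_euler p) + T j p.
Proof.
move=> jk; rewrite /ext_euler linear_sum /= -{2}(sum_delta (fun l => T l p) jk).
rewrite -big_split /=; apply: eq_bigr => l _.
by rewrite DT // linearD linearMn /= TT.
Qed.

Let Deuler j p : (j < k)%N -> D j (ext_euler p) = ext_euler (D j p) + D j p.
Proof.
move=> jk; rewrite /ext_euler linear_sum /= -{2}(sum_delta (fun l => D l p) jk).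
rewrite -big_split /=; apply: eq_bigr => l _.
by rewrite DT // eq_sym DD.
Qed.

Let eeuler i j p : (i < k)%N -> (j < k)%N -> e i j (ext_euler p) = ext_euler (e i j p).
Proof.
move=> ik jk; rewrite linear_sum; apply: eq_bigr => l _.
by rewrite eT // eD.
Qed.

Let mixT i j p : (i < k)%N -> (j < k)%N -> ext_mix i (T j p) = T j (ext_mix i p) + e i j p.
Proof.
move=> ik jk; rewrite /ext_mix linear_sum -(sum_delta (fun l => e i l p) jk).
rewrite -big_split /=; apply: eq_bigr => l _.
by rewrite DT // linearD linearMn /= eT.
Qed.

Let mixD i j p : (i < k)%N -> (j < k)%N -> ext_mix i (D j p) = D j (ext_mix i p).
Proof.
move=> ik jk; rewrite linear_sum; apply: eq_bigr => l _ /=.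
by rewrite DD // eD.
Qed.

Let mixeuler i p : (i < k)%N -> ext_mix i (ext_euler p) = ext_euler (ext_mix i p) + ext_mix i p.
Proof.
move=> ik; rewrite {1 2 3}/ext_mix linear_sum -big_split /=.
by apply: eq_bigr => l _; rewrite Deuler // linearD /= eeuler.
Qed.

Let emix i j q p : (i < k)%N -> (j < k)%N -> (q < k)%N ->
  e i j (ext_mix q p) = ext_mix q (e i j p) + (ext_mix i p *+ (j == q) - e q j (D i p)).
Proof.
move=> ik jk qk; rewrite [in LHS]/ext_mix linear_sum /=.
rewrite -(sum_delta (fun l => e q j (D l p)) ik) -sumrMnl -sumrB -big_split /=.
by apply: eq_bigr => l _; rewrite ee // -eD.
Qed.

Let mixmix i q p : (i < k)%N -> (q < k)%N ->
  ext_mix i (ext_mix q p)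
  = ext_mix q (ext_mix i p) + (ext_mix i (D q p) - ext_mix q (D i p)).
Proof.
move=> ik qk.
have -> : ext_mix i (ext_mix q p) = \sum_(l < k) (ext_mix q (e i l (D l p))
    + (ext_mix i (D l p) *+ (l == q :> nat) - e q l (D i (D l p)))).
  by apply: eq_bigr => l _; rewrite -mixD // emix.
rewrite big_split /= sumrB (sum_delta (fun l => ext_mix i (D l p)) qk).
rewrite [ext_mix q (ext_mix i p)]linear_sum; congr (_ + (_ - _)).
by apply: eq_bigr => l _; rewrite DD.
Qed.

Let opll i j p : (i < k)%N -> (j < k)%N -> ext_op i j p = e i j p - T j (D i p).
Proof. by rewrite /ext_op => -> ->. Qed.

(** The scalar [c] is written as the factor [c%:A], so that the identities below can be closed by
    [ring]. *)
Let oplk i p : (i < k)%N ->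
  ext_op i k p = ext_mix i p - c%:A * D i p - ext_euler (D i p).
Proof. by rewrite /ext_op ltnn mulr_algl => ->. Qed.

Let opkl j p : (j < k)%N -> ext_op k j p = T j p.
Proof. by rewrite /ext_op ltnn => ->. Qed.

Let opkk p : ext_op k k p = c%:A * p + ext_euler p.
Proof. by rewrite /ext_op ltnn mulr_algl. Qed.

Let linA (f : {linear N -> N}) p : f (c%:A * p) = c%:A * f p.
Proof. by rewrite !mulr_algl linearZ. Qed.

Let op_comm i j q r := forall p,
  ext_op i j (ext_op q r p) = ext_op q r (ext_op i j p)
    + (ext_op i r p *+ (j == q) - ext_op q j p *+ (r == i)).

Let op_comm_sym i j q r : op_comm i j q r -> op_comm q r i j.
Proof. by move=> h p; rewrite h; ring. Qed.

Let neqk i : (i < k)%N -> ((i == k) = false) * ((k == i) = false).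
Proof. by rewrite (eq_sym k) ltn_neqAle => /andP[/negbTE-> _]. Qed.

Let comm_ll_ll i j q r : (i < k)%N -> (j < k)%N -> (q < k)%N -> (r < k)%N ->
  op_comm i j q r.
Proof.
move=> ik jk qk rk p; rewrite !opll // !(linearB, linearD) /= ee //.
rewrite !(eT, eD) // !DT // !linearD !linearMn /= (TT _ jk rk) (DD _ ik qk).
case: eqVneq => [->|_]; case: eqVneq => [->|_]; rewrite ?eqxx ?mulr1n ?mulr0n; ring.
Qed.

Let comm_ll_kl i j r : (i < k)%N -> (j < k)%N -> (r < k)%N -> op_comm i j k r.
Proof.
move=> ik jk rk p; rewrite neqk // mulr0n.
rewrite !opkl // !opll // !(linearB, linearD) /=.
rewrite eT // DT // linearD linearMn /= (TT _ jk rk).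
case: eqVneq => [->|_]; rewrite ?eqxx ?mulr1n ?mulr0n; ring.
Qed.

Let comm_ll_kk i j : (i < k)%N -> (j < k)%N -> op_comm i j k k.
Proof.
move=> ik jk p; rewrite !neqk // !mulr0n !opkk !opll // !(linearB, linearD) /=.
rewrite !linA eeuler // Deuler // eulerT // !linearD /=.
ring.
Qed.

Let lkT q j p : (q < k)%N -> (j < k)%N -> ext_op q k (T j p)
  = T j (ext_op q k p) + ext_op q j p - (c%:A * p + ext_euler p) *+ (j == q).
Proof.
move=> qk jk; rewrite !oplk // opll // mixT // DT // !(linearB, linearD) /=.
rewrite eulerT // !linA linearMn /= eq_sym.
case: eqVneq => [->|_]; rewrite ?eqxx ?mulr1n ?mulr0n; ring.
Qed.

Let lkD q i p : (q < k)%N -> (i < k)%N ->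
  ext_op q k (D i p) = D i (ext_op q k p) + D i (D q p).
Proof.
move=> qk ik; rewrite !oplk // mixD // (DD _ qk ik) !(linearB, linearD) /=.
rewrite Deuler // !linA; ring.
Qed.

Let lkeuler q p : (q < k)%N ->
  ext_op q k (ext_euler p) = ext_euler (ext_op q k p) + ext_op q k p.
Proof.
move=> qk; rewrite !oplk // mixeuler // Deuler // !(linearB, linearD) /=.
rewrite !linA; ring.
Qed.

Let elk i j q p : (i < k)%N -> (j < k)%N -> (q < k)%N ->
  e i j (ext_op q k p) = ext_op q k (e i j p)
    + (ext_mix i p *+ (j == q) - e q j (D i p)).
Proof.
move=> ik jk qk; rewrite !oplk // !(linearB, linearD) /= emix // linA.
rewrite eeuler // !eD //; ring.
Qed.

Let comm_ll_lk i j q : (i < k)%N -> (j < k)%N -> (q < k)%N -> op_comm i j q k.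
Proof.
move=> ik jk qk p; rewrite neqk // mulr0n.
rewrite [ext_op i j _]opll // [ext_op i j p]opll // !(linearB, linearD) /=.
rewrite elk // lkT // lkD // [ext_op q j _]opll //.
have -> : D i (ext_op q k p) = ext_op q k (D i p) - D i (D q p) by rewrite lkD //; ring.
rewrite !oplk // !(linearB, linearD) /= !(DD _ qk ik).
case: eqVneq => [->|_]; rewrite ?eqxx ?mulr1n ?mulr0n; ring.
Qed.

Let comm_kl_kl j r : (j < k)%N -> (r < k)%N -> op_comm k j k r.
Proof. by move=> jk rk p; rewrite !(neqk jk) !(neqk rk) !mulr0n !opkl // TT // subr0 addr0. Qed.

Let comm_kl_kk j : (j < k)%N -> op_comm k j k k.
Proof.
move=> jk p; rewrite (neqk jk) eqxx mulr0n mulr1n !opkk !opkl // eulerT //.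
rewrite !linearD /= linA; ring.
Qed.

Let comm_lk_kl q j : (q < k)%N -> (j < k)%N -> op_comm q k k j.
Proof.
move=> qk jk p; rewrite eqxx !(opkl _ jk) lkT // opkk mulr1n; ring.
Qed.

Let comm_kk_kk : op_comm k k k k.
Proof. by move=> p; rewrite subrr addr0. Qed.

Let comm_lk_kk q : (q < k)%N -> op_comm q k k k.
Proof.
move=> qk p; rewrite (neqk qk) eqxx mulr0n mulr1n !opkk linearD /= lkeuler //.
by rewrite !mulr_algl linearZ /=; ring.
Qed.

Let comm_lk_lk i q : (i < k)%N -> (q < k)%N -> op_comm i k q k.
Proof.
move=> ik qk p; rewrite (neqk ik) (neqk qk) !mulr0n subr0 addr0.
rewrite !(oplk _ ik) !(oplk _ qk) !(linearB, linearD) /= !linA /=.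
rewrite !mixeuler // mixmix // !mixD // !Deuler // !linearD /= (DD _ ik qk).
ring.
Qed.

(** By hypothesis the T and D form a Weyl algebra commuting with the action e of gl_k. Each index is
    k or below k; of the 16 resulting cases, 6 follow from others by exchanging the two
    operators. *)
Lemma ext_op_comm i j q r p :
  (i <= k)%N -> (j <= k)%N -> (q <= k)%N -> (r <= k)%N ->
  ext_op i j (ext_op q r p) = ext_op q r (ext_op i j p)
    + (ext_op i r p *+ (j == q) - ext_op q j p *+ (r == i)).
Proof.
have leqk l : (l <= k)%N -> l = k \/ (l < k)%N.
  by rewrite leq_eqVlt => /predU1P.
move=> /leqk hi /leqk hj /leqk hq /leqk hr; move: p; rewrite -/(op_comm i j q r).
case: hi hj hq hr => [->|ik] [->|jk] [->|qk] [->|rk].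
- exact: comm_kk_kk.
- exact/op_comm_sym/(comm_kl_kk rk).
- exact/op_comm_sym/(comm_lk_kk qk).
- exact/op_comm_sym/(comm_ll_kk qk rk).
- exact: (comm_kl_kk jk).
- exact: (comm_kl_kl jk rk).
- exact/op_comm_sym/(comm_lk_kl qk jk).
- exact/op_comm_sym/(comm_ll_kl qk rk jk).
- exact: (comm_lk_kk ik).
- exact: (comm_lk_kl ik rk).
- exact: (comm_lk_lk ik qk).
- exact/op_comm_sym/(comm_ll_lk qk rk ik).
- exact: (comm_ll_kk ik jk).
- exact: (comm_ll_kl ik jk rk).
- exact: (comm_ll_lk ik jk qk).
- exact: (comm_ll_ll ik jk qk rk).
Qed.

End Extension.

Section GTMonomials.
Variables (n : nat) (U : nzRingType) (E : 'I_n -> 'I_n -> U).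
Local Notation expo := {ffun 'I_n * 'I_n -> nat}.

Definition row_mon (a : expo) (r : 'I_n) : U :=
  \prod_(j < n | (j < r)%N) E r j ^+ a (r, j).

Definition gt_mon (a : expo) : U := \prod_(r < n) row_mon a r.

Definition lower_expo (a : expo) : bool :=
  [forall p : 'I_n * 'I_n, (p.1 <= p.2)%N ==> (a p == 0%N)].

End GTMonomials.

Section Representation.
Variables (K : fieldType) (n : nat) (lam : nat -> K).
Local Notation N := {mpoly K[(n * n).+1]}.
Local Notation U := (Ugl K n).
Local Notation expo := {ffun 'I_n * 'I_n -> nat}.

(** One polynomial ring serves all rows, the variable of E_{rj} having number r n + j. The successor
    in the number of variables is there for [inord]. *)
Definition pvar (r j : nat) : 'I_(n * n).+1 := inord (r * n + j).

Definition pmul (r j : nat) (p : N) : N := 'X_(pvar r j) * p.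

Definition pder (r j : nat) (p : N) : N := mderiv (pvar r j) p.

Lemma pmul_is_linear r j : linear (pmul r j).
Proof. by move=> a p q; rewrite /pmul mulrDr -scalerAr. Qed.
HB.instance Definition _ r j := GRing.isLinear.Build K N N *:%R (pmul r j) (pmul_is_linear r j).

Lemma pder_is_linear r j : linear (pder r j).
Proof. by move=> a p q; rewrite /pder mderivD mderivZ. Qed.
HB.instance Definition _ r j := GRing.isLinear.Build K N N *:%R (pder r j) (pder_is_linear r j).

(** The extension iterated from gl_0. Since [gl_op k] only involves variables of rows below k, it
    commutes with the variables and derivatives of row k, as the next extension requires. For k = n
    this is a model of the Verma module in which 1 is the highest weight vector. *)
Fixpoint gl_op (k : nat) : nat -> nat -> {linear N -> N} :=
  if k is k'.+1 then fun i j =>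
    ext_linear k' (lam k') (pmul k') (pder k') (gl_op k') i j
  else fun _ _ => \0.

Lemma pvar_inj r j s i : (r < n)%N -> (j < n)%N -> (s < n)%N -> (i < n)%N ->
  (pvar r j == pvar s i) = (r == s) && (j == i).
Proof.
move=> rn jn sn i_n; rewrite -val_eqE /= !inordK; last 2 first.
- nia.
- nia.
apply/eqP/andP => [h|[/eqP-> /eqP->]//].
have rs : r = s by nia.
by split; apply/eqP => //; nia.
Qed.

Lemma pmulC r j s i p : pmul r j (pmul s i p) = pmul s i (pmul r j p).
Proof. exact: mulrCA. Qed.

Lemma pderC r j s i p : pder r j (pder s i p) = pder s i (pder r j p).
Proof. exact: mderiv_comm. Qed.

Lemma pder_mul r j s i p : (r < n)%N -> (j < n)%N -> (s < n)%N -> (i < n)%N ->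
  pder r j (pmul s i p) = pmul s i (pder r j p) + p *+ ((r == s) && (j == i)).
Proof.
move=> rn jn sn i_n; rewrite /pder /pmul mderivM addrC mderivX mnmE.
rewrite pvar_inj // (eq_sym s) (eq_sym i).
case: andP => [[/eqP-> /eqP->]|_]; last by rewrite scale0r mul0r.
rewrite (_ : _ - _ = 0)%MM ?mpolyX0 ?scale1r ?mul1r //.
by apply/mnmP => l; rewrite mnmBE subnn mnm0E.
Qed.

Lemma gl_op_mul k i j r s p : (i < k)%N -> (j < k)%N -> (k <= r < n)%N -> (s < n)%N ->
  gl_op k i j (pmul r s p) = pmul r s (gl_op k i j p)
  /\ gl_op k i j (pder r s p) = pder r s (gl_op k i j p).
Proof.
elim: k => // k IHk in i j p *; rewrite !ltnS => ik jk /andP[kr rn] sn.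
have kn : (k < n)%N by apply: leq_trans kr (ltnW rn).
have krF : ((k == r) = false) * ((r == k) = false) by rewrite (eq_sym r) ltn_eqF.
have kri : (k <= r < n)%N by rewrite (ltnW kr).
have DT l q : (l < k)%N -> pder k l (pmul r s q) = pmul r s (pder k l q).
  by move=> lk; rewrite pder_mul // ?krF ?addr0 //; lia.
have TD l q : (l < k)%N -> pder r s (pmul k l q) = pmul k l (pder r s q).
  by move=> lk; rewrite pder_mul // ?krF ?addr0 //; lia.
have IHt a b q : (a < k)%N -> (b < k)%N ->
    gl_op k a b (pmul r s q) = pmul r s (gl_op k a b q).
  by move=> ak bk; case: (IHk a b q).
have IHd a b q : (a < k)%N -> (b < k)%N ->
    gl_op k a b (pder r s q) = pder r s (gl_op k a b q).
  by move=> ak bk; case: (IHk a b q).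
have euT q : ext_euler k (pmul k) (pder k) (pmul r s q) =
    pmul r s (ext_euler k (pmul k) (pder k) q).
  rewrite /ext_euler linear_sum; apply: eq_bigr => l _ /=.
  by rewrite DT // pmulC.
have euD q : ext_euler k (pmul k) (pder k) (pder r s q) =
    pder r s (ext_euler k (pmul k) (pder k) q).
  rewrite /ext_euler linear_sum; apply: eq_bigr => l _ /=.
  by rewrite pderC TD.
have mixT q : (i < k)%N -> ext_mix k (pder k) (gl_op k) i (pmul r s q) =
    pmul r s (ext_mix k (pder k) (gl_op k) i q).
  move=> ik'; rewrite /ext_mix linear_sum; apply: eq_bigr => l _ /=.
  by rewrite DT // IHt.
have mixD q : (i < k)%N -> ext_mix k (pder k) (gl_op k) i (pder r s q) =
    pder r s (ext_mix k (pder k) (gl_op k) i q).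
  move=> ik'; rewrite /ext_mix linear_sum; apply: eq_bigr => l _ /=.
  by rewrite pderC IHd.
rewrite /= /ext_op; case: ltnP => ik'; case: ltnP => jk'.
- split; rewrite !linearB /=; first by rewrite IHt // DT // pmulC.
  by rewrite IHd // pderC TD.
- split; rewrite !linearB /=.
    by rewrite mixT // DT // euT [in RHS]linearZ.
  by rewrite mixD // pderC euD [in RHS]linearZ.
- by split; rewrite ?TD // pmulC.
- by split; rewrite !linearD /= ?euT ?euD linearZ.
Qed.

Lemma gl_op_comm k i j q r p : (k <= n)%N ->
  (i < k)%N -> (j < k)%N -> (q < k)%N -> (r < k)%N ->
  gl_op k i j (gl_op k q r p) = gl_op k q r (gl_op k i j p)
    + (gl_op k i r p *+ (j == q) - gl_op k q j p *+ (r == i)).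
Proof.
elim: k => // k IHk in i j q r p *; rewrite !ltnS => kn.
apply: ext_op_comm => {i j q r p}.
- by move=> i j p _ _; apply: pmulC.
- by move=> i j p _ _; apply: pderC.
- by move=> i j p ik jk; rewrite /= pder_mul ?eqxx //; lia.
- by move=> i j l p ik jk lk; apply: (gl_op_mul _ ik jk _ _).1; lia.
- by move=> i j l p ik jk lk; apply: (gl_op_mul _ ik jk _ _).2; lia.
- by move=> i j q r p ik jk qk rk; apply: IHk => //; apply: ltnW.
Qed.

Lemma pder1 r j : pder r j 1 = 0.
Proof. by rewrite /pder -[1]/(1%:MP) mderivC. Qed.

Lemma gl_op_hw k i j : (i < j < k)%N -> gl_op k i j 1 = 0.
Proof.
elim: k i j => // k IHk i j /andP[ij]; rewrite ltnS /= /ext_op /=.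
case: (ltngtP j k) => // [jk _|jk _].
  rewrite (ltn_trans ij jk) pder1 raddf0 subr0 IHk ?ij //.
have -> : (i < k)%N by rewrite -jk.
rewrite /ext_mix /ext_euler pder1 scaler0 subr0 -sumrB.
by rewrite big1 // => l _ /=; rewrite !raddf0 pder1 !raddf0 addr0.
Qed.

Lemma gl_op_weight k i : (i < k)%N -> gl_op k i i 1 = lam i *: 1.
Proof.
elim: k i => // k IHk i; rewrite ltnS /= /ext_op /=.
case: ltngtP => // [ik _|-> _].
  by rewrite pder1 raddf0 subr0 IHk.
by rewrite /ext_euler big1 ?addr0 // => l _ /=; rewrite pder1 raddf0.
Qed.

(** The correction terms come from [E_rj, E_sr] = - E_sj for s > r. They replace one variable by
    another and keep the total degree, so multiplication by the variable of E_rj is the leading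
    part. *)
Lemma gl_op_lower k r j p : (j < r < k)%N ->
  gl_op k r j p = pmul r j p - \sum_(r.+1 <= s < k) pmul s j (pder s r p).
Proof.
elim: k r j p => [|k IHk] r j p; first by rewrite ltn0 andbF.
move=> /andP[jr]; rewrite ltnS /= /ext_op /=.
case: ltngtP => // [rk _|rk _].
  rewrite (ltn_trans jr rk) IHk ?jr // big_nat_recr //= opprD addrA.
  by [].
by rewrite -rk jr big_geq ?subr0.
Qed.

End Representation.

(** * Freeness of the Gelfand-Tsetlin monomials *)

Section LeadingTerms.
Variables (K : fieldType) (n : nat) (lam : nat -> K).
Local Notation N := {mpoly K[(n * n).+1]}.
Local Notation U := (Ugl K n).
Local Notation expo := {ffun 'I_n * 'I_n -> nat}.

Lemma msize_pmul_le r j (p : N) : (msize (pmul r j p) <= (msize p).+1)%N.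
Proof.
rewrite /pmul; have [->|p0] := eqVneq p 0; first by rewrite mulr0 msize0.
rewrite msizeM //; first by rewrite msizeX mdeg1 addSn add1n.
by rewrite -msize_poly_eq0 msizeX mdeg1.
Qed.

Lemma msize_pder_le r j (p : N) : (msize (pder r j p) <= (msize p).-1)%N.
Proof.
rewrite msizeE; apply/bigmax_leqP_seq => m; rewrite mcoeff_msupp mcoeff_mderiv => nz _.
have : p@_(m + U_(pvar n r j)) != 0.
  by apply: contraNneq nz => ->; rewrite mul0rn.
rewrite -mcoeff_msupp => /msize_mdeg_lt; rewrite mdegD mdeg1 addn1.
by case: (msize p).
Qed.

(** As [msize] exceeds the total degree by one, only terms of total degree less than that of u are
    neglected. *)
Definition has_lead (u : 'X_{1..(n * n).+1}) (p : N) := (msize (p - 'X_[u]) <= mdeg u)%N.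

Lemma msize_lead u p : has_lead u p -> (msize p <= (mdeg u).+1)%N.
Proof.
move=> h; rewrite -[p](subrK 'X_[u]); apply: leq_trans (msizeD_le _ _) _.
by rewrite geq_max msizeX leqnn leqW.
Qed.

Lemma gl_op_lead r j p u : (j < r < n)%N -> has_lead u p ->
  has_lead (U_(pvar n r j) + u)%MM (gl_op n lam n r j p).
Proof.
move=> jrn hu; rewrite /has_lead gl_op_lower // mpolyXD addrAC mdegD mdeg1 add1n.
apply: leq_trans (msizeD_le _ _) _; rewrite geq_max msizeN; apply/andP; split.
  rewrite -[X in _ - X]/(pmul r j 'X_[u]) -linearB.
  exact: leq_trans (msize_pmul_le _ _ _) _.
apply: leq_trans (msize_sum _ _ _) _; apply/bigmax_leqP_seq => s _ _ /=.
apply: leq_trans (msize_pmul_le _ _ _) _; rewrite ltnS.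
apply: leq_trans (msize_pder_le _ _ _) _.
by have := msize_lead hu; case: (msize p).
Qed.

Definition expo_mon (a : expo) : 'X_{1..(n * n).+1} :=
  (\sum_(r < n) \sum_(j < n | (j < r)%N) U_(pvar n r j) *+ a (r, j))%MM.

Lemma expo_mon_inj (a b : expo) : lower_expo a -> lower_expo b ->
  expo_mon a = expo_mon b -> a = b.
Proof.
move=> /forallP la /forallP lb eab.
have expo_monE (c : expo) (r j : 'I_n) : (j < r)%N -> expo_mon c (pvar n r j) = c (r, j).
  move=> jr; rewrite mnm_sumE (bigD1 r) //= mnm_sumE (bigD1 j) //=.
  rewrite mulmnE mnm1E eqxx mul1n big1 ?addn0 => [|i]; last first.
    rewrite -val_eqE => /andP[_ /= ij].
    by rewrite mulmnE mnm1E pvar_inj // eqxx /= (negbTE ij) mul0n.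
  rewrite big1 ?addn0 // => s; rewrite -val_eqE /= => sr; rewrite mnm_sumE big1 // => i _.
  by rewrite mulmnE mnm1E pvar_inj // (negbTE sr) mul0n.
apply/ffunP => -[r j]; case: (ltnP j r) => jr.
  by rewrite -!expo_monE // eab.
by move: (la (r, j)) (lb (r, j)); rewrite /= jr /= => /eqP-> /eqP->.
Qed.

Variable rho : U -> N -> N.
Hypotheses (rho1 : forall p, rho 1 p = p)
  (rhoM : forall u u' p, rho (u * u') p = rho u (rho u' p))
  (rhoE : forall i j p, rho (E i j) p = gl_op n lam n i j p).

Lemma gt_mon_lead (a : expo) : has_lead (expo_mon a) (rho (gt_mon (@E K n) a) 1).
Proof.
pose Q x w := forall p u, has_lead u p -> has_lead (w + u)%MM (rho x p).
have Q1 : Q 1 0%MM by move=> p u hu; rewrite add0m rho1.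
have QM x w y w' : Q x w -> Q y w' -> Q (x * y) (w + w')%MM.
  by move=> hx hy p u hu; rewrite rhoM -addmA; apply/hx/hy.
have : Q (gt_mon (@E K n) a) (expo_mon a).
  apply: (big_ind2 Q) => // r _.
  apply: (big_ind2 Q) => // j jr.
  have QE : Q (E r j) U_(pvar n r j)%MM.
    by move=> p u; rewrite rhoE; apply: gl_op_lead; rewrite jr /=.
  elim: (a (r, j)) => [|c IHc]; first by rewrite expr0 mulm0n.
  by rewrite exprS mulmS; apply: QM.
move/(_ 1 0%MM); rewrite addm0; apply.
by rewrite /has_lead mpolyX0 subrr msize0.
Qed.

Lemma gt_mon_free (s : seq expo) (c : expo -> K) :
  uniq s -> all (@lower_expo n) s ->
  \sum_(a <- s) c a *: rho (gt_mon (@E K n) a) 1 = 0 -> forall a, a \in s -> c a = 0.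
Proof.
move=> s_uniq /allP s_low s0 a0 a0s; apply/eqP/negPn/negP => ca0.
have ex : exists a, (a \in s) && (c a != 0) by exists a0; rewrite a0s.
(* At an exponent of maximal degree among those with nonzero coefficient, no other term reaches the
   leading monomial: lower terms have smaller degree, and distinct exponents have distinct leading
   monomials. *)
have [a /andP[a_s ca] amax] : exists2 a, (a \in s) && (c a != 0) &
    forall b, b \in s -> c b != 0 -> (mdeg (expo_mon b) <= mdeg (expo_mon a))%N.
  pose P d := [exists i : 'I_(size s), let b := nth a0 s i in
    (c b != 0) && (mdeg (expo_mon b) == d)].
  have exP : exists d, P d.
    exists (mdeg (expo_mon a0)); apply/existsP.
    have i_lt : (index a0 s < size s)%N by rewrite index_mem.
    by exists (Ordinal i_lt); rewrite /= nth_index // ca0 eqxx.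
  have bound d : P d -> (d <= \max_(b <- s) mdeg (expo_mon b))%N.
    move=> /existsP[i /andP[_ /eqP <-]].
    by apply: leq_bigmax_seq => //; apply: mem_nth.
  case: (ex_maxnP exP bound) => d /existsP[i /andP[ci /eqP di]] dmax.
  exists (nth a0 s i); first by rewrite mem_nth.
  move=> b bs cb; rewrite di; apply: dmax; apply/existsP.
  have i_lt : (index b s < size s)%N by rewrite index_mem.
  by exists (Ordinal i_lt); rewrite /= nth_index // cb eqxx.
have := congr1 (mcoeff (expo_mon a)) s0; rewrite mcoeff0 raddf_sum /=.
rewrite (bigD1_seq a) //= mcoeffZ.
have coef b : (mdeg (expo_mon b) <= mdeg (expo_mon a))%N ->
    (rho (gt_mon (@E K n) b) 1)@_(expo_mon a) = (expo_mon b == expo_mon a)%:R.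
  move=> ba; rewrite -[rho _ _](subrK 'X_[expo_mon b]) mcoeffD mcoeffX.
  rewrite memN_msupp_eq0 ?add0r //; apply: msize_mdeg_ge.
  exact: leq_trans (gt_mon_lead b) ba.
rewrite coef // eqxx mulr1 big_seq_cond big1 ?addr0 => [/eqP|b /andP[bs ba]].
  by rewrite (negbTE ca).
rewrite mcoeffZ; have [->|cb] := eqVneq (c b) 0; first by rewrite mul0r.
rewrite coef ?amax //; case: eqP => [eab|]; last by rewrite mulr0.
by rewrite (expo_mon_inj _ _ eab) ?s_low // eqxx in ba.
Qed.

End LeadingTerms.

Lemma quot_mod_eq0 (A : pzRingType) (V : lmodType A) (S : set V) (x : V) :
  \pi_({ideal_quot span_mod_closed S})%qT x = 0 :> quot_mod S <-> span_mod S x.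
Proof.
have -> : (0 : quot_mod S) = \pi_({ideal_quot span_mod_closed S})%qT 0.
  by rewrite [RHS]raddf0.
split => [h|h]; last first.
  by apply/eqP; rewrite -Quotient.idealrBE subr0 unfold_in; apply/asboolP.
have: x - 0 \in span_mod_pred S by rewrite Quotient.idealrBE; apply/eqP.
by rewrite unfold_in subr0 => /asboolP.
Qed.

(** * Transfer of freeness to the Verma module *)

Section VermaFree.
Variables (K : fieldType) (n : nat) (lam : nat -> K).
Local Notation U := (Ugl K n).
Local Notation M := (verma (fun i : 'I_n => lam i)).
Local Notation expo := {ffun 'I_n * 'I_n -> nat}.

Local Notation gens := ([set x : (U^o)%type | (exists i j : 'I_n, (i < j)%N /\ x = E i j)
          \/ exists i : 'I_n, x = E i i - (lam i)%:A] : set (U^o)%type).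

Definition verma_hw : M :=
  (\pi_({ideal_quot span_mod_closed gens})%qT (1 : (U^o)%type)).

Lemma verma_act (u : U) : u *: verma_hw =
   (\pi_({ideal_quot span_mod_closed gens})%qT (u : (U^o)%type)).
Proof.
rewrite /verma_hw -[LHS]/(quot_mod_scale _ _) pi_quot_mod_scale.
by congr (\pi_(_)%qT _); rewrite -[LHS]/(u * 1) mulr1.
Qed.

Lemma verma_eq0 (u : U) : u *: verma_hw = 0 <-> span_mod gens u.
Proof.
rewrite verma_act; exact: quot_mod_eq0.
Qed.

Lemma verma_gen (x : M) : exists u : U, x = u *: verma_hw.
Proof.
exists (repr (x : {ideal_quot span_mod_closed gens})).
by rewrite verma_act reprK.
Qed.

Lemma verma_hw_raise (i j : 'I_n) : (i < j)%N -> E i j *: verma_hw = 0.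
Proof.
by move=> ij; apply/verma_eq0 => W [_ SW]; apply: SW; left; exists i, j.
Qed.

Lemma verma_hw_weight (i : 'I_n) : E i i *: verma_hw = (lam i)%:A *: verma_hw.
Proof.
apply/eqP; rewrite -subr_eq0 -scalerBl; apply/eqP.
by apply/verma_eq0 => W [_ SW]; apply: SW; right; exists i.
Qed.

Lemma verma_free (s : seq expo) (c : expo -> K) :
  uniq s -> all (@lower_expo n) s ->
  \sum_(a <- s) (c a)%:A *: (gt_mon (@E K n) a *: verma_hw) = 0 -> forall a, a \in s -> c a = 0.
Proof.
have [||rho [rho1 rhoL rhoM rhoE]] :=
    @Ugl_action K n (n * n).+1 (fun i j => gl_op n lam n i j).
- by move=> i j; apply: linearP.
- by move=> i j k l p; rewrite gl_op_comm.
move=> s_uniq s_low s0; apply: (gt_mon_free rho1 rhoM rhoE s_uniq s_low).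
have rho0 p : rho 0 p = 0.
  by apply: (addrI (rho 0 p)); rewrite addr0; have := rhoL 1 0 0 p; rewrite !scale1r addr0 => <-.
have rhoD u u' p : rho (u + u') p = rho u p + rho u' p.
  by have := rhoL 1 u u' p; rewrite !scale1r.
have rhoZ a u p : rho (a *: u) p = a *: rho u p.
  by have := rhoL a u 0 p; rewrite !addr0 rho0 addr0.
(* Linearity in the polynomial is known for the E i j and passes to all u by induction. *)
have rho_lin u a p q : rho u (a *: p + q) = a *: rho u p + rho u q.
  pose P := [set x : U | forall a p q, rho x (a *: p + q) = a *: rho x p + rho x q].
  suff: P u by apply.
  apply: Ugl_genP => [|i j]; last by move=> b r t; rewrite !rhoE linearP.
  split; first by move=> b r t; rewrite !rho1.
    move=> d x y hx hy b r t; rewrite !rhoL hx hy !scalerDr !scalerA [d * b]mulrC.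
    by rewrite addrACA.
  by move=> x y hx hy b r t; rewrite !rhoM hy hx.
(* The annihilator of the polynomial 1 is a left ideal and contains the generators of the left ideal
   that defines the Verma module. Hence a relation in the Verma module can be read on
   polynomials. *)
have rho_span u : span_mod gens u -> rho u 1 = 0.
  move=> /(_ [set x | rho x 1 = 0]); apply; split; first split => //.
    move=> a x y hx hy; rewrite /= -[a *: x]/(a * x) rhoD rhoM hx hy addr0.
    by apply: (addrI (rho a 0)); rewrite addr0; have := rho_lin a 1 0 0; rewrite !scale1r addr0 => <-.
  move=> x [[i [j [ij ->]]]|[i ->]] /=.
    by rewrite rhoE gl_op_hw // ij /=.
  rewrite -scaleNr rhoD rhoZ rhoE rho1 gl_op_weight //.
  by rewrite -scalerDl subrr scale0r.
have e0 : rho (\sum_(a <- s) c a *: gt_mon (@E K n) a) 1 = 0.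
  apply/rho_span/verma_eq0; rewrite scaler_suml -[RHS]s0.
  by apply: eq_bigr => a _; rewrite scalerA mulr_algl.
rewrite -[RHS]e0 (big_morph (fun u => rho u 1) (fun x y => rhoD x y 1) (rho0 1)).
by apply: eq_bigr => a _; rewrite rhoZ.
Qed.

End VermaFree.

(** * Spanning by the Gelfand-Tsetlin monomials *)

Section Subspaces.
Variables (K : fieldType) (n : nat) (U : algType K) (M : lmodType U).
Variable E : 'I_n -> 'I_n -> U.
Hypothesis E_comm : forall i j k l, E i j * E k l =
  E k l * E i j + (E i l *+ (j == k) - E k j *+ (l == i)).
Local Notation expo := {ffun 'I_n * 'I_n -> nat}.
Implicit Types (W S : set M).

(** A K-subspace: M is a module over U only, and K acts through its image in U, as in [has_dim]. *)
Definition subsp W := W 0 /\ forall (a : K) x y, W x -> W y -> W (a%:A *: x + y).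

Definition kspan S : set M := smallest subsp S.

Lemma subspD W x y : subsp W -> W x -> W y -> W (x + y).
Proof. by move=> [_ WL] Wx Wy; rewrite -[x]scale1r -(scale1r 1); apply: WL. Qed.

Lemma subspZ W a x : subsp W -> W x -> W (a%:A *: x).
Proof. by move=> [W0 WL] Wx; rewrite -[_ *: _]addr0; apply: WL. Qed.

Lemma subspN W x : subsp W -> W x -> W (- x).
Proof. by move=> sW Wx; rewrite -scaleN1r -scaleN1r; apply: subspZ. Qed.

Lemma subspB W x y : subsp W -> W x -> W y -> W (x - y).
Proof. by move=> sW Wx Wy; apply: subspD => //; apply: subspN. Qed.

Lemma subspMn W x d : subsp W -> W x -> W (x *+ d).
Proof.
by move=> sW Wx; elim: d => [|d IHd]; rewrite ?mulrS; [case: sW|apply: subspD].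
Qed.

Lemma subsp_sum W (I : Type) (r : seq I) (P : pred I) (F : I -> M) : subsp W ->
  (forall i, P i -> W (F i)) -> W (\sum_(i <- r | P i) F i).
Proof. by move=> sW WF; apply: big_ind => //; [case: sW|move=> x y; apply: subspD]. Qed.

Lemma kspan_subsp S : subsp (kspan S).
Proof.
split=> [W [[]]//|a x y Sx Sy W [Wsub SW]].
by apply: Wsub.2; [apply: Sx|apply: Sy].
Qed.

Lemma sub_kspan S : S `<=` kspan S.
Proof. by move=> x Sx W [_]; apply. Qed.

Lemma kspan_min S W : subsp W -> S `<=` W -> kspan S `<=` W.
Proof. by move=> sW SW x; apply. Qed.

Lemma scale_algC (u : U) a (x : M) : u *: (a%:A *: x) = a%:A *: (u *: x).
Proof. by rewrite !scalerA mulr_algr mulr_algl. Qed.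

Lemma kspan_map S W (u : U) : subsp W -> (forall x, S x -> W (u *: x)) ->
  forall x, kspan S x -> W (u *: x).
Proof.
move=> [W0 WL] h; apply: (@kspan_min S [set x | W (u *: x)]) => //.
split=> [|a x y /= Wx Wy]; first by rewrite /= scaler0.
by rewrite scalerDr scale_algC; apply: WL.
Qed.

Lemma act_comm (i j k l : 'I_n) (x : M) : E i j *: (E k l *: x) =
  E k l *: (E i j *: x) + ((E i l *: x) *+ (j == k) - (E k j *: x) *+ (l == i)).
Proof. by rewrite scalerA E_comm scalerDl scalerBl -!scalerMnl scalerA. Qed.

Definition stable k W := forall i j : 'I_n, (i < k)%N -> (j < k)%N ->
  forall x, W x -> W (E i j *: x).

(** Stability under the Borel subalgebra of upper triangular matrices of gl_k. *)
Definition bstable k W := forall i j : 'I_n, (i <= j)%N -> (j < k)%N ->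
  forall x, W x -> W (E i j *: x).

Definition gl_span k S : set M := smallest (fun W => subsp W /\ stable k W) S.

Lemma gl_span_subsp k S : subsp (gl_span k S).
Proof.
split=> [W [[[]]]//|a x y Sx Sy W [[Wsub Wst] SW]].
by apply: Wsub.2; [apply: Sx|apply: Sy].
Qed.

Lemma gl_span_stable k S : stable k (gl_span k S).
Proof.
by move=> i j ik jk x Sx W [[Wsub Wst] SW]; apply: (Wst) => //; apply: Sx.
Qed.

Lemma sub_gl_span k S : S `<=` gl_span k S.
Proof. by move=> x Sx W [_]; apply. Qed.

Lemma gl_span_min k S W : subsp W -> stable k W -> S `<=` W -> gl_span k S `<=` W.
Proof. by move=> sW stW SW x; apply. Qed.

Definition row_stable (k : 'I_n) W := forall j : 'I_n, (j < k)%N ->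
  forall x, W x -> W (E k j *: x).

Definition row_span (k : 'I_n) S : set M :=
  smallest (fun W => subsp W /\ row_stable k W) S.

Lemma row_span_subsp k S : subsp (row_span k S).
Proof.
split=> [W [[[]]]//|a x y Sx Sy W [[Wsub Wst] SW]].
by apply: Wsub.2; [apply: Sx|apply: Sy].
Qed.

Lemma row_span_stable k S : row_stable k (row_span k S).
Proof.
by move=> j jk x Sx W [[Wsub Wst] SW]; apply: (Wst) => //; apply: Sx.
Qed.

Lemma sub_row_span k S : S `<=` row_span k S.
Proof. by move=> x Sx W [_]; apply. Qed.

Lemma row_span_min k S W : subsp W -> row_stable k W -> S `<=` W -> row_span k S `<=` W.
Proof. by move=> sW stW SW x; apply. Qed.

(** Subspace of this shape are the induction hypotheses below: commutators produce both the vector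
    and its images, so membership of the vector has to be carried along. *)
Lemma subspI_pre (I : Type) W W' (u : I -> U) (P : I -> Prop) : subsp W -> subsp W' ->
  subsp [set x | W x /\ forall i, P i -> W' (u i *: x)].
Proof.
move=> sW sW'; split=> [|a x y /= [Wx Wux] [Wy Wuy]].
  by split=> [|i _]; rewrite ?scaler0; [case: sW|case: sW'].
split=> [|i Pi]; first by apply: sW.2.
by rewrite scalerDr scale_algC; apply: sW'.2; [apply: Wux|apply: Wuy].
Qed.

Section RowStep.
Variables (k : 'I_n) (S : set M).
Hypotheses (sS : subsp S) (bS : bstable k.+1 S).
Local Notation R := (row_span k S).
Local Notation T := (gl_span k R).

Let neqk (i : 'I_n) : (i < k)%N -> ((i == k) = false) * ((k == i) = false).
Proof. by move=> ik; rewrite -!val_eqE /= (gtn_eqF ik) (ltn_eqF ik). Qed.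

Let row_b : bstable k R.
Proof.
move=> i j ij jk x Rx; have ik := leq_ltn_trans ij jk.
pose W := [set x | R x /\ forall q : 'I_n * 'I_n, (q.1 <= q.2)%N /\ (q.2 < k)%N ->
   R (E q.1 q.2 *: x)].
suff: W x by case=> _ /(_ (i, j)); apply.
apply: (row_span_min _ _ _ Rx) => {x Rx i j ij jk ik}.
- by apply: subspI_pre; apply: row_span_subsp.
- move=> l lk x [Rx Wx]; split=> [|[i j] /= [ij jk]]; first exact: row_span_stable.
  have ik := leq_ltn_trans ij jk.
  rewrite act_comm (neqk jk) mulr0n sub0r; apply: (subspB (@row_span_subsp k S)).
    by apply: row_span_stable => //; apply: (Wx (i, j)).
  by apply: (subspMn _ (@row_span_subsp k S)); apply: row_span_stable.
- move=> x Sx; split=> [|[i j] /= [ij jk]]; apply: sub_row_span => //.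
  by apply: bS => //; apply: ltnW.
Qed.

Let row_diag x : R x -> R (E k k *: x).
Proof.
move=> Rx; pose W := [set x | R x /\ forall _ : unit, True -> R (E k k *: x)].
suff: W x by case=> _ /(_ tt); apply.
apply: (row_span_min _ _ _ Rx) => {x Rx}.
- by apply: (subspI_pre (fun=> E k k)); apply: row_span_subsp.
- move=> l lk x [Rx /(_ tt I) Wx]; split=> [|_ _]; first exact: row_span_stable.
  rewrite act_comm eqxx (neqk lk) mulr0n subr0; apply: (subspD (@row_span_subsp k S)).
    exact: row_span_stable.
  exact: row_span_stable.
- by move=> x Sx; split=> [|_ _]; apply: sub_row_span => //; apply: bS.
Qed.

Let T_row (l : 'I_n) x : (l < k)%N -> T x -> T (E k l *: x).
Proof.
move=> lk Tx; pose W := [set x | T x /\ forall l : 'I_n, (l < k)%N -> T (E k l *: x)].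
suff: W x by case=> _; apply.
apply: (gl_span_min _ _ _ Tx) => {x Tx l lk}.
- by apply: subspI_pre; apply: gl_span_subsp.
- move=> i j ik jk x [Tx Wx]; split=> [|l lk]; first exact: gl_span_stable.
  rewrite act_comm (neqk jk) mulr0n subr0; apply: (subspD (@gl_span_subsp k R)).
    by apply: gl_span_stable => //; apply: Wx.
  by apply: (subspMn _ (@gl_span_subsp k R)); apply: Wx.
- by move=> x Rx; split=> [|l lk]; apply: sub_gl_span => //; apply: row_span_stable.
Qed.

Let T_diag x : T x -> T (E k k *: x).
Proof.
move=> Tx; pose W := [set x | T x /\ forall _ : unit, True -> T (E k k *: x)].
suff: W x by case=> _ /(_ tt); apply.
apply: (gl_span_min _ _ _ Tx) => {x Tx}.
- by apply: (subspI_pre (fun=> E k k)); apply: gl_span_subsp.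
- move=> i j ik jk x [Tx /(_ tt I) Wx]; split=> [|_ _]; first exact: gl_span_stable.
  rewrite act_comm (neqk ik) (neqk jk) !mulr0n subr0 addr0.
  exact: gl_span_stable.
- by move=> x Rx; split=> [|_ _]; apply: sub_gl_span => //; apply: row_diag.
Qed.

Let T_col (i : 'I_n) x : (i < k)%N -> T x -> T (E i k *: x).
Proof.
have sT := @gl_span_subsp k R.
move=> ik Tx; pose W := [set x | T x /\ forall i : 'I_n, (i < k)%N -> T (E i k *: x)].
suff: W x by case=> _; apply.
apply: (gl_span_min _ _ _ Tx) => {x Tx i ik}.
- by apply: subspI_pre.
- move=> i j ik jk x [Tx Wx]; split=> [|l lk]; first exact: gl_span_stable.
  rewrite act_comm (neqk ik) mulr0n sub0r; apply: (subspB sT).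
    by apply: gl_span_stable => //; apply: Wx.
  by apply: (subspMn _ sT); apply: Wx.
- move=> x Rx; split; first exact: sub_gl_span.
  move=> i ik; pose W' := [set x | R x /\ forall i : 'I_n, (i < k)%N -> T (E i k *: x)].
  suff: W' x by case=> _; apply.
  apply: (row_span_min _ _ _ Rx) => {x Rx i ik}.
  + by apply: subspI_pre => //; apply: row_span_subsp.
  + move=> l lk x [Rx Wx]; split=> [|i ik]; first exact: row_span_stable.
    have Tx : T x by apply: sub_gl_span.
    rewrite act_comm eqxx; apply: (subspD sT); first by apply: T_row => //; apply: Wx.
    apply: (subspB sT); first exact: gl_span_stable.
    by apply: (subspMn _ sT); apply: T_diag.
  + move=> x Sx; split=> [|i ik]; first exact: sub_row_span.
    by apply: sub_gl_span; apply: sub_row_span; apply: bS => //; apply: ltnW.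
Qed.

(** One step of a Poincare-Birkhoff-Witt argument. The elements E_kk and E_ik are moved to the
    right, past gl_k and past the E_kl; the commutators stay in the span, and on S they are absorbed
    by the Borel subalgebra. The second part allows the step to be repeated with gl_k acting on
    R. *)
Lemma gl_span_rec : gl_span k.+1 S `<=` T /\ bstable k R.
Proof.
split; last exact: row_b.
apply: gl_span_min; first exact: gl_span_subsp.
  move=> i j; rewrite !ltnS; case: (ltngtP i k) => // [ik|/val_inj->] _;
    case: (ltngtP j k) => // [jk|/val_inj->] _ x Tx.
  - exact: gl_span_stable.
  - exact: T_col.
  - exact: T_row.
  - exact: T_diag.
by move=> x Sx; apply: sub_gl_span; apply: sub_row_span.
Qed.

End RowStep.

End Subspaces.

(** * Spans of ordered monomials and their filtration by height *)

Section MonomialSpans.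
Variables (K : fieldType) (n : nat) (U : algType K) (M : lmodType U).
Variable E : 'I_n -> 'I_n -> U.
Hypothesis E_comm : forall i j k l, E i j * E k l =
  E k l * E i j + (E i l *+ (j == k) - E k j *+ (l == i)).
Local Notation expo := {ffun 'I_n * 'I_n -> nat}.
Local Notation stable := (stable E).
Local Notation bstable := (bstable E).
Local Notation gl_span := (gl_span E).
Local Notation row_span := (row_span E).
Local Notation act_comm := (act_comm E_comm).
Implicit Types (W S : set M) (a b : expo).

(** Rows are indexed by natural numbers, with value 1 out of range, so that the ordered product can
    be cut at any k. *)
Definition nrow a (r : nat) : U := oapp (row_mon E a) 1 (insub r).

Definition lowmon k a : U := \prod_(0 <= r < k) nrow a r.

Definition upmon k a : U := \prod_(k <= r < n) nrow a r.

Lemma lowmonS k a : lowmon k.+1 a = lowmon k a * nrow a k.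
Proof. by rewrite /lowmon (big_nat_recr _ _ _ (leq0n k)). Qed.

Lemma upmon_ltn k a : (k < n)%N -> upmon k a = nrow a k * upmon k.+1 a.
Proof. by move=> kn; rewrite /upmon big_ltn. Qed.

Lemma upmon_n a : upmon n a = 1.
Proof. by rewrite /upmon big_geq. Qed.

Lemma nrow_ord a (r : 'I_n) : nrow a r = row_mon E a r.
Proof. by rewrite /nrow valK. Qed.

Lemma gt_mon_split k a : (k <= n)%N -> gt_mon E a = lowmon k a * upmon k a.
Proof.
move=> kn; rewrite /gt_mon /lowmon /upmon -(big_cat_nat (leq0n k) kn) /= big_mkord.
by apply: eq_bigr => r _; rewrite nrow_ord.
Qed.

Lemma lowmon_ind (Q : U -> Prop) k a : (k <= n)%N -> Q 1 ->
  (forall u u', Q u -> Q u' -> Q (u * u')) ->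
  (forall r j : 'I_n, (r < k)%N -> (j < r)%N -> Q (E r j)) -> Q (lowmon k a).
Proof.
move=> kn Q1 QM QE; rewrite /lowmon big_nat; apply: (big_ind Q) => // r /andP[_ rk].
rewrite -[r]/(nat_of_ord (Ordinal (leq_trans rk kn))) nrow_ord.
apply: (big_ind Q) => // j jr; elim: (a _) => [|c IHc]; first by rewrite expr0.
by rewrite exprS; apply: QM => //; apply: QE.
Qed.

Lemma eq_row_mon a b (r : 'I_n) :
  (forall j : 'I_n, (j < r)%N -> a (r, j) = b (r, j)) -> row_mon E a r = row_mon E b r.
Proof. by move=> ab; apply: eq_bigr => j jr; rewrite ab. Qed.

Lemma eq_nrow a b (P : pred nat) : (forall r j : 'I_n, P r -> (j < r)%N -> a (r, j) = b (r, j)) ->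
  forall r, P r -> nrow a r = nrow b r.
Proof.
move=> ab r Pr; rewrite /nrow; case: insubP => //= s _ sr.
by apply: eq_row_mon => j js; apply: ab => //; rewrite sr.
Qed.

Definition splice (k : nat) a b : expo := [ffun p : 'I_n * 'I_n => if (p.1 < k)%N then a p else b p].

Lemma lowmon_splice k a b : lowmon k (splice k a b) = lowmon k a.
Proof.
rewrite /lowmon !big_nat; apply: eq_bigr => r /andP[_ rk].
apply: (eq_nrow (P := fun r => r < k)%N) rk => s j sk _.
by rewrite ffunE sk.
Qed.

Lemma upmon_splice k a b : upmon k (splice k a b) = upmon k b.
Proof.
rewrite /upmon !big_nat; apply: eq_bigr => r /andP[rk _].
apply: (eq_nrow (P := fun r => k <= r)%N) rk => s j sk _.
by rewrite ffunE ltnNge sk.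
Qed.

Definition bump_expo a (r j : 'I_n) : expo := [ffun p : 'I_n * 'I_n => (a p + (p == (r, j)))%N].

(** The E_rj of a fixed row r commute, so the new factor slides to its place. *)
Lemma row_mon_bump a (r j : 'I_n) : (j < r)%N ->
  E r j * row_mon E a r = row_mon E (bump_expo a r j) r.
Proof.
move=> jr; rewrite /row_mon.
have com (i : 'I_n) : (i < r)%N -> E r j * E r i = E r i * E r j :> U.
  by move=> ir; rewrite E_comm -!val_eqE /= !ltn_eqF // !mulr0n subr0 addr0.
have comX (i : 'I_n) c : (i < r)%N -> E r j * E r i ^+ c = E r i ^+ c * E r j :> U.
  by move=> ir; apply: commrX; apply: com.
(* The induction runs over arbitrary duplicate-free lists of columns that contain j. *)
have: j \in index_enum 'I_n by rewrite mem_index_enum.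
have: uniq (index_enum 'I_n) by rewrite index_enum_uniq.
elim: (index_enum 'I_n) => //= i s IHs /andP[is_ us].
rewrite !big_cons inE.
case: (eqVneq j i) is_ => [<- is_ _|ji is_ /= js].
  rewrite jr mulrA -exprS ffunE eqxx addn1; congr (_ * _).
  rewrite big_seq_cond [RHS]big_seq_cond; apply: eq_bigr => l /andP[ls _].
  rewrite ffunE; case: eqP => [[lj]|_]; last by rewrite addn0.
  by rewrite -lj ls in is_.
case: ifP => ir; last exact: IHs.
rewrite mulrA (comX i _ ir) -mulrA (IHs us js) ffunE.
by rewrite xpair_eqE [i == j]eq_sym (negbTE ji) andbF addn0.
Qed.

Lemma row_span_mon (k : 'I_n) S : row_span k S
  `<=` kspan [set x | exists a s, S s /\ x = row_mon E a k *: s].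
Proof.
apply: row_span_min; first exact: kspan_subsp.
  move=> j jk; apply: kspan_map; first exact: kspan_subsp.
  move=> _ [a [s [Ss ->]]]; apply: sub_kspan; exists (bump_expo a k j), s.
  by rewrite scalerA row_mon_bump.
move=> s Ss; apply: sub_kspan; exists [ffun=> 0%N], s; split=> //.
by rewrite /row_mon big1 ?scale1r // => j _; rewrite ffunE expr0.
Qed.

(** Iterates [gl_span_rec]: the last row is split off first, and the Borel-stable span so obtained
    plays the part of S for the rows below it. *)
Lemma gl_span_mon k S : (k <= n)%N -> subsp S -> bstable k S ->
  gl_span k S `<=` kspan [set x | exists a s, S s /\ x = lowmon k a *: s].
Proof.
elim: k S => [|k IHk] S kn sS bS.
  apply: gl_span_min; [exact: kspan_subsp|by move=> i|].
  move=> x Sx; apply: sub_kspan; exists [ffun=> 0%N], x.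
  by rewrite /lowmon big_geq // scale1r.
have [glT bR] := gl_span_rec E_comm (k := Ordinal kn) bS.
apply: subset_trans glT _; apply: subset_trans.
  by apply: (IHk _ (ltnW kn) _ bR); apply: row_span_subsp.
apply: kspan_min; first exact: kspan_subsp.
move=> _ [a [s [Rs ->]]]; move: s Rs.
have := @row_span_mon (Ordinal kn) S => h s /h; move: s {h}.
apply: kspan_map; first exact: kspan_subsp.
move=> _ [b [s [Ss ->]]]; apply: sub_kspan; exists (splice k a b), s; split=> //.
rewrite scalerA lowmonS lowmon_splice -[X in nrow _ X]/(nat_of_ord (Ordinal kn)) nrow_ord.
rewrite (@eq_row_mon (splice k a b) b) // => j _.
by rewrite ffunE /= ltnn.
Qed.

(* Sum of the column indices of the factors of [upmon k a]: it is strictly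
   raised by the action of [E i j], i < j < k. *)
Definition height k a : nat :=
  \sum_(r < n | (k <= r)%N) \sum_(j < n | (j < r)%N) j * a (r, j).

Variables (v : M) (lam : 'I_n -> K).
Hypothesis v_raise : forall i j : 'I_n, (i < j)%N -> E i j *: v = 0.
Hypothesis v_weight : forall i : 'I_n, E i i *: v = (lam i)%:A *: v.

Definition upspan k p : set M :=
  kspan [set x | exists a, (p <= height k a)%N /\ x = upmon k a *: v].

Definition gtspan k p : set M :=
  kspan [set x | exists a, (p <= height k a)%N /\ x = gt_mon E a *: v].

Lemma upspan_subsp k p : subsp (upspan k p).
Proof. exact: kspan_subsp. Qed.

Lemma gtspan_subsp k p : subsp (gtspan k p).
Proof. exact: kspan_subsp. Qed.

Lemma upspan_sub k p q : (q <= p)%N -> upspan k p `<=` upspan k q.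
Proof.
move=> qp; apply: kspan_min; first exact: kspan_subsp.
by move=> _ [a [pa ->]]; apply: sub_kspan; exists a; rewrite (leq_trans qp).
Qed.

Lemma height_rec (k : 'I_n) a :
  height k a = (\sum_(j < n | (j < k)%N) j * a (k, j) + height k.+1 a)%N.
Proof.
rewrite /height (bigD1 k) //=; congr (_ + _)%N; apply: eq_bigl => r.
by rewrite -val_eqE /= ltn_neqAle eq_sym andbC.
Qed.

Lemma height_splice k a b : height k (splice k a b) = height k b.
Proof.
apply: eq_bigr => r kr; apply: eq_bigr => j _.
by rewrite ffunE ltnNge kr.
Qed.

Lemma upspan_row (k j : 'I_n) p x : (j < k)%N ->
  upspan k p x -> upspan k (p + j) (E k j *: x).
Proof.
move=> jk; apply: kspan_map => [|_ [a [pa ->]]]; first exact: kspan_subsp.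
apply: sub_kspan; exists (bump_expo a k j); split.
  apply: leq_trans (leq_add pa (leqnn j)) _.
  rewrite !height_rec -addnA [(_ + j)%N]addnC addnA leq_add //.
    rewrite (bigD1 j) // [X in (_ <= X)%N](bigD1 j) //= ffunE eqxx addnAC mulnDr muln1.
    rewrite leq_add2l leq_sum // => i _; rewrite ffunE leq_mul2l leq_addr.
    by rewrite orbT.
  apply: leq_sum => r kr; apply: leq_sum => i _; rewrite ffunE.
  by rewrite leq_mul2l leq_addr orbT.
have kn := ltn_ord k; rewrite !(upmon_ltn _ kn) scalerA mulrA !nrow_ord (row_mon_bump _ jk).
suff -> : upmon k.+1 (bump_expo a k j) = upmon k.+1 a by [].
rewrite /upmon !big_nat; apply: eq_bigr => r /andP[kr _].
apply: (eq_nrow (P := fun r => k < r)%N) kr => s i ks _.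
by rewrite ffunE xpair_eqE -val_eqE /= gtn_eqF // addn0.
Qed.

Lemma upspan_next (k : 'I_n) p : upspan k.+1 p `<=` upspan k p.
Proof.
apply: kspan_min; first exact: kspan_subsp.
move=> _ [a [pa ->]]; pose b := splice k.+1 [ffun=> 0%N] a.
apply: sub_kspan; exists b; split.
  by rewrite height_rec height_splice (leq_trans pa) ?leq_addl.
rewrite (upmon_ltn _ (ltn_ord k)) nrow_ord upmon_splice.
have -> : row_mon E b k = 1; last by rewrite mul1r.
by rewrite /row_mon big1 // => j _; rewrite ffunE /= ltnSn ffunE expr0.
Qed.

(** Downward induction from k = n, where v is killed. Passing E_ij through a factor E_kl costs only
    the term - E_kj when l = i, which replaces the column i by the larger column j. So
    [upmon k a *: v] is killed by the raising operators of gl_k up to larger heights. *)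
Lemma upmon_raise k a (i j : 'I_n) : (k <= n)%N -> (i < j < k)%N ->
  upspan k (height k a).+1 (E i j *: (upmon k a *: v)).
Proof.
move=> kn; have: ((n - k) + k)%N = n by rewrite subnK.
move: (n - k)%N => d; elim: d k {kn} i j a => [|d IHd] k i j a.
  rewrite add0n => -> /andP[ij _]; rewrite upmon_n scale1r v_raise //.
  by case: (upspan_subsp n (height n a).+1).
rewrite addSnnS => dk; have kn : (k < n)%N by rewrite -dk leq_addl.
pose k' := Ordinal kn.
(* The property carried through the factors of row k one at a time; the factor E_kl adds its column
   l to q. *)
pose Q x q := upspan k q x /\
  forall i j : 'I_n, (i < j < k)%N -> upspan k q.+1 (E i j *: x).
have QE (l : 'I_n) x q : (l < k)%N -> Q x q -> Q (E k' l *: x) (q + l)%N.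
  move=> lk [ux Qx]; split=> [|i' j' /andP[ij jk]]; first exact: (@upspan_row k').
  rewrite act_comm -!val_eqE /= ltn_eqF // mulr0n sub0r.
  apply: (subspB (upspan_subsp _ _)).
    by rewrite -addSn; apply: (@upspan_row k') => //; apply: Qx; rewrite ij.
  case: eqP => [li|_]; last by rewrite mulr0n; case: (upspan_subsp k (q + l).+1).
  rewrite mulr1n; apply: (@upspan_sub _ (q + j')).
    by rewrite -addnS leq_add2l li.
  exact: (@upspan_row k').
have Qrow : Q (row_mon E a k' *: (upmon k.+1 a *: v))
    (height k.+1 a + \sum_(j < n | (j < k)%N) j * a (k', j))%N.
  pose Q' u w := forall x q, Q x q -> Q (u *: x) (q + w)%N.
  have Q'M u w u' w' : Q' u w -> Q' u' w' -> Q' (u * u') (w + w')%N.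
    by move=> h h' x q Qx; rewrite -scalerA [(w + w')%N]addnC addnA; apply/h/h'.
  have Q'1 : Q' 1 0%N by move=> x q; rewrite scale1r addn0.
  have : Q' (row_mon E a k') (\sum_(j < n | (j < k)%N) j * a (k', j))%N.
    apply: (big_ind2 Q') => // l lk; elim: (a (k', l)) => [|c IHc].
      by rewrite expr0 muln0.
    by rewrite exprS mulnS; apply: Q'M => // x q; apply: QE.
  apply; split.
    apply: (@upspan_next k'); apply: sub_kspan.
    by exists a.
  move=> i' j' /andP[ij jk]; apply: (@upspan_next k').
  by apply: IHd => //; rewrite ij ltnW.
move=> ijk; rewrite (height_rec k') addnC (upmon_ltn _ kn) -scalerA.
rewrite -[X in nrow a X]/(nat_of_ord k') nrow_ord.
exact: Qrow.2.
Qed.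

Definition is_weight (mu : 'I_n -> K) (x : M) := forall i, E i i *: x = (mu i)%:A *: x.

Lemma weight_step mu (r j : 'I_n) x : is_weight mu x ->
  is_weight (fun i => mu i + ((i == r)%:R - (i == j)%:R)) (E r j *: x).
Proof.
have natZ (b : bool) (y : M) : y *+ b = (b%:R : K)%:A *: y.
  by case: b; rewrite ?mulr1n ?scale1r ?mulr0n ?scale0r.
move=> hx i; rewrite act_comm hx scale_algC [j == i]eq_sym.
rewrite scalerDl [RHS]scalerDl; congr (_ + _).
rewrite scalerBl [RHS]scalerBl -!natZ.
by congr (_ - _); case: eqP => [->|].
Qed.

Definition shift (w : 'I_n -> K) (u : U) := forall mu x, is_weight mu x ->
  is_weight (fun i => mu i + w i) (u *: x).

Lemma eq_is_weight mu nu x : mu =1 nu -> is_weight mu x -> is_weight nu x.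
Proof. by move=> e h i; rewrite h e. Qed.

Lemma shift1 : shift (fun=> 0) 1.
Proof. by move=> mu x h; rewrite scale1r; apply: eq_is_weight h => i; rewrite addr0. Qed.

Lemma shiftM w w' u u' : shift w u -> shift w' u' -> shift (fun i => w i + w' i) (u * u').
Proof.
move=> h h' mu x hx; rewrite -scalerA.
by apply: eq_is_weight (h _ _ (h' _ _ hx)) => i; rewrite addrAC addrA.
Qed.

Lemma shift_prod (I : Type) (s : seq I) (P : pred I) (W : I -> 'I_n -> K) (u : I -> U) :
  (forall j, P j -> shift (W j) (u j)) ->
  shift (fun i => \sum_(j <- s | P j) W j i) (\prod_(j <- s | P j) u j).
Proof.
move=> Wu; elim: s => [|j s IHs] mu x hx.
  rewrite big_nil; apply: eq_is_weight (shift1 hx) => i.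
  by rewrite big_nil.
rewrite big_cons; case: ifP => Pj; last first.
  by apply: eq_is_weight (IHs _ _ hx) => i; rewrite big_cons Pj.
apply: eq_is_weight (shiftM (Wu j Pj) IHs hx) => i.
by rewrite big_cons Pj.
Qed.

Definition row_weight a (r i : 'I_n) : K :=
  \sum_(j < n | (j < r)%N) ((i == r)%:R - (i == j)%:R) *+ a (r, j).

Lemma row_mon_shift a (r : 'I_n) : shift (row_weight a r) (row_mon E a r).
Proof.
apply: shift_prod => j jr; elim: (a (r, j)) => [|c IHc] mu x hx.
  by rewrite expr0; apply: eq_is_weight (shift1 hx) => i; rewrite mulr0n.
rewrite exprS; have hE : shift (fun i => (i == r)%:R - (i == j)%:R) (E r j).
  by move=> mu' x' hx'; apply: weight_step.
by apply: eq_is_weight (shiftM hE IHc hx) => i; rewrite mulrS.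
Qed.

Lemma gt_mon_weight a :
  is_weight (fun i => lam i + \sum_(r < n) row_weight a r i) (gt_mon E a *: v).
Proof. by apply: shift_prod => // r _; apply: row_mon_shift. Qed.

(** For i < k <= r, a factor E_rj changes the weight at i only if j = i, and then lowers it by one.
    These column sums become the entries of the patterns. *)
Lemma upmon_weight k a (i : 'I_n) : (i < k)%N -> E i i *: (upmon k a *: v) =
  (lam i - (\sum_(r < n | (k <= r)%N) a (r, i))%:R)%:A *: (upmon k a *: v).
Proof.
move=> ik.
have -> : upmon k a = \prod_(r < n | (k <= r)%N) row_mon E a r.
  by rewrite /upmon big_geq_mkord; apply: eq_bigr => r _; rewrite nrow_ord.
have h := shift_prod (index_enum _) (fun (r : 'I_n) (_ : (k <= r)%N) => @row_mon_shift a r) v_weight.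
rewrite (h i); congr ((_ + _)%:A *: _).
rewrite natr_sum -sumrN; apply: eq_bigr => r kr; rewrite /row_weight.
rewrite (bigD1 i) ?(leq_trans ik) //= big1 => [|j /andP[_ ji]].
  by rewrite addr0 eqxx -val_eqE /= ltn_eqF ?(leq_trans ik) // sub0r mulNrn.
by rewrite -val_eqE /= ltn_eqF ?(leq_trans ik) // eq_sym (negbTE ji) subrr mul0rn.
Qed.

(** [upmon_raise] and [upmon_weight] make the span of the upper parts Borel-stable, so that
    [gl_span_mon] applies. The gain is that [gtspan k p], a mere linear span of basis vectors, is
    stable under gl_k. *)
Lemma upspan_gl_span k p : (k <= n)%N -> gl_span k (upspan k p) = gtspan k p.
Proof.
move=> kn; apply/seteqP; split.
  apply: subset_trans (gl_span_mon kn (@upspan_subsp k p) _) _.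
    move=> i j ij jk; apply: kspan_map => [|_ [a [pa ->]]]; first exact: kspan_subsp.
    move: ij; rewrite leq_eqVlt => /predU1P[/val_inj ij|ij].
      rewrite ij upmon_weight //; apply: (subspZ _ (upspan_subsp _ _)).
      by apply: sub_kspan; exists a.
    apply: (@upspan_sub _ (height k a).+1); first exact: leqW.
    by apply: upmon_raise => //; rewrite ij.
  apply: kspan_min; first exact: kspan_subsp.
  move=> _ [a [s [Us ->]]]; move: s Us; apply: kspan_map; first exact: kspan_subsp.
  move=> _ [b [pb ->]]; apply: sub_kspan; exists (splice k a b).
  by rewrite height_splice pb (gt_mon_split _ kn) lowmon_splice upmon_splice scalerA.
apply: kspan_min; first exact: gl_span_subsp.
move=> _ [a [pa ->]]; rewrite (gt_mon_split _ kn) -scalerA.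
have : gl_span k (upspan k p) (upmon k a *: v).
  by apply: sub_gl_span; apply: sub_kspan; exists a.

apply: (lowmon_ind (Q := fun u => forall x, gl_span k (upspan k p) x ->
  gl_span k (upspan k p) (u *: x))) => // [x|u u' hu hu' x Wx|r j rk jr x Wx].
- by rewrite scale1r.
- by rewrite -scalerA; apply: hu; apply: hu'.
- by apply: gl_span_stable => //; apply: ltn_trans rk.
Qed.

Lemma gtspan_stable k p : (k <= n)%N -> stable k (gtspan k p).
Proof. by move=> kn; rewrite -upspan_gl_span //; apply: gl_span_stable. Qed.

Lemma upspan_gtspan k p : (k <= n)%N -> upspan k p `<=` gtspan k p.
Proof. by move=> kn; rewrite -upspan_gl_span //; apply: sub_gl_span. Qed.

Lemma gt_mon_span :
  (forall P : set U, subalgebra P -> (forall i j, P (E i j)) -> forall u, P u) ->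
  (forall x, exists u : U, x = u *: v) ->
  forall x, kspan [set x | exists a, x = gt_mon E a *: v] x.
Proof.
move=> E_gen v_gen; set S := kspan _.
have stS : stable n (gtspan n 0) by apply: gtspan_stable.
have inS : gtspan n 0 `<=` S.
  apply: kspan_min; first exact: kspan_subsp.
  by move=> _ [a [_ ->]]; apply: sub_kspan; exists a.
move=> x; have [u ->] := v_gen x; apply: inS.
pose P := [set u : U | forall x, gtspan n 0 x -> gtspan n 0 (u *: x)].
suff: P u.
  apply; apply: (upspan_gtspan (leqnn n)); apply: sub_kspan.
  by exists [ffun=> 0%N]; rewrite upmon_n scale1r.
apply: E_gen => [|i j y Sy]; last exact: stS.
split => [y|b y z Py Pz w Sw|y z Py Pz w Sw] /=.
- by rewrite scale1r.
- rewrite scalerDl -[b *: y]mulr_algl -scalerA.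
  by apply: (gtspan_subsp n 0).2; [apply: Py|apply: Pz].
- by rewrite -scalerA; apply: Py; apply: Pz.
Qed.

End MonomialSpans.

(** * Casimir elements and their eigenvalues *)

Section CyclicSums.
Variables (U : nzRingType) (J : finType) (A : J -> J -> U).

Fixpoint path_prod (x : J) (s : seq J) (y : J) : U :=
  if s is z :: s' then A x z * path_prod z s' y else A x y.

(** The (x, y) entry of the m-th power of the matrix A, over a noncommutative ring. *)
Fixpoint path_sum (m : nat) (x y : J) : U :=
  if m is m'.+1 then \sum_z A x z * path_sum m' z y else (x == y)%:R.

Lemma path_prodE m x0 x s y : size s = m ->
  \prod_(t < m.+1) A (nth x0 (x :: s) t) (nth x0 (rcons s y) t) = path_prod x s y.
Proof.
move=> <-; elim: s x => [|z s IHs] x; first by rewrite big_ord_recl big_ord0 mulr1.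
by rewrite big_ord_recl /= -IHs.
Qed.

Lemma sum_tuple_cons m (F : seq J -> U) :
  \sum_(s : m.+1.-tuple J) F s = \sum_x \sum_(s : m.-tuple J) F (x :: s).
Proof.
rewrite pair_bigA /=.
rewrite (reindex (fun p : J * m.-tuple J => [tuple of p.1 :: p.2])) //=.
exists (fun s => (thead s, [tuple of behead s])) => [[x s] _|s _] /=.
  by congr (_, _); apply: val_inj.
by rewrite -tuple_eta.
Qed.

Lemma path_sumE m x y : \sum_(s : m.-tuple J) path_prod x s y = path_sum m.+1 x y.
Proof.
elim: m x y => [|m IHm] x y.
  rewrite (big_pred1 [tuple]) => [|s]; last by apply/esym/eqP/tuple0.
  rewrite /= (bigD1 y) //= eqxx mulr1 big1 ?addr0 // => z zy.
  by rewrite (negbTE zy) mulr0.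
rewrite (sum_tuple_cons _ (fun s => path_prod x s y)) [RHS]/=; apply: eq_bigr => z _.
by rewrite -mulr_sumr IHm.
Qed.

Lemma cyclic_sumE m :
  \sum_(r : {ffun 'I_m.+1 -> J}) \prod_(t < m.+1) A (r t) (r (ordS t))
  = \sum_x path_sum m.+1 x x.
Proof.
rewrite (reindex (fun s : m.+1.-tuple J => [ffun t => tnth s t])) /=; last first.
  exists (fun r => [tuple r t | t < m.+1]) => [s _|r _].
    by apply: eq_from_tnth => t; rewrite tnth_mktuple ffunE.
  by apply/ffunP => t; rewrite ffunE tnth_mktuple.
pose F s := if s is x :: s' then path_prod x s' x else 0.
transitivity (\sum_(s : m.+1.-tuple J) F s).
  apply: eq_bigr => s _; case/tupleP: s => x s.
  rewrite /F /= -(path_prodE x _ _ (size_tuple s)); apply: eq_bigr => t _.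
  rewrite !ffunE !(tnth_nth x); congr (A _ _).
  (* The cyclic successor wraps around exactly at t = m, where the appended x is read. *)
  rewrite /= nth_rcons size_tuple; have := ltn_ord t; rewrite ltnS leq_eqVlt.
  case: (ltngtP t m) => //= [tm|->] _; first by rewrite modn_small.
  by rewrite modnn.
rewrite (sum_tuple_cons _ F); apply: eq_bigr => x _.
exact: path_sumE.
Qed.

End CyclicSums.

Section Casimir.
Variables (K : fieldType) (n : nat) (U : algType K) (M : lmodType U).
Variable E : 'I_n -> 'I_n -> U.
Hypothesis E_comm : forall i j k l, E i j * E k l =
  E k l * E i j + (E i l *+ (j == k) - E k j *+ (l == i)).
Local Notation act_comm := (act_comm E_comm).

Fixpoint mpow (k m : nat) (i j : 'I_n) : U :=
  if m is m'.+1 then \sum_(r < n | (r < k)%N) E i r * mpow k m' r j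
  else (i == j)%:R.

Definition casimir k m : U := \sum_(i < n | (i < k)%N) mpow k m i i.

Lemma sum_deltaL (F : 'I_n -> U) (P : pred 'I_n) a : P a ->
  \sum_(r | P r) F r *+ (r == a) = F a.
Proof.
move=> Pa; rewrite (bigD1 a) //= eqxx mulr1n big1 ?addr0 // => r /andP[_ /negbTE->].
by rewrite mulr0n.
Qed.

(** The entries of a power of the generator matrix transform under gl_k like the generators
    themselves; hence its trace [casimir] commutes with gl_k. *)
Lemma mpow_comm k m (a b c d : 'I_n) : (a < k)%N -> (b < k)%N ->
  E a b * mpow k m c d = mpow k m c d * E a b
    + (mpow k m a d *+ (b == c) - mpow k m c b *+ (d == a)).
Proof.
move=> ak bk; elim: m c d => [|m IHm] c d.
  rewrite /= mulr_natl mulr_natr -[LHS]addr0; congr (_ + _).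
  rewrite [d == a]eq_sym [c == b]eq_sym.
  by case: (a == d); case: (b == c); rewrite /= !(mulr0n, mulr1n) ?subrr.
have step r : E a b * (E c r * mpow k m r d) = E c r * mpow k m r d * E a b
   + (E a r * mpow k m r d *+ (b == c) - E c b * mpow k m r d *+ (r == a)
     + (E c r * mpow k m a d *+ (r == b) - E c r * mpow k m r b *+ (d == a))).
  rewrite mulrA E_comm mulrDl -mulrA IHm mulrDr mulrA -addrA; congr (_ + _).
  by rewrite addrC mulrBl mulrBr !mulrnAl !mulrnAr [b == r]eq_sym.
rewrite /= mulr_sumr mulr_suml (eq_bigr _ (fun r _ => step r)) big_split /=.
congr (_ + _); rewrite big_split /= !sumrB.
rewrite (sum_deltaL (fun r => E c b * mpow k m r d)) //.
rewrite (sum_deltaL (fun r => E c r * mpow k m a d)) // !sumrMnl.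
by rewrite addrA subrK.
Qed.

Lemma mpow_centralize (u : U) k m (c d : 'I_n) :
  (forall a b : 'I_n, (a < k)%N -> (b < k)%N -> u * E a b = E a b * u) ->
  (c < k)%N -> u * mpow k m c d = mpow k m c d * u.
Proof.
move=> uE; elim: m c => [|m IHm] c ck; first by rewrite /= mulr_natl mulr_natr.
rewrite /= mulr_sumr mulr_suml; apply: eq_bigr => r rk.
by rewrite mulrA uE // -mulrA IHm // mulrA.
Qed.

Lemma casimir_centralize (u : U) k m :
  (forall a b : 'I_n, (a < k)%N -> (b < k)%N -> u * E a b = E a b * u) ->
  u * casimir k m = casimir k m * u.
Proof.
move=> uE; rewrite /casimir mulr_sumr mulr_suml; apply: eq_bigr => i ik.
exact: mpow_centralize.
Qed.

Lemma casimir_comm k m (a b : 'I_n) : (a < k)%N -> (b < k)%N ->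
  E a b * casimir k m = casimir k m * E a b.
Proof.
move=> ak bk; rewrite /casimir mulr_sumr mulr_suml.
rewrite (eq_bigr _ (fun i _ => mpow_comm m i i ak bk)) big_split /= sumrB.
under [X in _ + (X - _)]eq_bigr do rewrite eq_sym.
rewrite (sum_deltaL (fun r => mpow k m a r)) // (sum_deltaL (fun r => mpow k m r b)) //.
by rewrite subrr addr0.
Qed.

(* Eigenvalue of the diagonal entry [mpow k m i i] on a highest weight vector
   of weight mu, for l i = mu i + (k - 1 - i). *)
Fixpoint hwt (R : comNzRingType) (l : nat -> R) (k m i : nat) : R :=
  if m is m'.+1 then l i * hwt l k m' i - \sum_(i.+1 <= r < k) hwt l k m' r else 1.

Section HighestWeight.
Variables (k : nat) (W : set M) (x : M) (mu : nat -> K).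
Hypotheses (kn : (k <= n)%N) (sW : subsp W) (stW : stable E k W).
Hypothesis x_raise : forall i j : 'I_n, (i < j < k)%N -> W (E i j *: x).
Hypothesis x_weight : forall i : 'I_n, (i < k)%N -> W (E i i *: x - (mu i)%:A *: x).
Let l i := mu i + (k.-1 - i)%:R.

Let W0 : W 0. Proof. by case: sW. Qed.

Lemma mpow_stable m (i j : 'I_n) y : (i < k)%N -> (j < k)%N -> W y -> W (mpow k m i j *: y).
Proof.
move=> ik jk Wy; elim: m i ik => [|m IHm] i ik /=.
  by rewrite scaler_nat; apply: subspMn.
rewrite scaler_suml; apply: subsp_sum => // r rk.
by rewrite -scalerA; apply: stW => //; apply: IHm.
Qed.

(** Everything here is a congruence modulo the gl_k-stable subspace W, modulo which x is a highest
    weight vector: E_ir is moved past the matrix entry by [mpow_comm] and then sends x into W. *)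
Lemma mpow_act m (i r j : 'I_n) : (i < r < k)%N -> (j < k)%N ->
  W (E i r *: (mpow k m r j *: x)
     - (mpow k m i j *: x - (mpow k m r r *: x) *+ (j == i))).
Proof.
move=> /andP[ir rk] jk; have ik := ltn_trans ir rk.
rewrite scalerA mpow_comm // scalerDl scalerBl !scalerMnl eqxx mulr1n addrK -scalerA.
by apply: mpow_stable => //; apply: x_raise; rewrite ir.
Qed.

Lemma mpow_raise m (i j : 'I_n) : (i < j < k)%N -> W (mpow k m i j *: x).
Proof.
elim: m i j => [|m IHm] i j /andP[ij jk] /=.
  by rewrite -val_eqE /= ltn_eqF // scale0r.
have ik := ltn_trans ij jk.
rewrite scaler_suml; apply: subsp_sum => // r rk; rewrite -scalerA.
have [rj|jr] := ltnP r j; first by apply: stW => //; apply: IHm; rewrite rj.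
have ir : (i < r < k)%N by rewrite (leq_trans ij).
have := mpow_act m ir jk; rewrite -val_eqE /= gtn_eqF // mulr0n subr0.
move=> h; rewrite -[X in W X](subrK (mpow k m i j *: x)).
by apply: subspD => //; apply: IHm; rewrite ij.
Qed.

Let subr_chain (V : zmodType) (y a b c d : V) :
  y - (c - d) = (y - (a - b)) + ((a - c) - (b - d)).
Proof. by rewrite [- (b - d)]opprD [X in _ = _ + X]addrACA -opprD addrA subrK. Qed.

Lemma mpow_diag m (i : 'I_n) : (i < k)%N ->
  W (mpow k m i i *: x - (hwt l k m i)%:A *: x).
Proof.
elim: m i => [|m IHm] i ik /=; first by rewrite eqxx !scale1r subrr.
pose t r := hwt l k m r.
(* Scalar by which E_ir times the entry (r, i) of the m-th power acts on x modulo W. The k - 1 - i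
   copies of t i coming from the r > i turn mu i into l i. *)
pose G (r : nat) : K := if (r < i)%N then 0
  else if r == i then mu i * t i else t i - t r.
have -> : l i * t i - \sum_(i.+1 <= r < k) t r = \sum_(r < n | (r < k)%N) G r.
  rewrite (big_ord_narrow kn) -(big_mkord xpredT G) (big_cat_nat (leq0n i) (ltnW ik)) /=.
  have -> : \sum_(0 <= r < i) G r = 0 by rewrite big_nat big1 // => r /andP[_ ri]; rewrite /G ri.
  rewrite add0r.
  rewrite [in RHS]big_ltn // /G ltnn eqxx.
  have -> : \sum_(i.+1 <= r < k) (if (r < i)%N then 0
      else if r == i then mu i * t i else t i - t r)
      = \sum_(i.+1 <= r < k) (t i - t r).
    by apply: eq_big_nat => r /andP[ir _]; rewrite ltnNge (ltnW ir) gtn_eqF.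
  rewrite sumrB addrA; congr (_ - _); rewrite sumr_const_nat mulrDl mulr_natl.
  by congr (_ + _ *+ _); rewrite -subn1 subnAC subn1 -subnS.
rewrite !scaler_suml -sumrB; apply: subsp_sum => // r rk; rewrite -scalerA /G.
case: ltngtP => [ri|ir|/val_inj ri].
- rewrite !scale0r subr0; apply: stW => //; apply: mpow_raise.
  by rewrite ri.
- have irk : (i < r < k)%N by rewrite ir.
  have := mpow_act m irk ik; rewrite eqxx mulr1n => h.
  rewrite !scalerBl (subr_chain _ (mpow k m i i *: x) (mpow k m r r *: x)).
  by apply: subspD => //; apply: subspB => //; apply: IHm.
- rewrite ri.
  have -> : E i i *: (mpow k m i i *: x) - (mu i * t i)%:A *: x =
      E i i *: (mpow k m i i *: x - (t i)%:A *: x) + (t i)%:A *: (E i i *: x - (mu i)%:A *: x).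
    rewrite !scalerBr (scale_algC (E i i)) addrA subrK; congr (_ - _).
    by rewrite scalerA mulr_algl scalerA mulrC.
  apply: subspD => //; first by apply: stW => //; apply: IHm.
  by apply: subspZ => //; apply: x_weight.
Qed.

Lemma casimir_hw m : W (casimir k m *: x - (\sum_(0 <= i < k) hwt l k m i)%:A *: x).
Proof.
have -> : \sum_(0 <= i < k) hwt l k m i = \sum_(i < n | (i < k)%N) hwt l k m i.
  by rewrite (big_ord_narrow kn) big_mkord.
rewrite !scaler_suml -sumrB; apply: subsp_sum => // i ik.
exact: mpow_diag.
Qed.

End HighestWeight.

Lemma casimir_casimir_comm k m l q : casimir k m * casimir l q = casimir l q * casimir k m.
Proof.
wlog kl : k m l q / (l <= k)%N.
  by move=> h; case: (leqP l k) => [|/ltnW] kl; [|apply/esym]; apply: h.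
apply: casimir_centralize => a b al bl.
by rewrite casimir_comm // (leq_trans _ kl).
Qed.

Lemma casimir_diag_comm k m (i : 'I_n) : E i i * casimir k m = casimir k m * E i i.
Proof.
have [ik|ki] := ltnP i k; first exact: casimir_comm.
apply: casimir_centralize => a b ak bk; rewrite E_comm.
have ne (c : 'I_n) : (c < k)%N -> (i == c) = false.
  by move=> ck; rewrite -val_eqE /= gtn_eqF // (leq_trans ck).
by rewrite [b == i]eq_sym !ne // subr0 addr0.
Qed.

Lemma gt_genE (k i : nat) (kn : (k <= n)%N) :
  \sum_(r : {ffun 'I_i.+1 -> 'I_k}) \prod_(t < i.+1)
     E (widen_ord kn (r t)) (widen_ord kn (r (ordS t))) = casimir k i.+1.
Proof.
rewrite (cyclic_sumE (fun x y => E (widen_ord kn x) (widen_ord kn y))).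
rewrite /casimir (big_ord_narrow kn); apply: eq_bigr => x _; move: {2 4}x => y.
elim: i.+1 x y => [|m IHm] x y //=.
by rewrite (big_ord_narrow kn); apply: eq_bigr => z _; rewrite IHm.
Qed.

End Casimir.

(** * The Perelomov-Popov formula for the eigenvalues *)

Section PerelomovPopov.

Lemma rmorph_hwt (R S : comNzRingType) (f : {rmorphism R -> S}) (l : nat -> R) k m i :
  f (hwt l k m i) = hwt (f \o l) k m i.
Proof.
elim: m i => [|m IHm] i; first exact: rmorph1.
rewrite /= rmorphB rmorphM IHm rmorph_sum; congr (_ - _).
by apply: eq_bigr => r _; apply: IHm.
Qed.

Lemma eq_hwt (R : comNzRingType) (l l' : nat -> R) k m i : (i < k)%N ->
  (forall j, (j < k)%N -> l j = l' j) -> hwt l k m i = hwt l' k m i.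
Proof.
move=> + ll; elim: m i => [|m IHm] i ik //=.
rewrite ll // IHm //; congr (_ - _).
by rewrite !big_nat; apply: eq_bigr => r /andP[_ rk]; apply: IHm.
Qed.

Variables (F : fieldType) (k : nat) (l : nat -> F).
Hypothesis l_inj : forall i j, (i < k)%N -> (j < k)%N -> i != j -> l i != l j.

(** For j >= i this is, up to sign, the residue at x = l j of the product of the 1 - 1 / (x - l r)
    for i <= r < k, which [partial_fractions] expands. *)
Let c i j : F := \prod_(i <= r < k | r != j) (1 - (l j - l r)^-1).

Let cS i j : (i < j)%N -> (j < k)%N -> c i j = (1 + (l i - l j)^-1) * c i.+1 j.
Proof.
move=> ij jk; rewrite /c big_ltn_cond ?(ltn_trans ij) // ltn_eqF //.
by rewrite -[l j - l i]opprB invrN opprK.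
Qed.

Let cc i : (i < k)%N -> c i i = \prod_(i.+1 <= r < k) (1 - (l i - l r)^-1).
Proof.
move=> ik; rewrite /c big_ltn_cond // eqxx big_nat_cond [RHS]big_nat_cond.
by apply: eq_bigl => r; case: (ltngtP i r).
Qed.

Let partial_fractions i x : (i <= k)%N ->
  (forall j, (i <= j < k)%N -> x != l j) ->
  \sum_(i <= j < k) c i j / (x - l j) = 1 - \prod_(i <= r < k) (1 - (x - l r)^-1).
Proof.
move=> ik; have: ((k - i) + i)%N = k by rewrite subnK.
move: (k - i)%N => d; elim: d i x {ik} => [|d IHd] i x.
  by rewrite add0n => ->; rewrite !big_geq // subrr.
rewrite addSnnS => dk xl; have ik : (i < k)%N by rewrite -dk leq_addl.
have xi : x - l i != 0 by rewrite subr_eq0 xl // leqnn.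
have IHx := IHd i.+1 x dk (fun j h => xl j (introT andP (conj (ltnW (proj1 (andP h))) (proj2 (andP h))))).
have IHi : \sum_(i.+1 <= j < k) c i.+1 j / (l i - l j) = 1 - c i i.
  rewrite cc // IHd // => j /andP[ij jk].
  by apply: l_inj => //; rewrite ltn_eqF.
rewrite [in LHS]big_ltn // [in RHS]big_ltn //.
have -> : \sum_(i.+1 <= j < k) c i j / (x - l j) =
   (1 - (x - l i)^-1) * \sum_(i.+1 <= j < k) c i.+1 j / (x - l j)
   + (x - l i)^-1 * \sum_(i.+1 <= j < k) c i.+1 j / (l i - l j).
  rewrite !mulr_sumr -big_split /=; apply: eq_big_nat => j /andP[ij jk].
  rewrite cS //; have xj : x - l j != 0 by rewrite subr_eq0 xl // (ltnW ij).
  have lj : l i - l j != 0 by rewrite subr_eq0 l_inj // ltn_eqF.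
  by field; rewrite xj lj xi.
by rewrite IHx IHi; field.
Qed.

(** In the recursion of [hwt] at i, the tail sum from i + 1 is a source term, known by induction.
    [hwtE] is the solution; its initial value 1 is the partial fraction identity at x = l i. *)
Let hwt_tail m i : (i <= k)%N ->
  \sum_(i <= j < k) hwt l k m j = \sum_(i <= j < k) l j ^+ m * c i j.
Proof.
move=> ik; have: ((k - i) + i)%N = k by rewrite subnK.
move: (k - i)%N => d; elim: d i m {ik} => [|d IHd] i m.
  by rewrite add0n => ->; rewrite !big_geq.
rewrite addSnnS => dk; have ik : (i < k)%N by rewrite -dk leq_addl.
have lij j : (i < j < k)%N -> l i - l j != 0.
  by move=> /andP[ij jk]; rewrite subr_eq0 l_inj // ltn_eqF.
have IHi : \sum_(i.+1 <= j < k) c i.+1 j / (l i - l j) = 1 - c i i.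
  rewrite cc // partial_fractions // => j ijk.
  by rewrite -subr_eq0 lij.
have hwtE q : hwt l k q i = l i ^+ q * c i i
    + \sum_(i.+1 <= j < k) l j ^+ q * (c i.+1 j / (l i - l j)).
  elim: q => [|q IHq].
    under eq_bigr do rewrite expr0 mul1r.
    by rewrite IHi expr0 mul1r addrC subrK.
  rewrite /= IHq IHd // mulrDr mulrA -exprS -addrA; congr (_ + _).
  rewrite mulr_sumr -sumrB; apply: eq_big_nat => j ijk.
  by rewrite exprS; field; apply: lij.
rewrite big_ltn // [RHS]big_ltn // hwtE IHd // -addrA; congr (_ + _).
rewrite -big_split /=; apply: eq_big_nat => j /andP[ij jk].
rewrite (cS ij jk); have := lij j; rewrite ij jk => /(_ isT) h; by field.
Qed.

Lemma hwt_sum m : \sum_(0 <= j < k) hwt l k m j =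
  \sum_(j < k) l j ^+ m * \prod_(r < k | r != j) (1 - 1 / (l j - l r)).
Proof.
rewrite hwt_tail // big_mkord; apply: eq_bigr => j _; congr (_ * _).
rewrite /c big_mkord; apply: eq_bigr => r _.
by rewrite div1r.
Qed.

End PerelomovPopov.

Section Gamma.
Variables (K : fieldType) (n : nat).

(** In the fraction field the shifted indeterminates are distinct, so [hwt_sum] applies. The
    right-hand side exhibits the rational function as a polynomial, which is then the one chosen by
    [xget], and which can be evaluated at coinciding entries. *)
Lemma gammaE (k i : nat) : gamma K k.+1 i =
  \sum_(0 <= j < k.+1) hwt (fun j => 'X_(inord j) + k.+1%:R - 1 : {mpoly K[k.+1]}) k.+1 i j.
Proof.
pose l j : {mpoly K[k.+1]} := 'X_(inord j) + k.+1%:R - 1.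
set p := RHS.
have pE : tofrac p = gamma_rat K k.+1 i.
  rewrite /p rmorph_sum; under eq_bigr do rewrite rmorph_hwt.
  rewrite hwt_sum.
    apply: eq_bigr => j _; rewrite /= /l inord_val; congr (_ * _).
    apply: eq_bigr => m _; rewrite inord_val -tofracB.
    by congr (1 - 1 / _); rewrite -tofracB; congr tofrac; ring.
  move=> a b ak bk; apply: contraNneq => /eqP; rewrite /= tofrac_eq => /eqP.
  move=> /addIr/addIr/(congr1 (mcoeff U_(inord a))); rewrite !mcoeffXU eqxx.
  case: eqP => [/(congr1 val)|_ /eqP]; last by rewrite oner_eq0.
  by rewrite /= !inordK // => ->.
rewrite /gamma; case: xgetP => [q _ /= qE|/(_ p)]; last by rewrite /= pE.
by apply/eqP; rewrite -tofrac_eq qE pE.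
Qed.

Lemma gamma_atE (v : {ffun mu n -> K}) (a : mu n) :
  gamma_at v a = \sum_(0 <= j < (tag a).+1)
    hwt (fun j => v (idx (inord j : 'I_(tag a).+1)) + (tag a)%:R) (tag a).+1 (tagged a).+1 j.
Proof.
rewrite /gamma_at gammaE rmorph_sum; apply: eq_big_nat => j jk.
rewrite rmorph_hwt; apply: eq_hwt => // r rk /=.
by rewrite rmorphB rmorphD /= mevalXU rmorph_nat rmorph1 -natr1 addrA addrK.
Qed.

End Gamma.

(** * The eigenvalues determine a row up to permutation *)

Section Generating.
Variables (K : numFieldType).
Implicit Types (s t : seq K).

Definition qprod s : {poly K} := \prod_(x <- s) (1 - x *: 'X).

Lemma size_qprod s : (size (qprod s) <= (size s).+1)%N.
Proof.
rewrite /qprod; elim: s => [|x s IHs]; first by rewrite big_nil size_poly1.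
rewrite big_cons; apply: leq_trans (size_polyMleq _ _) _.
have : (size (1 - x *: 'X : {poly K})%R <= 2)%N.
  apply: leq_trans (size_polyD _ _) _; rewrite size_poly1 size_polyN geq_max /=.
  by apply: leq_trans (size_scale_leq _ _) _; rewrite size_polyX.
by move: IHs; set p := size _; set q := size _; rewrite /=; lia.
Qed.

Lemma qprod0 s : (qprod s)`_0 = 1.
Proof.
rewrite -horner_coef0 /qprod horner_prod big1 // => x _.
by rewrite !hornerE ?mulr0 ?subr0.
Qed.

(** The homogeneous form lets the same coefficients give the product of the X - x (a = X, b = 1) and
    that of the 1 - (x + 1) X (a = 1 - X, b = X). *)
Lemma qprod_homog s (a b : {poly K}) : \prod_(x <- s) (a - x *: b)
  = \sum_(i < (size s).+1) (qprod s)`_i *: (a ^+ (size s - i) * b ^+ i).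
Proof.
elim: s => [|x s IHs].
  by rewrite /qprod !big_nil big_ord1 coef1 scale1r !expr0 mulr1.
rewrite big_cons IHs /= mulrBl.
have cE i : (qprod (x :: s))`_i = (qprod s)`_i - x * (if i is j.+1 then (qprod s)`_j else 0).
  rewrite /qprod big_cons mulrBl mul1r coefB -scalerAl coefZ coefXM.
  by case: i.
under [RHS]eq_bigr do rewrite cE scalerBl.
rewrite sumrB; congr (_ - _).
  rewrite [RHS]big_ord_recr /= [X in _ + X *: _]nth_default ?size_qprod // scale0r addr0.
  rewrite mulr_sumr; apply: eq_bigr => i _.
  by rewrite -scalerAr mulrA -exprS subSn // -ltnS.
rewrite [RHS]big_ord_recl /= mulr0 scale0r add0r mulr_sumr.
apply: eq_bigr => i _; rewrite /bump /= add1n subSS -scalerAl -scalerAr scalerA.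
by rewrite exprS mulrCA.
Qed.

Variable k : nat.

Definition casimir_ev (l : nat -> K) m := \sum_(0 <= j < k) hwt l k m j.

Definition tail_poly (l : nat -> K) N i : {poly K} :=
  \poly_(c < N) (if c is m.+1 then - \sum_(i <= j < k) hwt l k m j else 1).

Lemma dvdXnP N (p : {poly K}) : (forall c, (c < N)%N -> p`_c = 0) <-> 'X^N %| p.
Proof.
split=> [h|/dvdpP[q ->] c cN]; last by rewrite coefMXn cN.
rewrite -[p](poly_take_drop N) (_ : take_poly N p = 0) ?add0r ?dvdp_mull //.
by apply/polyP => c; rewrite coef_take_poly coef0; case: ifP => // /h.
Qed.

(* For i = 0, this says that Q (1 - sum_m ev_m X^(m+1)) is the product of the
   1 - (l_j + 1) X, for Q the product of the 1 - l_j X, so that ev_m is symmetric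
   in l; conversely the ev_m determine Q, since the product of the 1 - (l_j + 1) X
   is obtained from Q by a linear substitution. *)
Lemma qprod_tail (l : nat -> K) N i : (i <= k)%N ->
  'X^(N.+1) %| qprod [seq l j | j <- index_iota i k] * tail_poly l N.+1 i
             - qprod [seq l j + 1 | j <- index_iota i k].
Proof.
move=> ik; have: ((k - i) + i)%N = k by rewrite subnK.
move: (k - i)%N => d; elim: d i {ik} => [|d IHd] i.
  rewrite add0n => ->; rewrite /index_iota subnn /= /qprod !big_nil mul1r.
  apply/dvdXnP => c cN; rewrite coefB coef_poly cN coef1.
  by case: c cN => [|c] _ /=; rewrite ?subrr // big_geq // subr0 oppr0.
rewrite addSnnS => dk; have ik : (i < k)%N by rewrite -dk leq_addl.
have -> : index_iota i k = i :: index_iota i.+1 k.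
  by rewrite /index_iota -(subnSK ik).
set s := index_iota i.+1 k; rewrite /= /qprod !big_cons.
set Q := qprod [seq l j | j <- s]; rewrite -/Q -/(qprod _).
set Qp := qprod [seq l j + 1 | j <- s]; rewrite -/Qp.
set P := 1 - l i *: 'X; set Pp := 1 - _ *: 'X.
(* Coefficient by coefficient, this is the recursion that defines [hwt]. *)
have step : 'X^(N.+1) %| P * tail_poly l N.+1 i - Pp * tail_poly l N.+1 i.+1.
  apply/dvdXnP => c cN; rewrite !(coefB, mulrBl, mul1r) -!scalerAl !coefZ !coefXM.
  rewrite !coef_poly cN; case: c cN => [|c] cN /=; first by rewrite !mulr0 !subrr.
  rewrite (ltnW cN); case: c cN => [|c] cN /=.
    rewrite big_ltn //= !mulr1; ring.
  have -> : \sum_(i <= j < k) hwt l k c.+1 j = hwt l k c.+1 i + \sum_(i.+1 <= j < k) hwt l k c.+1 j.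
    by rewrite big_ltn.
  rewrite [\sum_(i <= j < k) hwt l k c j]big_ltn //=; ring.
have -> : P * Q * tail_poly l N.+1 i - Pp * Qp =
  Q * (P * tail_poly l N.+1 i - Pp * tail_poly l N.+1 i.+1)
  + Pp * (Q * tail_poly l N.+1 i.+1 - Qp) by ring.
by rewrite dvdp_add ?dvdp_mull // IHd.
Qed.

Lemma casimir_ev_sym (l l' : nat -> K) m :
  perm_eq [seq l j | j <- iota 0 k] [seq l' j | j <- iota 0 k] ->
  casimir_ev l m = casimir_ev l' m.
Proof.
move=> ll'; have := @qprod_tail l m.+1 0 (leq0n k); have := @qprod_tail l' m.+1 0 (leq0n k).
rewrite /index_iota subn0.
have -> : qprod [seq l' j | j <- iota 0 k] = qprod [seq l j | j <- iota 0 k].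
  by rewrite /qprod (perm_big _ ll').
have -> : qprod [seq l' j + 1 | j <- iota 0 k] = qprod [seq l j + 1 | j <- iota 0 k].
  apply: perm_big; rewrite perm_sym.
  by have := perm_map (fun x => x + 1) ll'; rewrite -!map_comp.
(* Q has constant term 1, so it is coprime to X and can be cancelled modulo a power of X. *)
set Q := qprod _ => h' h; have := dvdp_sub h h'.
rewrite opprB addrA subrK -mulrBr Gauss_dvdpr; last first.
  apply: coprimep_expl; rewrite coprimep_sym -[X in coprimep _ X]subr0 -polyC0.
  by rewrite coprimep_XsubC rootE horner_coef0 qprod0 oner_eq0.
move/dvdXnP/(_ m.+1 (ltnSn _)); rewrite coefB !coef_poly ltnSn.
by move/eqP; rewrite subr_eq0 => /eqP/oppr_inj.
Qed.

Let coef_1X m : (((1 - 'X) ^+ m : {poly K})`_0 = 1) * (((1 - 'X) ^+ m : {poly K})`_1 = - m%:R).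
Proof.
elim: m => [|m [IH0 IH1]]; first by rewrite expr0 !coef1 oppr0.
by rewrite exprS !mulrBl !mul1r !coefB !coefXM /= IH0 IH1 subr0 -natr1 opprD.
Qed.

(** Let D be the difference of the two [qprod]. If its coefficients below j vanish, the coefficient
    of X^(j+1) gives D_{j+1} - k D_j = D_{j+1} - (k - j) D_j, that is, j D_j = 0. Here k is the
    eigenvalue for m = 0, and D_0 = 0 because both constant terms are 1. *)
Lemma casimir_ev_sep (l l' : nat -> K) :
  (forall m, (m <= k)%N -> casimir_ev l m = casimir_ev l' m) ->
  perm_eq [seq l j | j <- iota 0 k] [seq l' j | j <- iota 0 k].
Proof.
move=> ll'; set s := map _ _; set s' := map _ _.
have ss : size s = k by rewrite size_map size_iota.
have ss' : size s' = k by rewrite size_map size_iota.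
suff Qss' : qprod s = qprod s'.
  apply: prod_XsubC_eq.
  have XE t : \prod_(x <- t) ('X - x%:P) = \prod_(x <- t) ('X - x *: 1 : {poly K}).
    by apply: eq_bigr => x _; rewrite alg_polyC.
  by rewrite !XE !qprod_homog ss ss' Qss'.
have := @qprod_tail l k.+1 0 (leq0n k); have := @qprod_tail l' k.+1 0 (leq0n k).
rewrite /index_iota subn0 -/s -/s'.
have -> : tail_poly l' k.+2 0 = tail_poly l k.+2 0.
  apply/polyP => c; rewrite !coef_poly; case: ifP => //; case: c => // m mk.
  by congr (- _); apply/esym/ll'.
have QpE (g : nat -> K) : qprod [seq g j + 1 | j <- iota 0 k] =
    \sum_(i < k.+1) (qprod [seq g j | j <- iota 0 k])`_i *: ((1 - 'X) ^+ (k - i) * 'X ^+ i).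
  have := qprod_homog [seq g j | j <- iota 0 k] (1 - 'X) 'X.
  rewrite size_map size_iota => <-; rewrite /qprod !big_map; apply: eq_bigr => j _.
  by rewrite scalerDl scale1r opprD addrA addrAC.
rewrite !QpE -/s -/s'; set F := tail_poly _ _ _ => h' h.
have {h h'} := dvdp_sub h h'.
pose D := qprod s - qprod s'.
have -> : qprod s * F - (\sum_(i < k.+1) (qprod s)`_i *: ((1 - 'X) ^+ (k - i) * 'X ^+ i)) -
   (qprod s' * F - (\sum_(i < k.+1) (qprod s')`_i *: ((1 - 'X) ^+ (k - i) * 'X ^+ i)))
   = D * F - \sum_(i < k.+1) D`_i *: ((1 - 'X) ^+ (k - i) * 'X ^+ i).
  under [X in _ = _ - X]eq_bigr do rewrite coefB scalerBl.
  rewrite sumrB mulrBl; ring.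
move/dvdXnP => h; apply/eqP; rewrite -subr_eq0 -/D; apply/eqP/polyP => j.
rewrite coef0; elim/ltn_ind: j => j IHj.
have [jk|jk] := ltnP k j.
  rewrite nth_default // (leq_trans (size_polyD _ _)) // size_polyN geq_max.
  by rewrite !(leq_trans (size_qprod _)) ?ss ?ss'.
have j0 : j != 0%N \/ D`_j = 0.
  by case: j {IHj jk} => [|j]; [right; rewrite coefB !qprod0 subrr|left].
case: j0 => [j0|//].
have Dsz c : (k < c)%N -> D`_c = 0.
  move=> kc; rewrite nth_default // (leq_trans (size_polyD _ _)) // size_polyN geq_max.
  by rewrite !(leq_trans (size_qprod _)) ?ss ?ss'.
have S2E : (\sum_(i < k.+1) D`_i *: ((1 - 'X) ^+ (k - i) * 'X ^+ i))`_j.+1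
    = D`_j.+1 - (k - j)%:R * D`_j.
  have term (i : 'I_k.+1) : (i <= j.+1)%N ->
      (D`_i *: ((1 - 'X) ^+ (k - i) * 'X ^+ i))`_j.+1
        = D`_i * ((1 - 'X) ^+ (k - i))`_(j.+1 - i).
    by move=> ij; rewrite coefZ coefMXn ltnNge ij.
  have big i : (j.+1 < i)%N -> (D`_i *: ((1 - 'X) ^+ (k - i) * 'X ^+ i))`_j.+1 = 0.
    by move=> ij; rewrite coefZ coefMXn ij mulr0.
  have jk1 : (j < k.+1)%N by [].
  rewrite coef_sum (bigD1 (Ordinal jk1)) // (term (Ordinal jk1)) /= ?leqnSn // subSn // subnn coef_1X.
  rewrite addrC mulrN mulrC; congr (_ - _).
  have small (i : 'I_k.+1) : i != Ordinal jk1 -> (nat_of_ord i != j.+1) ->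
      (D`_i *: ((1 - 'X) ^+ (k - i) * 'X ^+ i))`_j.+1 = 0.
    rewrite -val_eqE /= => ij ij1; have [lt|gt|/eqP] := ltngtP i j.+1; last by rewrite (negbTE ij1).
      by rewrite coefZ IHj ?mul0r // ltn_neqAle ij -ltnS.
    exact: big.
  have [jk'|kj] := ltnP j k; last first.
    rewrite big1 ?Dsz // => i ij; apply: small => //.
    by rewrite ltn_eqF // (leq_trans (ltn_ord i)).
  have jk2 : (j.+1 < k.+1)%N by [].
  rewrite (bigD1 (Ordinal jk2)) /=; last by rewrite -val_eqE /= gtn_eqF.
  rewrite (term (Ordinal jk2)) /= // subnn coef_1X mulr1 big1 ?addr0 // => i /andP[ij ij1].
  exact: small.
have := h j.+1; rewrite ltnS ltnS jk => /(_ isT); rewrite coefB S2E coefM.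
rewrite !big_ord_recr big1 => [|i _] /=; last by rewrite IHj ?mul0r.
rewrite subSn // !subnn add0r !coef_poly /= sumr_const_nat subn0 natrB // => /eqP.
rewrite (_ : _ - _ = - (j%:R * D`_j)); last ring.
by rewrite oppr_eq0 mulf_eq0 pnatr_eq0 (negbTE j0) => /eqP.
Qed.

End Generating.

(** * Triangular actions of commutative algebras *)

Section Triangular.
Variables (K : fieldType) (U : algType K) (M : lmodType U) (S : Type) (g : S -> U).
Variables (T : eqType) (m : T -> M) (crd : M -> T -> K).
Variables (gt : T -> T -> Prop) (deg : T -> nat) (fib : nat -> seq T).
Variable theta : T -> S -> K.

Local Notation G := (span_alg (range g)).

Hypothesis g_comm : forall s t, g s * g t = g t * g s.
Hypothesis crdL : forall a x y b, crd (a%:A *: x + y) b = a * crd x b + crd y b.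
Hypothesis crd_m : forall a b, crd (m a) b = (a == b)%:R.
Hypothesis crd_supp : forall x, exists s : seq T, forall b, crd x b != 0 -> b \in s.
Hypothesis crd_inj : forall x, (forall b, crd x b = 0) -> x = 0.
Hypothesis gt_trans : forall a b c, gt a b -> gt b c -> gt a c.
Hypothesis gt_irr : forall a, ~ gt a a.
Hypothesis fibP : forall D a, (a \in fib D) = (deg a <= D)%N.
Hypothesis g_tri : forall s a b, crd (g s *: m a - (theta a s)%:A *: m a) b != 0 ->
  deg b = deg a /\ gt b a.

Let crdD x y b : crd (x + y) b = crd x b + crd y b.
Proof. by have := crdL 1 x y b; rewrite scale1r mul1r scale1r. Qed.

Let crd0 b : crd 0 b = 0.
Proof. by apply: (addrI (crd 0 b)); rewrite -crdD !addr0. Qed.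

Let crdZ a x b : crd (a%:A *: x) b = a * crd x b.
Proof. by rewrite -[_ *: x]addr0 crdL crd0 addr0. Qed.

Let crdN x b : crd (- x) b = - crd x b.
Proof. by apply: (addrI (crd x b)); rewrite -crdD !subrr crd0. Qed.

Let crd_sum (I : Type) (r : seq I) (F : I -> M) b :
  crd (\sum_(i <- r) F i) b = \sum_(i <- r) crd (F i) b.
Proof. by elim: r => [|i r IHr]; rewrite ?big_nil ?crd0 // !big_cons crdD IHr. Qed.

Let expansion x (s : seq T) : uniq s -> (forall b, crd x b != 0 -> b \in s) ->
  x = \sum_(c <- s) (crd x c)%:A *: m c.
Proof.
move=> us xs; apply/eqP; rewrite -subr_eq0; apply/eqP/crd_inj => b.
rewrite crdD crdN crd_sum; under eq_bigr do rewrite crdZ crd_m.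
have [bs|bs] := boolP (b \in s).
  rewrite (bigD1_seq b) //= eqxx mulr1 big1 ?addr0 ?subrr // => c /negbTE->.
  by rewrite mulr0.
rewrite big_seq big1 ?subr0 => [|c cs].
  by apply/eqP; apply: contraNT bs => /xs.
by case: eqP cs bs => [->->|_ _ _]; rewrite ?mulr0.
Qed.

Let crd_act_ex y x b : crd (y *: x) b != 0 ->
  exists c, crd x c != 0 /\ crd (y *: m c) b != 0.
Proof.
have [s xs] := crd_supp x; have us := undup_uniq s.
rewrite {1}[x](expansion us) => [|c /xs]; last by rewrite mem_undup.
rewrite scaler_sumr crd_sum => nz; apply: contrapT => h; case/eqP: nz.
rewrite big1 // => c _; rewrite scale_algC crdZ.
have [->|xc] := eqVneq (crd x c) 0; first by rewrite mul0r.
have [->|yc] := eqVneq (crd (y *: m c) b) 0; first by rewrite mulr0.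
by case: h; exists c.
Qed.

Let crd_act1 y x b : (forall c, c != b -> crd x c != 0 -> crd (y *: m c) b = 0) ->
  crd (y *: x) b = crd x b * crd (y *: m b) b.
Proof.
have [s [us sb xs]] : exists s, [/\ uniq s, b \in s & forall c, crd x c != 0 -> c \in s].
  have [s xs] := crd_supp x; exists (undup (b :: s)); split; first exact: undup_uniq.
    by rewrite mem_undup mem_head.
  by move=> c /xs cs; rewrite mem_undup inE cs orbT.
move=> h; rewrite {1}[x](expansion us xs) scaler_sumr crd_sum (bigD1_seq b) //=.
rewrite scale_algC crdZ big1 ?addr0 // => c cb.
by rewrite scale_algC crdZ; have [->|xc] := eqVneq (crd x c) 0; rewrite ?mul0r // h ?mulr0.
Qed.

Let ge b a := b = a \/ (deg b = deg a /\ gt b a).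
Let tri y := forall a b, crd (y *: m a) b != 0 -> ge b a.

Definition diag (y : U) (a : T) : K := crd (y *: m a) a.

Let ge_trans a b c : ge a b -> ge b c -> ge a c.
Proof.
move=> [->//|[dab gab]] [<-|[dbc gbc]]; first by right.
by right; split; [rewrite dab|apply: gt_trans gbc].
Qed.

Let ge_anti a b : ge a b -> ge b a -> a = b.
Proof.
by move=> [//|[_ gab]] [//|[_ gba]]; case: (@gt_irr a); apply: gt_trans gba.
Qed.

Let triM y y' : tri y -> tri y' -> tri (y * y').
Proof.
move=> ty ty' a b; rewrite -scalerA => /crd_act_ex[c [/ty' ca /ty bc]].
exact: ge_trans ca.
Qed.

Let diagM y y' a : tri y -> tri y' -> diag (y * y') a = diag y a * diag y' a.
Proof.
move=> ty ty'; rewrite /diag -scalerA mulrC; apply: crd_act1 => c ca /ty' gca.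
by apply/eqP; apply: contraNT ca => /ty gac; rewrite (ge_anti gca gac).
Qed.

Let diag1 a : diag 1 a = 1.
Proof. by rewrite /diag scale1r crd_m eqxx. Qed.

Let diagL a b y y' : diag (a *: y + y') b = a * diag y b + diag y' b.
Proof. by rewrite /diag scalerDl -mulr_algl -scalerA crdL. Qed.

Let diag_g s a : diag (g s) a = theta a s.
Proof.
have /eqP : crd (g s *: m a - (theta a s)%:A *: m a) a = 0.
  by apply/eqP/negPn/negP => /g_tri[_ /gt_irr].
by rewrite crdD crdN crdZ crd_m eqxx mulr1 subr_eq0 => /eqP.
Qed.

Let G_sub : subalgebra G.
Proof.
split=> [B [[]]//|a x y Gx Gy B hB|x y Gx Gy B hB]; have [[_ BL BM] _] := hB.
- by apply: BL; [apply: Gx|apply: Gy].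
- by apply: BM; [apply: Gx|apply: Gy].
Qed.

Let G_g s : G (g s).
Proof. by move=> B [_]; apply; exists s. Qed.

Let G_tri y : G y -> tri y.
Proof.
move=> /(_ tri); apply; split; first split.
- by move=> a b; rewrite scale1r crd_m; case: (eqVneq a b) => [->|_]; [left|rewrite eqxx].
- move=> c x z tx tz a b; rewrite scalerDl -mulr_algl -scalerA crdL.
  have [e|/tx//] := eqVneq (crd (x *: m a) b) 0.
  by rewrite e mulr0 add0r => /tz.
- exact: triM.
move=> _ [s _ <-] a b; have [->|ba] := eqVneq b a; first by left.
move=> nz; right; apply: (@g_tri s).
by rewrite crdD crdN crdZ crd_m [a == b]eq_sym (negbTE ba) mulr0 subr0.
Qed.

Let GM x y : G x -> G y -> G (x * y). Proof. by case: G_sub => _ _; apply. Qed.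
Let G1 : G 1. Proof. by case: G_sub. Qed.
Let GL a x y : G x -> G y -> G (a *: x + y). Proof. by case: G_sub => _ + _; apply. Qed.
Let GX x r : G x -> G (x ^+ r).
Proof. by move=> Gx; elim: r => [|r IHr]; rewrite ?expr0 // exprS; apply: GM. Qed.

Let G_comm x y : G x -> G y -> x * y = y * x.
Proof.
move=> Gx Gy; apply: (Gy [set z | x * z = z * x]); split; first split.
- by rewrite /= mulr1 mul1r.
- by move=> a z t /= hz ht; rewrite mulrDr mulrDl -scalerAl -scalerAr hz ht.
- by move=> z t /= hz ht; rewrite mulrA hz -mulrA ht mulrA.
move=> _ [s _ <-]; apply: (Gx [set z | z * g s = g s * z]); split; first split.
- by rewrite /= mulr1 mul1r.
- by move=> a z t /= hz ht; rewrite mulrDr mulrDl -scalerAl -scalerAr hz ht.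
- by move=> z t /= hz ht; rewrite -mulrA ht mulrA hz mulrA.
by move=> _ [t _ <-]; apply: g_comm.
Qed.

Definition alg_character (f : U -> K) := [/\ f 1 = 1,
  (forall a x y, G x -> G y -> f (a *: x + y) = a * f x + f y)
  & (forall x y, G x -> G y -> f (x * y) = f x * f y)].

Lemma diag_character a : alg_character (diag^~ a) /\ forall s, diag (g s) a = theta a s.
Proof.
split=> //; split=> //.
by move=> x y Gx Gy; apply: diagM; apply: G_tri.
Qed.

Lemma alg_character_eq f f' : alg_character f -> alg_character f' ->
  (forall s, f (g s) = f' (g s)) -> forall y, G y -> f y = f' y.
Proof.
move=> [f1 fL fM] [f'1 f'L f'M] ff' y Gy.
suff [] : [set z | G z /\ f z = f' z] y by [].
apply: Gy; split; first split.
- by rewrite /= f1 f'1.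
- by move=> a x z [Gx ex] [Gz ez]; split; [apply: GL|rewrite fL // f'L // ex ez].
- by move=> x z [Gx ex] [Gz ez]; split; [apply: GM|rewrite fM // f'M // ex ez].
- by move=> _ [s _ <-]; split; [apply: G_g|].
Qed.

Variable f : U -> K.
Hypothesis f_char : alg_character f.

Definition gen_space : set M := [set x | exists r : nat, forall y : 'I_r -> U,
  (forall t, G (y t) /\ f (y t) = 0) -> (\prod_(t < r) y t) *: x = 0].

Let gen_space_ge x : gen_space x -> exists r0, forall r, (r0 <= r)%N ->
  forall y : 'I_r -> U, (forall t, G (y t) /\ f (y t) = 0) -> (\prod_(t < r) y t) *: x = 0.
Proof.
move=> [r0 h]; exists r0 => r /subnK; move: (r - r0)%N => d <- y hy.
by rewrite big_split_ord -scalerA h ?scaler0.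
Qed.

Lemma gen_space_subsp : subsp gen_space.
Proof.
split=> [|a x y /gen_space_ge[r hr] /gen_space_ge[q hq]].
  by exists 0%N => y _; rewrite scaler0.
exists (r + q)%N => z hz; rewrite scalerDr scale_algC hr ?leq_addr //.
by rewrite hq ?leq_addl // scaler0 addr0.
Qed.

Variable L : seq T.
Hypothesis L_uniq : uniq L.
Hypothesis LP : forall a, a \in L <-> forall s, theta a s = f (g s).

Let diag_L a y : a \in L -> G y -> diag y a = f y.
Proof.
move=> /LP La Gy; have [dchar dg] := diag_character a.
by apply: (alg_character_eq dchar f_char _ Gy) => s; rewrite dg.
Qed.

Let sepL b : b \notin L -> exists s, theta b s != f (g s).
Proof.
move=> bL; apply: contrapT => h; case/negP: bL; apply/LP => s.
by apply/eqP/negPn/negP => ne; apply: h; exists s.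
Qed.

Let factor b : exists q, G q /\ (b \notin L -> diag q b = 0) /\
  (forall a, a \in L -> diag q a != 0).
Proof.
have [bL|bL] := boolP (b \in L).
  by exists 1; split=> //; split=> // a _; rewrite diag1 oner_neq0.
have [s hs] := sepL bL; exists (- theta b s *: 1 + g s); split; first exact: GL.
split=> [_|a /LP aL]; rewrite diagL diag1 mulr1 diag_g; first by rewrite addNr.
by rewrite addrC subr_eq0 aL eq_sym.
Qed.

Let D0 := \max_(a <- L) deg a.
Let L_fib D a : (D0 <= D)%N -> a \in L -> a \in fib D.
Proof.
by move=> DD aL; rewrite fibP; apply: leq_trans DD; apply: leq_bigmax_seq.
Qed.

(** Q is a product of elements g s - theta b s, one for each b of [fib D0] outside L, with s chosen
    so that theta b s differs from f (g s). *)
Let projector : exists Q, [/\ G Q, (forall b, b \in fib D0 -> b \notin L -> diag Q b = 0)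
  & (forall a, a \in L -> diag Q a != 0)].
Proof.
elim: (fib D0) => [|b s [Q [GQ Q0 QL]]].
  by exists 1; split=> // a _; rewrite diag1 oner_neq0.
have [q [Gq [q0 qL]]] := factor b; exists (q * Q).
have tq := G_tri Gq; have tQ := G_tri GQ.
split=> [|c|a aL]; first exact: GM.
  rewrite inE diagM // => /predU1P[->|cs] cL; first by rewrite q0 ?mul0r.
  by rewrite Q0 ?mulr0.
by rewrite diagM // mulf_neq0 ?qL ?QL.
Qed.

(** Passing to a larger index of the finite set [fib D] strictly increases this number, so an
    element of G with zero diagonal on [fib D] is nilpotent there. *)
Let rank D b := count (fun c => `[< gt b c >]) (fib D).

Let rank_lt D b c : c \in fib D -> gt b c -> (rank D c < rank D b)%N.
Proof.
move=> cD bc; rewrite /rank -!size_filter.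
rewrite !size_filter; elim: (fib D) cD => //= d s IHs.
rewrite inE => /predU1P[<-|cs].
  case: asboolP => [/gt_irr//|_]; case: asboolP => // _.
  rewrite add0n add1n ltnS; apply: sub_count => e /asboolP ce.
  by apply/asboolP; apply: gt_trans ce.
rewrite -addnS; apply: leq_add; last exact: IHs.
case: (asboolP (gt c d)) => // cd.
by case: asboolP => // -[]; apply: gt_trans cd.
Qed.

Let V D j x := forall b, crd x b != 0 -> b \in fib D /\ (j <= rank D b)%N.

Let V_stable D j y x : G y -> V D j x -> V D j (y *: x).
Proof.
move=> Gy Vx b /crd_act_ex[c [/Vx[cD jc] /(G_tri Gy)[->//|[dbc bc]]]].
split; first by move: cD; rewrite !fibP dbc.
exact: leq_trans jc (ltnW (rank_lt cD bc)).
Qed.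

Let V_crd D j y x b : G y -> V D j x -> rank D b = j ->
  crd (y *: x) b = crd x b * diag y b.
Proof.
move=> Gy Vx bj; apply: crd_act1 => c cb /Vx[cD jc]; apply/eqP.
apply: contraNT cb => /(G_tri Gy)[->//|[_ bc]].
by have := rank_lt cD bc; rewrite bj ltnNge jc.
Qed.

Let V_step D j y x : G y -> (forall b, b \in fib D -> diag y b = 0) ->
  V D j x -> V D j.+1 (y *: x).
Proof.
move=> Gy y0 Vx b nz; have [bD jb] := V_stable Gy Vx nz; split=> //.
rewrite ltn_neqAle jb andbT; apply: contraNneq nz => bj.
by rewrite (V_crd Gy Vx) // y0 // mulr0.
Qed.

Let V_top D x : V D (size (fib D)).+1 x -> x = 0.
Proof.
move=> Vx; apply: crd_inj => b; apply/eqP/negPn/negP => /Vx[_].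
by rewrite ltnNge count_size.
Qed.

Let V_subsp D j : subsp (V D j).
Proof.
split=> [b|a x y Vx Vy b]; first by rewrite crd0 eqxx.
rewrite crdL; have [->|/Vx//] := eqVneq (crd x b) 0.
by rewrite mulr0 add0r => /Vy.
Qed.

Let V_m D a : a \in fib D -> V D (rank D a) (m a).
Proof. by move=> aD b; rewrite crd_m; case: (eqVneq a b) => [<-|_]; rewrite ?eqxx. Qed.

Lemma gen_space_basis : exists b : 'I_(size L) -> M,
  [/\ forall t, gen_space (b t),
      forall a : 'I_(size L) -> K,
        \sum_t (a t)%:A *: b t = 0 -> forall t, a t = 0
    & forall x, gen_space x -> exists a : 'I_(size L) -> K, x = \sum_t (a t)%:A *: b t].
Proof.
(* A power of Q sends the m a with a in L to generalized eigenvectors, and kills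
   no generalized eigenvector. *)
have [Q [GQ Q0 QL]] := projector; pose N := (size (fib D0)).+1.
pose P := Q ^+ N; have GP : G P by apply: GX.
have QXL r a : a \in L -> diag (Q ^+ r) a != 0.
  move=> aL; elim: r => [|r IHr]; first by rewrite diag1 oner_neq0.
  by rewrite exprS diagM ?mulf_neq0 ?QL //; apply: G_tri => //; apply: GX.
have PL a : a \in L -> diag P a != 0 by apply: QXL.
pose e a := P *: m a.
have e_gen a : a \in L -> gen_space (e a).
  move=> aL; exists N => y hy.
  have GY r (z : 'I_r -> U) : (forall t, G (z t)) -> G (\prod_(t < r) z t).
    by move=> Gz; apply: (big_ind G).
  (* Each factor of the product is paired with one factor Q. The diagonal of z t * Q vanishes on all
     of [fib D0]: on L because f (z t) = 0, elsewhere because of Q. So every pair raises the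
     rank. *)
  suff step r j x (z : 'I_r -> U) : (forall t, G (z t) /\ f (z t) = 0) -> V D0 j x ->
      V D0 (j + r) ((\prod_(t < r) z t * Q ^+ r) *: x).
    apply: (@V_top D0); rewrite -[X in V _ X _]add0n scalerA.
    apply: step hy _ => b; rewrite crd_m.
    by case: (eqVneq a b) => [<-|_]; rewrite ?eqxx // => _; rewrite L_fib.
  elim: r j x z => [|r IHr] j x z hz Vx.
    by rewrite big_ord0 expr0 mul1r scale1r addn0.
  rewrite big_ord_recl exprS; set R := \prod_(_ < _) _.
  have GR : G R by apply: GY => t; case: (hz (lift ord0 t)).
  have [Gz0 fz0] := hz ord0.
  have -> : z ord0 * R * (Q * Q ^+ r) = (z ord0 * Q) * (R * Q ^+ r).
    by rewrite -!mulrA; congr (_ * _); rewrite !mulrA (G_comm GR GQ).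
  rewrite -scalerA addnS; apply: V_step => [|b bD|]; first exact: GM.
    rewrite diagM; [|exact: G_tri|exact: G_tri].
    have [bL|bL] := boolP (b \in L); last by rewrite (Q0 b) ?mulr0.
    by rewrite (diag_L bL Gz0) fz0 mul0r.
  by apply: IHr => // t; apply: hz.
have e_V D a : a \in L -> (D0 <= D)%N -> V D (rank D a) (e a).
  by move=> aL DD; apply: V_stable => //; apply/V_m/L_fib.
have e_crd D a b : a \in L -> (D0 <= D)%N -> rank D b = rank D a ->
    crd (e a) b = (a == b)%:R * diag P b.
  by move=> aL DD ab; rewrite (@V_crd D (rank D a)) ?crd_m //; apply/V_m/L_fib.
(* The bound D is arbitrary because x may involve indices of degree greater than those of L. The
   coordinates of lowest rank j are removed by subtracting multiples of the [e a]. *)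
have span D q j x : (D0 <= D)%N -> gen_space x -> V D j x ->
    (j + q)%N = (size (fib D)).+1 -> exists c : T -> K, x = \sum_(a <- L) (c a)%:A *: e a.
  move=> DD; elim: q j x => [|q IHq] j x xg Vx.
    rewrite addn0 => jE; exists (fun=> 0); have -> : x = 0 by apply: (@V_top D); rewrite -jE.
    by rewrite big1 // => a _; rewrite scale0r scale0r.
  rewrite addnS -addSn => jq.
  (* On a coordinate of lowest rank, g s - f (g s) acts by a nonzero scalar, while a power of it
     kills x. *)
  have x_out b : b \notin L -> rank D b = j -> crd x b = 0.
    move=> /sepL[s hs] bj; pose y := - f (g s) *: 1 + g s.
    have Gy : G y by apply: GL.
    have fy : f y = 0 by case: f_char => f1 fL _; rewrite /y fL // f1 mulr1 addNr.
    case: xg => r /(_ (fun=> y) (fun=> conj Gy fy)); rewrite prodr_const card_ord => yr.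
    have: crd (y ^+ r *: x) b = crd x b * diag y b ^+ r.
      clear yr; elim: r x Vx => [|r IHr] z Vz; first by rewrite expr0 scale1r mulr1.
      rewrite exprSr -scalerA IHr; last exact: V_stable.
      by rewrite (V_crd Gy Vz) // -mulrA -exprS.
    rewrite yr crd0 => /esym/eqP; rewrite mulf_eq0 expf_eq0 => /orP[/eqP//|/andP[_]].
    by rewrite /y diagL diag1 mulr1 diag_g addrC subr_eq0 (negbTE hs).
  pose d a := if rank D a == j then crd x a / diag P a else 0.
  pose x' := x - \sum_(a <- L) (d a)%:A *: e a.
  have Vx' : V D j x'.
    apply: (subspB (V_subsp D j)) => //; rewrite big_seq.
    apply: (subsp_sum _ (V_subsp D j)) => a aL; rewrite /d.
    case: eqP => [aj|_]; last by rewrite !scale0r; case: (V_subsp D j).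
    by apply: (subspZ _ (V_subsp D j)); rewrite -aj; apply: e_V.
  have x'g : gen_space x'.
    apply: (subspB gen_space_subsp) => //; rewrite big_seq.
    apply: (subsp_sum _ gen_space_subsp) => a aL.
    by apply: (subspZ _ gen_space_subsp); apply: e_gen.
  have Vx'1 : V D j.+1 x'.
    move=> b nz; have [bD jb] := Vx' _ nz; split=> //.
    rewrite ltn_neqAle jb andbT; apply: contraNneq nz => bj.
    rewrite /x' crdD crdN crd_sum.
    have term a : a \in L -> crd ((d a)%:A *: e a) b = (a == b)%:R * crd x b.
      move=> aL; rewrite crdZ /d; case: (eqVneq (rank D a) j) => [aj|aj].
        rewrite (e_crd D) -?bj ?aj //; have [ab|_] := eqVneq a b; last by rewrite !mul0r mulr0.
        by rewrite -ab !mul1r divfK ?PL.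
      rewrite mul0r; have [ab|_] := eqVneq a b; last by rewrite mul0r.
      by rewrite ab -bj eqxx in aj.
    have [bL|bL] := boolP (b \in L).
      rewrite (bigD1_seq b) //= term // eqxx mul1r big_seq_cond big1 ?addr0 ?subrr //.
      by move=> a /andP[aL /negbTE ab]; rewrite term // ab mul0r.
    rewrite (x_out _ bL) // sub0r big_seq big1 ?oppr0 // => a aL.
    by rewrite term // (x_out _ bL) ?mulr0.
  have [c x'E] := IHq _ _ x'g Vx'1 jq; exists (fun a => d a + c a).
  rewrite -[x](subrK (\sum_(a <- L) (d a)%:A *: e a)) -/x' x'E -big_split /=.
  by apply: eq_bigr => a _; rewrite addrC !scalerDl.
have indep (c : T -> K) : \sum_(a <- L) (c a)%:A *: e a = 0 -> forall a, a \in L -> c a = 0.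
  move=> c0; suff h r a : a \in L -> (rank D0 a < r)%N -> c a = 0.
    by move=> a aL; apply: (h (rank D0 a).+1).
  elim: r a => // r IHr a aL; rewrite ltnS leq_eqVlt => /predU1P[ar|]; last exact: IHr.
  have := congr1 (crd^~ a) c0; rewrite /= crd0 crd_sum (bigD1_seq a) //= big_seq_cond big1.
    rewrite crdZ (e_crd D0) // eqxx mul1r addr0 => /eqP.
    by rewrite mulf_eq0 (negbTE (PL _ aL)) orbF => /eqP.
  move=> b /andP[bL ba]; rewrite crdZ; have [rb|rb] := ltnP (rank D0 b) r.
    by rewrite IHr ?mul0r.
  apply/eqP; rewrite mulf_eq0 orbC; apply/orP; left.
  apply: contraNT ba => /(G_tri GP)[->//|[_ ab]].
  by have := rank_lt (L_fib (leqnn _) bL) ab; rewrite ar ltnNge rb.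
have sumL (F : T -> M) : \sum_(a <- L) F a = \sum_(t < size L) F (tnth (in_tuple L) t).
  by rewrite [in LHS](_ : L = in_tuple L) // big_tuple.
exists (fun t => e (tnth (in_tuple L) t)); split=> [t|c c0 t|x xg].
- exact/e_gen/mem_tnth.
- pose c' a := if insub (index a L) is Some t then c t else 0.
  have c'E t' : c' (tnth (in_tuple L) t') = c t'.
    have tL : index (tnth (in_tuple L) t') L = t'.
      by rewrite (tnth_nth (tnth (in_tuple L) t')) /= index_uniq.
    by rewrite /c' tL valK.
  rewrite -c'E; apply: (indep c'); last exact: mem_tnth.
  by rewrite sumL -[RHS]c0; apply: eq_bigr => t' _; rewrite c'E.
- have [s xs] := crd_supp x; pose D := maxn D0 (\max_(a <- s) deg a).
  have [||||c xE] := span D (size (fib D)).+1 0%N x; rewrite ?add0n //; first exact: leq_maxl.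
    move=> b /xs bs; split=> //; rewrite fibP /D leq_max orbC.
    by apply/orP; left; apply: leq_bigmax_seq.
  exists (fun t => c (tnth (in_tuple L) t)).
  by rewrite xE sumL.
Qed.

End Triangular.

(** * Triangularity of the Casimir elements in the basis of monomials *)

Section HighestWeightModule.
Variables (K : numFieldType) (n : nat) (U : algType K) (M : lmodType U).
Variable E : 'I_n -> 'I_n -> U.
Hypothesis E_comm : forall i j k l, E i j * E k l =
  E k l * E i j + (E i l *+ (j == k) - E k j *+ (l == i)).
Hypothesis E_gen : forall P : set U, subalgebra P -> (forall i j, P (E i j)) -> forall u, P u.
Local Notation expo := {ffun 'I_n * 'I_n -> nat}.
Variable v : M.
Let lam (i : 'I_n) : K := i%:R.
Hypothesis v_raise : forall i j : 'I_n, (i < j)%N -> E i j *: v = 0.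
Hypothesis v_weight : forall i : 'I_n, E i i *: v = (lam i)%:A *: v.
Hypothesis v_gen : forall x, exists u : U, x = u *: v.
Hypothesis v_free : forall (s : seq expo) (c : expo -> K), uniq s -> all (@lower_expo n) s ->
  \sum_(a <- s) (c a)%:A *: (gt_mon E a *: v) = 0 -> forall a, a \in s -> c a = 0.

Local Notation lexpo := {a : expo | lower_expo a}.

Definition gtm (a : lexpo) : M := gt_mon E (val a) *: v.

Definition lower_part (a : expo) : expo :=
  [ffun p : 'I_n * 'I_n => if (p.2 < p.1)%N then a p else 0%N].

Lemma lower_partP (a : expo) : lower_expo (lower_part a).
Proof. by apply/forallP => p; apply/implyP => h; rewrite ffunE ltnNge h. Qed.

Definition to_lexpo (a : expo) : lexpo := exist (fun e : expo => lower_expo e) _ (lower_partP a).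

Lemma gt_mon_lower (a : expo) : gt_mon E (lower_part a) = gt_mon E a.
Proof.
apply: eq_bigr => r _; apply: eq_row_mon => j jr.
by rewrite ffunE /= jr.
Qed.

Lemma height_lower k (a : expo) : height k (lower_part a) = height k a.
Proof. by apply: eq_bigr => r _; apply: eq_bigr => j jr; rewrite ffunE /= jr. Qed.

Definition decomposes (c : lexpo -> K) (x : M) := exists s : seq lexpo,
  [/\ uniq s, forall b, c b != 0 -> b \in s & x = \sum_(b <- s) (c b)%:A *: gtm b].

Let sum_supp (c : lexpo -> K) (s s' : seq lexpo) : uniq s -> uniq s' ->
  (forall b, c b != 0 -> b \in s) -> (forall b, c b != 0 -> b \in s') ->
  \sum_(b <- s) (c b)%:A *: gtm b = \sum_(b <- s') (c b)%:A *: gtm b.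
Proof.
have filt t : \sum_(b <- t) (c b)%:A *: gtm b
    = \sum_(b <- [seq b <- t | c b != 0]) (c b)%:A *: gtm b.
  rewrite big_filter [LHS](bigID (fun b => c b != 0)) /= [X in _ + X]big1 ?addr0 //.
  by move=> b /negPn/eqP->; rewrite !scale0r.
move=> us us' cs cs'; rewrite filt [RHS]filt; apply: perm_big.
apply: uniq_perm; rewrite ?filter_uniq // => b; rewrite !mem_filter.
by case: (boolP (c b != 0)) => // cb; rewrite cs ?cs'.
Qed.

Let decomposesL a c c' x x' : decomposes c x -> decomposes c' x' ->
  decomposes (fun b => a * c b + c' b) (a%:A *: x + x').
Proof.
move=> [s [us cs ->]] [s' [us' cs' ->]]; pose t := undup (s ++ s').
have ut : uniq t by apply: undup_uniq.
have ct b : c b != 0 -> b \in t by move/cs => bs; rewrite mem_undup mem_cat bs.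
have ct' b : c' b != 0 -> b \in t by move/cs' => bs; rewrite mem_undup mem_cat bs orbT.
exists t; split=> // [b|].
  by have [-> nz|/ct//] := eqVneq (c b) 0; rewrite mulr0 add0r in nz; apply: ct'.
rewrite (sum_supp us ut cs ct) (sum_supp us' ut cs' ct') scaler_sumr -big_split /=.
apply: eq_bigr => b _; rewrite scalerA mulr_algl [in RHS]scalerDl [in RHS]scalerDl.
by rewrite -(scalerA a).
Qed.

Let decomposes_gtm a : decomposes (fun b => (a == b)%:R) (gtm a).
Proof.
exists [:: a]; split=> // [b|]; last by rewrite big_seq1 eqxx !scale1r.
by have [->|_] := eqVneq a b; rewrite ?mem_head ?eqxx.
Qed.

Let decomposes_ex x : exists c, decomposes c x.
Proof.
have := gt_mon_span E_comm v_raise v_weight E_gen v_gen x.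
apply: (@kspan_min _ _ _ _ [set x | exists c, decomposes c x]).
  split=> [|a y z [c hc] [c' hc']].
    exists (fun=> 0); exists [::]; split=> // [b|]; first by rewrite eqxx.
    by rewrite big_nil.
  by exists (fun b => a * c b + c' b); apply: decomposesL.
move=> _ [a ->]; exists (fun b => (to_lexpo a == b)%:R).
by rewrite -gt_mon_lower; apply: (decomposes_gtm (to_lexpo a)).
Qed.

Let decomposes0 c : decomposes c 0 -> forall b, c b = 0.
Proof.
move=> [s [us cs s0]] b; apply/eqP/negPn/negP => cb.
pose c' (a : expo) := if insub a is Some a' then c a' else 0.
have c'E (a : lexpo) : c' (val a) = c a by rewrite /c' valK.
have := @v_free (map val s) c' _ _ _ (val b).
rewrite c'E => h; case/eqP: (cb); apply: h.
- by rewrite map_inj_uniq //; apply: val_inj.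
- by apply/allP => _ /mapP[a _ ->]; apply: valP.
- by rewrite big_map [RHS]s0; apply: eq_bigr => a _; rewrite c'E.
- by apply: map_f; apply: cs.
Qed.

Let decomposes_uniq c c' x : decomposes c x -> decomposes c' x -> c = c'.
Proof.
move=> hc hc'; apply/funext => b; have := decomposesL (-1) hc hc'.
rewrite scaleN1r scaleN1r addNr => /decomposes0/(_ b)/eqP.
by rewrite mulN1r addrC subr_eq0 => /eqP.
Qed.

Definition crd (x : M) : lexpo -> K := projT1 (cid (decomposes_ex x)).

Let crdP x : decomposes (crd x) x.
Proof. exact: projT2 (cid (decomposes_ex x)). Qed.

Lemma crdL a x y b : crd (a%:A *: x + y) b = a * crd x b + crd y b.
Proof. by rewrite (decomposes_uniq (crdP _) (decomposesL a (crdP x) (crdP y))). Qed.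

Lemma crd_gtm a b : crd (gtm a) b = (a == b)%:R.
Proof. by rewrite (decomposes_uniq (crdP _) (decomposes_gtm a)). Qed.

Lemma crd_supp x : exists s : seq lexpo, forall b, crd x b != 0 -> b \in s.
Proof. by have [s [_ cs _]] := crdP x; exists s. Qed.

Lemma crd_inj x : (forall b, crd x b = 0) -> x = 0.
Proof.
move=> x0; have [s [_ _ ->]] := crdP x.
by rewrite big1 // => b _; rewrite x0 !scale0r.
Qed.

Let crd0 b : crd 0 b = 0.
Proof.
have := crdL 1 0 0 b; rewrite scaler0 addr0 mul1r => h.
by apply: (addrI (crd 0 b)); rewrite addr0 -h.
Qed.

Let crdZ a x b : crd (a%:A *: x) b = a * crd x b.
Proof. by rewrite -[_ *: x]addr0 crdL crd0 addr0. Qed.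

Lemma crd_kspan (P : lexpo -> Prop) x :
  kspan [set y | exists a : expo, P (to_lexpo a) /\ y = gt_mon E a *: v] x ->
  forall b, crd x b != 0 -> P b.
Proof.
apply: (@kspan_min _ _ _ _ [set x | forall b, crd x b != 0 -> P b]).
  split=> [b|a y z hy hz b]; first by rewrite crd0 eqxx.
  by rewrite crdL; have [->|/hy//] := eqVneq (crd y b) 0; rewrite mulr0 add0r => /hz.
move=> _ [a [Pa ->]] b; rewrite -gt_mon_lower.
rewrite -[_ *: v]/(gtm (to_lexpo a)) crd_gtm.
by have [<-|_] := eqVneq (to_lexpo a) b; rewrite ?eqxx.
Qed.

(** Each factor E_rj counts r - j >= 1, so finitely many monomials have degree at most D. The degree
    depends only on the weight and is therefore preserved by elements that commute with the E_ii. *)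
Definition degree (a : lexpo) : nat :=
  \sum_(r < n) \sum_(j < n | (j < r)%N) (r - j) * val a (r, j).

Let wt (a : lexpo) (i : 'I_n) : K := lam i + \sum_(r < n) row_weight K (val a) r i.

Let gtm_weight a i : E i i *: gtm a = (wt a i)%:A *: gtm a.
Proof. exact: (gt_mon_weight E_comm v_weight). Qed.

Let crd_weight x i b : crd (E i i *: x) b = wt b i * crd x b.
Proof.
move: b; have := gt_mon_span E_comm v_raise v_weight E_gen v_gen x.
apply: (@kspan_min _ _ _ _ [set x | forall b, crd (E i i *: x) b = wt b i * crd x b]).
  split=> [b|a y z hy hz b]; first by rewrite scaler0 crd0 mulr0.
  rewrite scalerDr scale_algC !crdL hy hz mulrDr mulrCA; ring.
move=> _ [a ->] b; rewrite -gt_mon_lower -[_ *: v]/(gtm (to_lexpo a)) gtm_weight.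
rewrite crdZ crd_gtm; have [<-//|_] := eqVneq (to_lexpo a) b.
by rewrite !mulr0.
Qed.

(** The weight is paired with (0, 1, ..., n-1): a factor E_rj contributes r - j. *)
Let wt_degree a b : (forall i, wt a i = wt b i) -> degree a = degree b.
Proof.
have sumE (c : lexpo) : \sum_(i < n) i%:R * wt c i = \sum_(i < n) i%:R * lam i + (degree c)%:R.
  under eq_bigr do rewrite /wt mulrDr mulr_sumr.
  rewrite big_split /= exchange_big /=; congr (_ + _).
  rewrite natr_sum; apply: eq_bigr => r _; rewrite natr_sum.
  under eq_bigr do rewrite mulr_sumr.
  rewrite exchange_big /=; apply: eq_bigr => j jr.
  under eq_bigr do rewrite mulrnAr mulrBr.
  rewrite sumrMnl sumrB natrM natrB ?(ltnW jr) // mulr_natr; congr ((_ - _) *+ _).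
    by rewrite (bigD1 r) //= eqxx mulr1 big1 ?addr0 // => i /negbTE->; rewrite mulr0.
  by rewrite (bigD1 j) //= eqxx mulr1 big1 ?addr0 // => i /negbTE->; rewrite mulr0.
move=> ab; apply/eqP; rewrite -(eqr_nat K); apply/eqP.
apply: (addrI (\sum_(i < n) i%:R * lam i)); rewrite -!sumE.
by apply: eq_bigr => i _; rewrite ab.
Qed.

Definition degree_fiber (D : nat) : seq lexpo :=
  [seq a <- pmap insub [seq [ffun p => val (h p)] | h : {ffun 'I_n * 'I_n -> 'I_D.+1}]
   | (degree a <= D)%N].

Lemma degree_fiberP D a : (a \in degree_fiber D) = (degree a <= D)%N.
Proof.
rewrite mem_filter; case: (leqP (degree a) D) => //= aD.
rewrite mem_pmap_sub; apply/mapP.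
have aD' p : (val a p < D.+1)%N.
  rewrite ltnS; apply: leq_trans aD; case: p => r j; have [jr|rj] := ltnP j r.
    rewrite /degree (bigD1 r) //= (bigD1 j) //=; set x := val a _.
    by apply: leq_trans (leq_addr _ _); apply: leq_trans (leq_addr _ _); rewrite leq_pmull ?subn_gt0.
  by have /forallP/(_ (r, j)) := valP a; rewrite /= rj /= => /eqP->.
exists [ffun p => inord (val a p)]; first by rewrite mem_enum.
by apply/ffunP => p; rewrite !ffunE inordK.
Qed.

(** A Casimir element of gl_k strictly raises [height k] and does not lower [height l] for l >= k;
    for l < k there is no control. The condition on all l >= k makes relations with different k
    compose. *)
Definition dominates (b a : lexpo) := exists k, [/\ (k <= n)%N,
  (height k (val a) < height k (val b))%N &
  forall l, (k <= l <= n)%N -> (height l (val a) <= height l (val b))%N].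

Lemma dominates_trans a b c : dominates a b -> dominates b c -> dominates a c.
Proof.
move=> [k [kn ba hk]] [l [ln cb hl]]; case: (leqP k l) => kl.
  exists l; split=> // [|q /andP[lq qn]].
    by apply: leq_trans cb _; apply: hk; rewrite kl.
  by apply: leq_trans (hl q _) (hk q _); rewrite ?lq ?qn ?(leq_trans kl).
exists k; split=> // [|q /andP[kq qn]].
  by apply: leq_ltn_trans (hl k _) ba; rewrite ltnW.
by apply: leq_trans (hl q _) (hk q _); rewrite ?kq ?qn ?(leq_trans (ltnW kl)).
Qed.

Lemma dominates_irr a : ~ dominates a a.
Proof. by move=> [k [_]]; rewrite ltnn. Qed.

Definition gt_elem (s : mu n) : U := casimir E (tag s).+1 (tagged s).+1.

(* Minus the entry of index (k - 1, j) of the pattern of [a]. *)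
Definition col_sum k (a : expo) (j : nat) : nat :=
  \sum_(r < n | (k <= r)%N) oapp (fun j' => a (r, j')) 0%N (insub j).

(** With k = tag s + 1, the weight of [upmon k a *: v] at j is j minus the column sum, and the shift
    k - 1 - j in [hwt] cancels this j. This is the effect of the highest weight (0, 1, ..., n-1). *)
Definition gt_eigenvalue (a : lexpo) (s : mu n) : K :=
  casimir_ev (tag s).+1 (fun j => (tag s)%:R - (col_sum (tag s).+1 (val a) j)%:R) (tagged s).+1.

Lemma gt_elem_comm s t : gt_elem s * gt_elem t = gt_elem t * gt_elem s.
Proof. exact: casimir_casimir_comm. Qed.

Lemma gt_elem_tri s a b :
  crd (gt_elem s *: gtm a - (gt_eigenvalue a s)%:A *: gtm a) b != 0 ->
  degree b = degree a /\ dominates b a.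
Proof.
set k := (tag s).+1; set c := gt_elem s; set t := gt_eigenvalue a s.
have kn : (k <= n)%N := ltn_ord (tag s).
set y := _ - _; move=> nz; split.
  apply: wt_degree => i; apply/eqP; rewrite -subr_eq0.
  have : wt b i * crd y b = wt a i * crd y b.
    rewrite -crd_weight.
    have -> : E i i *: y = (wt a i)%:A *: y.
      rewrite /y scalerBr scalerA casimir_diag_comm // -scalerA gtm_weight !scale_algC.
      by rewrite gtm_weight scale_algC -scalerBr.
    by rewrite crdZ.
  by move/eqP; rewrite -subr_eq0 -mulrBl mulf_eq0 (negbTE nz) orbF.
(* For l >= k the filtration attached to l is stable under gl_l, which contains gl_k. *)
have low l : (k <= l <= n)%N -> gtspan E v l (height l (val a)) y.
  move=> /andP[kl ln]; set W := gtspan _ _ _ _.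
  have sW : subsp W by apply: gtspan_subsp.
  have Wa : W (gtm a) by apply: sub_kspan; exists (val a).
  have stW : stable E k W.
    move=> i j ik jk; apply: (gtspan_stable E_comm v_raise v_weight ln).
      exact: leq_trans ik kl.
    exact: leq_trans jk kl.
  apply: (subspB sW); last by apply: (subspZ _ sW).
  rewrite /c /gt_elem /casimir scaler_suml; apply: (subsp_sum _ sW) => i ik.
  exact: (mpow_stable sW stW).
(* The Casimir element commutes with the rows below k, hence acts directly on [upmon k a *: v], a
   highest weight vector of gl_k modulo W. *)
have high : gtspan E v k (height k (val a)).+1 y.
  set W := gtspan _ _ _ _.
  have sW : subsp W by apply: gtspan_subsp.
  have stW : stable E k W by apply: (gtspan_stable E_comm v_raise v_weight kn).
  set x := upmon E k (val a) *: v.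
  pose mu j : K := j%:R - (col_sum k (val a) j)%:R.
  have x_raise (i j : 'I_n) : (i < j < k)%N -> W (E i j *: x).
    by move=> ijk; apply: upspan_gtspan => //; apply: upmon_raise.
  have x_weight (i : 'I_n) : (i < k)%N -> W (E i i *: x - (mu i)%:A *: x).
    move=> ik; rewrite (upmon_weight E_comm v_weight) // (_ : _ - _ = 0); first by case: sW.
    rewrite /mu /col_sum; under [X in _ - (_ - X%:R)%:A *: _]eq_bigr do rewrite valK.
    by rewrite subrr.
  have := casimir_hw E_comm kn sW stW x_raise x_weight (tagged s).+1.
  rewrite -/(gt_elem s) -/c.
  have -> : \sum_(0 <= i < k) hwt (fun i => mu i + (k.-1 - i)%:R) k (tagged s).+1 i = t.
    apply: eq_big_nat => i /andP[_ ik]; apply: eq_hwt => // j jk.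
    rewrite /mu natrB /=; last by rewrite -ltnS.
    by ring.
  move=> Wx; have -> : y = lowmon E k (val a) *: (c *: x - t%:A *: x).
    rewrite /y /gtm (gt_mon_split _ _ kn) -scalerA -/x scalerBr scale_algC; congr (_ - _).
    rewrite scalerA [RHS]scalerA; congr (_ *: _).
    apply: (lowmon_ind (Q := fun u => c * u = u * c)) => //.
    - by rewrite mul1r mulr1.
    - by move=> u u' /= hu hu'; rewrite mulrA hu -[u * c * u']mulrA hu' mulrA.
    - move=> r j rk jr; rewrite casimir_comm //.
      exact: ltn_trans rk.
  move: (c *: x - _) Wx => z.
  apply: (lowmon_ind (Q := fun u => forall z, W z -> W (u *: z))) => //.
  - by move=> z'; rewrite scale1r.
  - by move=> u u' hu hu' z' Wz; rewrite -scalerA; apply: hu; apply: hu'.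
  - by move=> r j rk jr z' Wz; apply: stW => //; apply: ltn_trans rk.
have heightE (P : nat -> bool) l (z : M) : 
    kspan [set x | exists e, P (height l e) /\ x = gt_mon E e *: v] z ->
    forall d, crd z d != 0 -> P (height l (val d)).
  move=> h; apply: (@crd_kspan (fun d => P (height l (val d)))).
  apply: kspan_min h; first exact: kspan_subsp.
  by move=> _ [e [Pe ->]]; apply: sub_kspan; exists e; rewrite height_lower.
exists k; split=> // [|l /low h].
  exact: (heightE (fun h => height k (val a) < h)%N k y high).
exact: (heightE (fun h => height l (val a) <= h)%N l y h).
Qed.

Lemma hw_gen_space_basis f (L : seq lexpo) : alg_character gt_elem f -> uniq L ->
  (forall a, a \in L <-> forall s, gt_eigenvalue a s = f (gt_elem s)) ->
  exists b : 'I_(size L) -> M,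
  [/\ forall t, gen_space gt_elem f (b t),
      forall a : 'I_(size L) -> K,
        \sum_t (a t)%:A *: b t = 0 -> forall t, a t = 0
    & forall x, gen_space gt_elem f x -> exists a : 'I_(size L) -> K,
        x = \sum_t (a t)%:A *: b t].
Proof.
move=> fc uL LP.
exact: (gen_space_basis gt_elem_comm crdL crd_gtm crd_supp crd_inj dominates_trans
  dominates_irr degree_fiberP gt_elem_tri fc uL LP).
Qed.

Lemma hw_character (a : lexpo) : exists f, alg_character gt_elem f /\
  forall s, f (gt_elem s) = gt_eigenvalue a s.
Proof.
exists (diag gtm crd ^~ a).
exact: (diag_character crdL crd_gtm crd_supp crd_inj dominates_trans
  dominates_irr gt_elem_tri).
Qed.

End HighestWeightModule.

(** * The combinatorics of patterns *)

Section Patterns.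
Variable n : nat.
Implicit Types (z w : {ffun mu n -> int}) (a b : mu n).

(* The linear order of the indices along which the entries of an element of
   P(Omega^+(0)) decrease. *)
Definition chain_le a b : bool :=
  ~~ ((tag a < tag b)%N || ((tag b == tag a :> nat) && (tagged b < tagged a)%N)).

(** The position in the chain as a number, lexicographic in row and column since n + 1 exceeds every
    column index. It gives transitivity and minimal elements. *)
Definition chain_key a : nat := (n - tag a) * n.+1 + tagged a.

Lemma chain_leE a b : chain_le a b = (chain_key a <= chain_key b)%N.
Proof.
have ha : (tagged a < n.+1)%N := leq_trans (ltn_ord (tagged a)) (leqW (ltn_ord (tag a))).
have hb : (tagged b < n.+1)%N := leq_trans (ltn_ord (tagged b)) (leqW (ltn_ord (tag b))).
have ka := ltn_ord (tag a); have kb := ltn_ord (tag b).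
rewrite /chain_le /chain_key; move: (nat_of_ord (tagged a)) (nat_of_ord (tagged b)) ha hb.
move: (nat_of_ord (tag a)) (nat_of_ord (tag b)) ka kb => k l kn ln i j ik jl.
by case: (ltngtP k l) => kl /=; rewrite ?kl; nia.
Qed.

Lemma c_vecE a b : c_vec a b = - (chain_le a b : nat)%:Z.
Proof. by rewrite ffunE /chain_le; case: ifP. Qed.

Lemma P_OmegaP z : P_Omega (Omega_plus (0 : {ffun mu n -> int})) z <->
  D0 z /\ forall a b, tag a = (tag b).+1 :> nat -> z b <= z a.
Proof.
split=> [[Dz Oz]|[Dz hz]]; split=> //.
  move=> a b ab; have : [set a; b]%SET \in Omega_plus z.
    by rewrite Oz; apply/imsetP; exists (a, b) => //; rewrite inE /= ab eqxx !ffunE.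
  (* Edges are unoriented; the row numbers tell which endpoint is which. *)
  case/imsetP => -[a' b']; rewrite inE /= => /andP[/eqP ab' zab] e.
  have : a \in [set a'; b']%SET by rewrite -e set21.
  have : b \in [set a'; b']%SET by rewrite -e set22.
  rewrite !inE => /orP[]/eqP eb /orP[]/eqP ea; move: ab; rewrite ea eb ?ab' //; lia.
apply/setP => e; apply/imsetP/imsetP => -[p]; rewrite inE => /andP[/eqP tp zp] ->.
  by exists p => //; rewrite inE tp eqxx !ffunE.
by exists p => //; rewrite inE tp eqxx hz.
Qed.

Lemma P_Omega_chain z : P_Omega (Omega_plus (0 : {ffun mu n -> int})) z <->
  Zmu0 z /\ forall a b, chain_le a b -> z b <= z a.
Proof.
split=> [/P_OmegaP[[Z0 Dz] hz]|[Z0 hz]]; last first.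
  apply/P_OmegaP; split; first split=> //.
    by move=> k i j kn ij; apply: hz; rewrite /chain_le /= ltnn eqxx -leqNgt.
  move=> a b ab; apply: hz; rewrite /chain_le.
  have -> : (tag a < tag b)%N = false by lia.
  by have -> : (tag b == tag a :> nat) = false by lia.
split=> // a b; rewrite /chain_le negb_or -leqNgt negb_and -leqNgt => /andP[ba].
have row (k : 'I_n) (i j : 'I_k.+1) : (i <= j)%N -> z (idx j) <= z (idx i).
  have [kn|kn] := ltnP k.+1 n; first exact: Dz.
  have kE : k.+1 = n by apply/eqP; rewrite eqn_leq ltn_ord.
  by rewrite !Z0.
move: ba; rewrite leq_eqVlt => /orP[/eqP eab|ba _].
  rewrite (introT eqP eab) /= => ij.
  case: a b eab ij => [k i] [l j] /= /val_inj e; subst l => ij.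
  exact: (row k i j ij).
(* Rows further apart are linked through the first entry of each row in between. *)
have: ((tag a - tag b).-1 + (tag b).+1)%N = tag a by lia.
move: (tag a - tag b).-1 => d; elim: d a {ba} => [|d IHd] a da; first by apply: hz; rewrite -da.
have an := ltn_ord (tag a).
have kn : ((tag a).-1 < n)%N by lia.
apply: le_trans (IHd (idx (ord0 : 'I_(Ordinal kn).+1)) _) _; first by rewrite /= -da; lia.
by apply: hz => /=; rewrite -da; lia.
Qed.

(** For the inclusion into the cone, induction on the sum of the absolute values: if a is the first
    negative entry of the chain, all later entries are negative too, so subtracting [c_vec a] adds 1
    from a onwards and keeps the sequence decreasing and nonpositive. *)
Lemma P_Omega_cone : (0 < n)%N ->
    P_Omega (Omega_plus (0 : {ffun mu n -> int}))
    = [set z | exists m : mu n -> nat,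
         z = \sum_(a : mu n | ((tag a).+1 < n)%N) c_vec a *+ m a].
Proof.
move=> n_gt0; apply/seteqP; split=> z; last first.
  move=> [m ->]; apply/P_Omega_chain.
  have sE b : (\sum_(a : mu n | ((tag a).+1 < n)%N) c_vec a *+ m a) b
     = - \sum_(a : mu n | ((tag a).+1 < n)%N) (chain_le a b * m a)%:Z.
    rewrite sum_ffunE -sumrN; apply: eq_bigr => a _.
    by rewrite ffunMnE c_vecE mulNrn -mulr_natr natz -PoszM.
  split=> [b bn|b c bc]; rewrite ?sE.
    rewrite big1 ?oppr0 // => a an; rewrite /chain_le (_ : (tag a < tag b)%N) //.
    by lia.
  rewrite lerN2; apply: ler_sum => a _; rewrite lez_nat leq_mul2r.
  case: (boolP (chain_le a b)) => ab; last by rewrite orbT.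
  by rewrite (_ : chain_le a c) ?orbT //; move: ab bc; rewrite !chain_leE; apply: leq_trans.
move/P_Omega_chain.
have: (\sum_b `|z b|%N < (\sum_b `|z b|%N).+1)%N by [].
move: (X in (_ < X)%N) => N; elim: N z => // N IHN z.
rewrite ltnS => zN [Z0 hz].
have z_le0 b : z b <= 0.
  have kn : (n.-1 < n)%N by rewrite prednK.
  rewrite -(Z0 (idx (ord0 : 'I_(Ordinal kn).+1))) /= ?prednK //; apply: hz.
  rewrite /chain_le /= negb_or -leqNgt -ltnS prednK // ltn_ord /=.
  by rewrite ltn0 andbF.
have [zn|/forallPn[a0 /negP a0z]] := boolP [forall b, z b == 0].
  exists (fun=> 0%N); rewrite big1 => [|a _]; last by rewrite mulr0n.
  by apply/ffunP => b; rewrite ffunE; apply/eqP/(forallP zn).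
have {}a0z : z a0 < 0 by rewrite lt_neqAle z_le0 andbT; apply/negP.
case: (@arg_minnP _ a0 (fun a => z a < 0) chain_key a0z) => a az amin.
pose z' := z - c_vec a.
have z'E b : z' b = z b + (chain_le a b : nat)%:Z.
  by rewrite -[LHS]/((z - c_vec a) b) ffunE [X in _ + X]ffunE c_vecE opprK.
have z_lt b : chain_le a b -> z b < 0 by move=> /hz zb; apply: le_lt_trans az.
have an : ((tag a).+1 < n)%N.
  rewrite ltn_neqAle ltn_ord andbT; apply/negP => /eqP/Z0 za.
  by rewrite za ltxx in az.
have [m z'm] : exists m : mu n -> nat,
    z' = \sum_(a : mu n | ((tag a).+1 < n)%N) c_vec a *+ m a.
  apply: IHN; last split.
  - apply: leq_trans zN; rewrite (bigD1 a) //= [X in (_ < X)%N](bigD1 a) //=.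
    rewrite -addSn; apply: leq_add.
      rewrite z'E /chain_le ltnn eqxx ltnn /=; move: az; clear; lia.
    apply: leq_sum => b _; rewrite z'E; have := z_lt b; case: chain_le => h; last by rewrite addr0.
    by move: (h isT); clear; lia.
  - move=> b bn; rewrite z'E Z0 // /chain_le (_ : (tag a < tag b)%N) //; lia.
  - move=> b c bc; rewrite !z'E; have zbc := hz _ _ bc.
    have [ab|ab] := boolP (chain_le a b).
      rewrite (_ : chain_le a c) ?lerD2r //.
      by move: ab bc; rewrite !chain_leE; apply: leq_trans.
    have [ac|ac] := boolP (chain_le a c); last by rewrite !addr0.
    have zb0 : 0 <= z b.
      rewrite leNgt; apply: contra ab => /amin.
      by rewrite chain_leE.
    by have := z_lt c ac; move: zb0; clear; lia.
exists (fun b => (m b + (b == a))%N).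
have -> : z = z' + c_vec a by rewrite /z' subrK.
rewrite z'm [in RHS](bigD1 a) //= [in LHS](bigD1 a) //= eqxx addn1 mulrSr -!addrA.
congr (_ + _); rewrite addrC; congr (_ + _).
by apply: eq_bigr => b /andP[_ /negbTE->]; rewrite addn0.
Qed.

End Patterns.

(** * Interlacing patterns in an orbit *)

Section Orbits.
Variable n : nat.
Hypothesis n_gt0 : (0 < n)%N.
Implicit Types (z w : {ffun mu n -> int}).
Local Notation expo := {ffun 'I_n * 'I_n -> nat}.
Local Notation lexpo := {a : expo | lower_expo a}.

(** Natural number indices make it possible to compare equal columns of rows of different
    lengths. *)
Definition entry w (k i : nat) : int :=
  oapp (fun k' : 'I_n => w (idx (inord i : 'I_k'.+1))) 0 (insub k).

Lemma entryE w (k : 'I_n) (i : 'I_k.+1) : entry w k i = w (idx i).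
Proof. by rewrite /entry valK /= inord_val. Qed.

Lemma eq_entry w w' : (forall k i, (i <= k < n)%N -> entry w k i = entry w' k i) -> w = w'.
Proof.
move=> ww; apply/ffunP => -[k i]; rewrite -[existT _ k i]/(idx i) -!entryE ww //.
by rewrite -ltnS !ltn_ord.
Qed.

(** The inequalities say that w_{k+1,i} - w_{k,i}, the exponent of E_{k+1,i}, is nonnegative. *)
Definition interlacing w := Zmu0 w /\
  forall k i, (i <= k)%N -> (k.+1 < n)%N -> entry w k i <= entry w k.+1 i.

Lemma entry_top w i : Zmu0 w -> (i < n)%N -> entry w n.-1 i = 0.
Proof.
move=> w0 i_n; have kn : (n.-1 < n)%N by rewrite prednK.
have ik : (i < (Ordinal kn).+1)%N by rewrite /= prednK.
have := entryE w (Ordinal ik) => /= ->.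
by rewrite w0 //= prednK.
Qed.

Definition pattern_of (a : expo) : {ffun mu n -> int} :=
  [ffun s : mu n => - (col_sum (tag s).+1 a (tagged s))%:Z].

Lemma entry_pattern a k i : (i <= k < n)%N -> entry (pattern_of a) k i = - (col_sum k.+1 a i)%:Z.
Proof.
move=> /andP[ik kn]; have ik' : (i < (Ordinal kn).+1)%N by [].
by have := entryE (pattern_of a) (Ordinal ik') => /= ->; rewrite ffunE.
Qed.

Lemma col_sumS (r j : 'I_n) a : col_sum r a j = (a (r, j) + col_sum r.+1 a j)%N.
Proof.
rewrite /col_sum (bigD1 r) //= valK /=; congr (_ + _)%N; apply: eq_bigl => s.
by rewrite -val_eqE /= ltn_neqAle eq_sym andbC.
Qed.

Lemma col_sum_n (a : expo) j : col_sum n a j = 0%N.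
Proof. by rewrite /col_sum big1 // => r; rewrite leqNgt ltn_ord. Qed.

Lemma pattern_interlacing a : interlacing (pattern_of a).
Proof.
split=> [s sn|k i ik kn].
  rewrite ffunE; suff -> : col_sum (tag s).+1 a (tagged s) = 0%N by rewrite oppr0.
  by rewrite /col_sum big1 // => r sr; move: (ltn_ord r) sr; rewrite -[X in (_ < X)%N]sn ltnNge => /negbTE->.
rewrite !entry_pattern ?ik ?(ltnW kn) ?(leqW ik) //.
have i_n : (i < n)%N by lia.
have := col_sumS (Ordinal kn) (Ordinal i_n) a; rewrite /= => ->.
by rewrite lerN2 lez_nat leq_addl.
Qed.

Definition expo_of w : expo := [ffun p : 'I_n * 'I_n =>
  if (p.2 < p.1)%N then `|entry w p.1 p.2 - entry w p.1.-1 p.2|%N else 0%N].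

Lemma expo_of_lower w : lower_expo (expo_of w).
Proof. by apply/forallP => p; apply/implyP => h; rewrite ffunE ltnNge h. Qed.

Lemma expo_ofK w : interlacing w -> pattern_of (expo_of w) = w.
Proof.
move=> [w0 hw]; apply: eq_entry => k i /andP[ik kn].
rewrite entry_pattern ?ik //.
suff -> : (col_sum k.+1 (expo_of w) i)%:Z = - entry w k i by rewrite opprK.
have: ((n.-1 - k) + k)%N = n.-1 by rewrite subnK // -ltnS prednK.
move: (n.-1 - k)%N => d; elim: d k ik {kn} => [|d IHd] k ik.
  rewrite add0n => kn; rewrite kn prednK // col_sum_n entry_top ?oppr0 //.
  by rewrite (leq_ltn_trans ik) // kn prednK.
rewrite addSnnS => dk; have kn : (k.+1 < n)%N by move: dk n_gt0; lia.
have i_n : (i < n)%N by lia.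
have := col_sumS (Ordinal kn) (Ordinal i_n) (expo_of w); rewrite /= => ->.
rewrite PoszD IHd ?(leqW ik) // ffunE /= ltnS ik /=.
rewrite gez0_abs ?subr_ge0 ?hw //.
by rewrite addrAC subrr add0r.
Qed.

Lemma pattern_of_inj (a b : expo) : lower_expo a -> lower_expo b ->
  pattern_of a = pattern_of b -> a = b.
Proof.
move=> /forallP la /forallP lb e; apply/ffunP => -[r j].
have [jr|rj] := ltnP j r; last first.
  by have := la (r, j); have := lb (r, j); rewrite /= rj /= => /eqP-> /eqP->.
have cE k : (j <= k < n)%N -> col_sum k.+1 a j = col_sum k.+1 b j.
  by move=> jk; have := congr1 (fun w => entry w k j) e; rewrite !entry_pattern // => /oppr_inj[].
have r0 : (0 < r)%N by apply: leq_ltn_trans jr.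
have h1 : col_sum r a j = col_sum r b j.
  by rewrite -(prednK r0); apply: cE; have := ltn_ord r; lia.
have h2 : col_sum r.+1 a j = col_sum r.+1 b j by apply: cE; rewrite (ltnW jr) ltn_ord.
by move: h1; rewrite !col_sumS h2 => /addIn.
Qed.

Lemma permuteE (s : S_mu n) z (k : 'I_n) (i : 'I_k.+1) :
  permute s z (idx i) = z (idx (s k i)).
Proof. by rewrite ffunE. Qed.

Lemma S_piP (s : S_mu n) : reflect (forall k : 'I_n, k.+1 = n -> s k = 1%g) (s \in S_pi n).
Proof.
rewrite inE; apply: (iffP forallP) => h k.
  by move=> kn; have /implyP/(_ (introT eqP kn))/eqP := h k.
by apply/implyP => /eqP/h/eqP.
Qed.

Definition orbit_seq z : seq {ffun mu n -> int} := undup [seq permute s z | s in S_pi n].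

Lemma orbit_seqP z w : reflect (exists2 s, s \in S_pi n & w = permute s z) (w \in orbit_seq z).
Proof.
rewrite mem_undup; apply: (iffP fintype.imageP) => -[s hs hw]; first by exists s.
by exists s.
Qed.

Definition rowwise_mul (s t : S_mu n) : S_mu n := [ffun k : 'I_n => (s k * t k)%g].

Lemma permute_mul s t z : permute t (permute s z) = permute (rowwise_mul t s) z.
Proof. by apply/ffunP => a; rewrite !ffunE /= permM. Qed.

Lemma in_stab z s : (s \in stab z) = (s \in S_pi n) && (permute s z == z).
Proof. by rewrite finset.in_set. Qed.

(** Orbit-stabilizer formula: the fibres of s |-> [permute s z] on [S_pi] are translates of the
    stabilizer. *)
Lemma card_S_pi z : #|S_pi n| = (size (orbit_seq z) * #|stab z|)%N.
Proof.
have fibre o : o \in orbit_seq z -> #|[set s in S_pi n | permute s z == o]%SET| = #|stab z|.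
  move=> /orbit_seqP[t tS ->].
  pose tV : S_mu n := [ffun k : 'I_n => (t k)^-1%g].
  have mulK s : rowwise_mul tV (rowwise_mul t s) = s.
    by apply/ffunP => k; rewrite !ffunE mulKg.
  have mulVK s : rowwise_mul t (rowwise_mul tV s) = s.
    by apply/ffunP => k; rewrite !ffunE mulKVg.
  have tVS : tV \in S_pi n by apply/S_piP => k kn; rewrite ffunE (S_piP _ tS) // invg1.
  have mulS s s' : s \in S_pi n -> s' \in S_pi n -> rowwise_mul s s' \in S_pi n.
    move=> /S_piP hs /S_piP hs'; apply/S_piP => k kn.
    by rewrite ffunE hs // hs' // mulg1.
  rewrite -(card_imset (stab z) (can_inj mulK)); congr #|pred_of_set _|.
  apply/setP => s; apply/idP/imsetP => [|[s' + ->]].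
    rewrite finset.in_set => /andP[sS /eqP sz]; exists (rowwise_mul tV s); last by rewrite mulVK.
    rewrite in_stab mulS //= -permute_mul; apply/eqP.
    rewrite -[RHS](_ : permute (rowwise_mul tV t) z = z).
      by rewrite -permute_mul sz permute_mul.
    by apply/ffunP => a; rewrite !ffunE mulVg perm1; case: a.
  rewrite in_stab => /andP[s'S /eqP s'z]; rewrite finset.in_set mulS //=.
  by rewrite -permute_mul s'z.
have -> : #|S_pi n| = (\sum_(s in S_pi n) \sum_(o <- orbit_seq z) (permute s z == o))%N.
  rewrite -sum1_card; apply: eq_bigr => s sS.
  rewrite (bigD1_seq (permute s z)) ?undup_uniq //=; last by apply/orbit_seqP; exists s.
  by rewrite eqxx big1 // => o; rewrite eq_sym => /negbTE->.
rewrite exchange_big /= (eq_big_seq (fun=> #|stab z|)) => [|o oz].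
  by rewrite big_const_seq count_predT iter_addn_0 mulnC.
rewrite -(fibre o oz) -sum1_card big_mkcond [RHS]big_mkcond /=.
by apply: eq_bigr => s _; rewrite [in RHS]finset.in_set; case: (s \in S_pi n); case: eqP.
Qed.

Lemma orbit_interlacing z : D0 z ->
  (forall w, w \in orbit_seq z -> interlacing w) <-> P_Omega (Omega_plus (0 : {ffun mu n -> int})) z.
Proof.
move=> Dz; have Z0 := Dz.1; split; last first.
  move=> /P_OmegaP[_ hz] w.
  move=> /orbit_seqP.
  move=> [s sS ->]; move/S_piP in sS.
  split=> [[k i] kn|k i ik kn].
    by rewrite -[existT _ k i]/(idx i) permuteE Z0.
  have ik1 : (i < (Ordinal (ltnW kn)).+1)%N by [].
  have ik2 : (i < (Ordinal kn).+1)%N by rewrite /= ltnW.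
  have e1 := entryE (permute s z) (Ordinal ik1); have e2 := entryE (permute s z) (Ordinal ik2).
  by rewrite /= in e1 e2; rewrite e1 e2 !permuteE; apply: hz.
move=> h; apply/P_OmegaP; split=> // -[k i] [l j] /= kl.
rewrite -[existT _ k i]/(idx i) -[existT _ l j]/(idx j).
(* This moves the entry i of row k and the entry j of row l to the first column, where interlacing
   compares them. The last row is left alone, being zero. *)
pose s : S_mu n := [ffun r : 'I_n => if r.+1 == n then 1%g
  else tperm ord0 (inord (if r == l then j : nat else i : nat))].
have sS : s \in S_pi n by apply/S_piP => r rn; rewrite ffunE (introT eqP rn).
have [_ /(_ l 0%N (leq0n _))] : interlacing (permute s z) by apply: h; apply/orbit_seqP; exists s.
have lkn : (l.+1 < n)%N by rewrite -kl.
rewrite lkn => /(_ isT).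
have -> : l.+1 = k :> nat by [].
rewrite -[0%N]/(nat_of_ord (ord0 : 'I_l.+1)) entryE.
rewrite -[nat_of_ord (ord0 : 'I_l.+1)]/(nat_of_ord (ord0 : 'I_k.+1)) entryE.
rewrite !permuteE !ffunE eqxx (ltn_eqF lkn) tpermL inord_val.
case: ifP => [/eqP kn|_]; first by rewrite !(Z0 (idx (_ : 'I_k.+1))).
rewrite (_ : (k == l) = false) ?tpermL ?inord_val //.
by apply/eqP => e; move: kl; rewrite e; lia.
Qed.

Variable K : numFieldType.

Lemma gt_eigenvalue_gamma (a : lexpo) (s : mu n) :
  gt_eigenvalue K a s = gamma_at (of_int K (pattern_of (val a))) s.
Proof.
rewrite gamma_atE; apply: eq_big_nat => j /andP[_ jk]; apply: eq_hwt => // i ik.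
rewrite !ffunE /= inordK // addrC; congr (_ + _).
by rewrite rmorphN.
Qed.

Let row_val w k (j : nat) : K := of_int K w (idx (inord j : 'I_(k : 'I_n).+1)) + k%:R.

Let gamma_at_row w (k : 'I_n) (i : 'I_k.+1) :
  gamma_at (of_int K w) (idx i) = casimir_ev k.+1 (row_val w k) i.+1.
Proof. exact: gamma_atE. Qed.

Let row_valE w k : [seq row_val w k j | j <- iota 0 k.+1]
  = [seq x%:~R + k%:R | x <- [tuple w (idx i) | i < k.+1]].
Proof.
rewrite -val_enum_ord -map_comp /= -map_comp; apply: eq_map => i.
by rewrite /= /row_val inord_val ffunE.
Qed.

Lemma gamma_at_orbit w z : Zmu0 w -> Zmu0 z ->
  (forall s, gamma_at (of_int K w) s = gamma_at (of_int K z) s) <->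
  exists2 s, s \in S_pi n & w = permute s z.
Proof.
move=> w0 z0; split=> [h|[s sS ->] [k i]]; last first.
  rewrite -[existT _ k i]/(idx i) !gamma_at_row; apply: casimir_ev_sym.
  rewrite !row_valE; apply: perm_map; apply/tuple_permP; exists (s k).
  congr tval; apply: eq_from_tnth => j.
  by rewrite !tnth_mktuple permuteE.
have row_perm (k : 'I_n) : exists s : 'S_k.+1, (k.+1 == n) ==> (s == 1%g) /\
    forall i, w (idx i) = z (idx (s i)).
  have [kn|kn] := eqVneq k.+1 n.
    by exists 1%g; rewrite eqxx; split=> // i; rewrite w0 ?z0.
  have : perm_eq [tuple w (idx i) | i < k.+1] [tuple z (idx i) | i < k.+1].
    apply: (@perm_map_inj _ _ (fun x : int => x%:~R + k%:R : K)).
      by move=> x y /addIr/intr_inj.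
    rewrite -!row_valE; apply: casimir_ev_sep => -[_|m mk].
      by rewrite /casimir_ev /=.
    by have := h (idx (Ordinal mk)); rewrite !gamma_at_row.
  case/tuple_permP => s sE; exists s; split=> // i.
  have := congr1 (fun t => tnth t i) (val_inj sE).
  by rewrite !tnth_mktuple.
pose s k := sval (cid (row_perm k)).
have hs k := svalP (cid (row_perm k)).
exists (finfun s : S_mu n).
  by apply/S_piP => k kn; rewrite ffunE; have [/implyP/(_ (introT eqP kn))/eqP + _] := hs k.
by apply/ffunP => -[k i]; rewrite -[existT _ k i]/(idx i) permuteE ffunE; apply: (hs k).2.
Qed.

(** The list L of the triangular argument: the basis vectors whose diagonal character is that of
    z. *)
Definition solution_seq z : seq lexpo :=
  [seq exist (fun e : expo => lower_expo e) _ (expo_of_lower w) | w <- orbit_seq z & `[< interlacing w >]].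

Lemma solution_seq_uniq z : uniq (solution_seq z).
Proof.
rewrite map_inj_in_uniq ?filter_uniq ?undup_uniq // => w w'.
rewrite !mem_filter => /andP[/asboolP iw _] /andP[/asboolP iw' _].
by move=> /(congr1 (fun e => pattern_of (val e))) /=; rewrite !expo_ofK.
Qed.

Lemma solution_seqP z (a : lexpo) : Zmu0 z -> a \in solution_seq z <->
  forall s, gt_eigenvalue K a s = gamma_at (of_int K z) s.
Proof.
move=> z0; have [p0 pI] := pattern_interlacing (val a).
split=> [/mapP[w]|h].
  rewrite mem_filter => /andP[/asboolP iw /orbit_seqP ow] ->.
  move=> s; rewrite gt_eigenvalue_gamma /= expo_ofK //.
  by move: s; apply/gamma_at_orbit => //; case: iw.
apply/mapP; exists (pattern_of (val a)).
  rewrite mem_filter; apply/andP; split; first exact/asboolP/pattern_interlacing.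
  apply/orbit_seqP/gamma_at_orbit => // s; rewrite -h.
  exact/esym/gt_eigenvalue_gamma.
apply/val_inj/pattern_of_inj; [exact: valP|exact: expo_of_lower|].
by rewrite expo_ofK //; apply: pattern_interlacing.
Qed.

Lemma size_solution_seq z : D0 z ->
  (size (solution_seq z) == size (orbit_seq z))
    = `[< P_Omega (Omega_plus (0 : {ffun mu n -> int})) z >].
Proof.
move=> Dz; rewrite size_map size_filter -all_count.
apply/allP/asboolP => [h|/(orbit_interlacing Dz) h w /h /asboolP//].
by apply/(orbit_interlacing Dz) => w /h /asboolP.
Qed.

Lemma orbit_seq_gt0 z : (0 < size (orbit_seq z))%N.
Proof.
have : permute [ffun=> 1%g] z \in orbit_seq z.
  by apply/orbit_seqP; exists [ffun=> 1%g] => //; apply/S_piP => k _; rewrite ffunE.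
by case: orbit_seq.
Qed.

End Orbits.

(** * Dimensions of the generalized weight spaces *)

Section Dimension.
Variables (K : fieldType) (U : algType K) (M : lmodType U).

Lemma basis_size_le d d' (b : 'I_d -> M) (b' : 'I_d' -> M) :
  (forall a : 'I_d -> K, \sum_(t < d) (a t)%:A *: b t = 0 -> forall t, a t = 0) ->
  (forall t, exists a : 'I_d' -> K, b t = \sum_(s < d') (a s)%:A *: b' s) ->
  (d <= d')%N.
Proof.
move=> b_free /choice[a bE]; pose A : 'M[K]_(d, d') := \matrix_(t, s) a t s.
suff /eqP <- : row_free A by apply: rank_leq_col.
apply: inj_row_free => u uA; apply/rowP => t; rewrite mxE.
apply: (b_free (u 0)); under eq_bigr do rewrite bE scaler_sumr.
rewrite exchange_big big1 // => s _.
have := congr1 (fun v : 'rV_d' => v 0 s) uA; rewrite !mxE => uAs.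
transitivity ((\sum_(t < d) u 0 t * A t s)%:A *: b' s); last by rewrite uAs !scale0r.
rewrite !scaler_suml; apply: eq_bigr => t' _.
by rewrite mxE scalerA -scalerAl mul1r scalerA.
Qed.

End Dimension.

Section EssentialSupport.
Variables (K : numFieldType) (n : nat).
Implicit Types (M : lmodType (Ugl K n)) (w z : {ffun mu n -> int}).

Lemma gt_elem_gen : gt_elem (@E K n) = @gt_gen K n.
Proof.
apply/funext => s; rewrite /gt_elem.
exact: (esym (gt_genE (@E K n) (tagged s) (ltn_ord (tag s)))).
Qed.

Lemma Gamma_characterP (v : {ffun mu n -> K}) (f : Ugl K n -> K) :
  is_Gamma_character v f <->
  alg_character (@gt_gen K n) f /\ forall a, f (gt_gen K a) = gamma_at v a.
Proof. by split=> [[? ? ? ?]|[[? ? ?] ?]]; split. Qed.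

Lemma chi_character (v : {ffun mu n -> K}) (f : Ugl K n -> K) :
  is_Gamma_character v f -> is_Gamma_character v (chi v).
Proof. by move=> vf; rewrite /chi; case: xgetP => [g _ //|/(_ f)/(_ vf)]. Qed.

Lemma gt_spaceE M (v : {ffun mu n -> K}) :
  gt_space M v = gen_space (M := M) (@gt_gen K n) (chi v).
Proof. by []. Qed.

(** Without a character, [chi v] is the zero function, so that 1 lies in [ker_chi v] and a power of
    1 kills x. *)
Lemma gt_space_eq0 M (v : {ffun mu n -> K}) (x : M) :
  (forall f, ~ is_Gamma_character v f) -> gt_space M v x -> x = 0.
Proof.
move=> vN [r]; have chi0 : chi v = fun=> 0.
  by rewrite /chi; case: xgetP => // f _ /vN.
move=> /(_ (fun=> 1)) <-; last first.
  by move=> _; rewrite /ker_chi chi0; split=> // B [[B1 _ _] _].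
rewrite big1 => [|i _]; last by [].
by rewrite scale1r.
Qed.

Hypothesis n_gt0 : (0 < n)%N.
Let lam (i : nat) : K := i%:R.
Local Notation M := (verma (fun i : 'I_n => lam i)).

Let v_gen (x : M) := verma_gen x.
Let v_free := @verma_free K n lam.

(** The character is the diagonal coefficient of the action at the basis vector of exponents
    [expo_of z]. *)
Lemma verma_character z : interlacing z -> exists f, is_Gamma_character (of_int K z) f.
Proof.
move=> iz; pose a := exist (fun e => @lower_expo n e) _ (expo_of_lower z).
have [f [fc fa]] := hw_character (@Ugl_comm K n) (@Ugl_genP K n)
  (@verma_hw_raise K n lam) (@verma_hw_weight K n lam) v_gen v_free a.
exists f; apply/Gamma_characterP; rewrite -gt_elem_gen; split=> // s.
by rewrite fa gt_eigenvalue_gamma /= expo_ofK.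
Qed.

Lemma verma_gt_space_dim z f : Zmu0 z -> is_Gamma_character (of_int K z) f ->
  has_dim (gt_space M (of_int K z)) (size (solution_seq z)).
Proof.
move=> z0 /chi_character/Gamma_characterP[fc fa].
rewrite gt_spaceE; rewrite -gt_elem_gen in fc fa *.
apply: (hw_gen_space_basis (@Ugl_comm K n) (@Ugl_genP K n)
  (@verma_hw_raise K n lam) (@verma_hw_weight K n lam) v_gen v_free fc).
  exact: solution_seq_uniq.
move=> a; split=> [/(solution_seqP n_gt0 K a z0) h s|h]; first by rewrite h fa.
by apply/(solution_seqP n_gt0 K a z0) => s; rewrite h fa.
Qed.

Lemma has_dim_uniq (N : lmodType (Ugl K n)) (W : set N) d d' :
  has_dim W d -> has_dim W d' -> d = d'.
Proof.
move=> [b [Wb fb sb]] [b' [Wb' fb' sb']]; apply/eqP; rewrite eqn_leq.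
apply/andP; split.
  by apply: (basis_size_le fb) => t; apply: sb'.
by apply: (basis_size_le fb') => t; apply: sb.
Qed.

Lemma card_S_pi_div z : (#|S_pi n| %/ #|stab z|)%N = size (orbit_seq z).
Proof.
rewrite (card_S_pi z) mulnK //; have := orbit_seq_gt0 z.
have S_gt0 : (0 < #|S_pi n|)%N.
  by apply/card_gt0P; exists [ffun=> 1%g]; apply/S_piP => k _; rewrite ffunE.
by move: S_gt0; rewrite (card_S_pi z) muln_gt0 => /andP[].
Qed.

Lemma verma_essential_support :
  P_Omega (Omega_plus (0 : {ffun mu n -> int})) = essential_support M.
Proof.
apply/seteqP; split=> z.
  move=> Pz; have Dz := Pz.1.
  have iz : interlacing z.
    apply: (proj2 (orbit_interlacing n_gt0 Dz) Pz).
    apply/orbit_seqP; exists [ffun=> 1%g]; first by apply/S_piP => k _; rewrite ffunE.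
    by apply/ffunP => -[k i]; rewrite !ffunE perm1.
  have [f fz] := verma_character iz.
  have szE : size (solution_seq z) = size (orbit_seq z).
    by apply/eqP; rewrite size_solution_seq //; apply/asboolP.
  have dimz := verma_gt_space_dim Dz.1 fz; rewrite szE in dimz.
  split=> //; last by rewrite card_S_pi_div.
  have [b [Wb fb _]] := dimz.
  pose t0 := Ordinal (orbit_seq_gt0 z); exists (b t0); first exact: Wb.
  apply/eqP => b0; suff /eqP : (t0 == t0)%:R = 0 :> K by rewrite eqxx oner_eq0.
  apply: (fb (fun t => (t == t0)%:R)).
  rewrite (bigD1 t0) // big1 => [|t /negbTE->]; last by rewrite !scale0r.
  by rewrite b0 scaler0; apply: addr0.
(* A nonzero vector of M[z] forces a character to exist, so the dimension is the number of
   interlacing patterns of the orbit; by hypothesis it is the size of the orbit. *)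
move=> [Dz [x Wx x0] dimz]; have [f fz] : exists f, is_Gamma_character (of_int K z) f.
  apply: contrapT => Nf; case/eqP: x0; apply: (gt_space_eq0 _ Wx) => f fz.
  by case: Nf; exists f.
have := has_dim_uniq (verma_gt_space_dim Dz.1 fz) dimz.
rewrite card_S_pi_div => /eqP; rewrite size_solution_seq //.
by move/asboolP.
Qed.

End EssentialSupport.

Theorem theorem6p6 (R : realType) (n : nat) (n_gt0 : (0 < n)%N) :
  P_Omega (Omega_plus (0 : {ffun mu n -> int}))
    = [set z | exists m : mu n -> nat,
         z = \sum_(a : mu n | ((tag a).+1 < n)%N) c_vec a *+ m a]
  /\ P_Omega (Omega_plus (0 : {ffun mu n -> int}))
    = essential_support (verma (fun i : 'I_n => - rho_tilde R[i] i)).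
Proof.
split; first exact: P_Omega_cone.
have -> : (fun i : 'I_n => - rho_tilde R[i] i) = (fun i : 'I_n => i%:R).
  by apply/funext => i; rewrite /rho_tilde opprK.
exact: verma_essential_support.
Qed.
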